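(* Let $l\in\mathbb{Z}_{>0}$. Forgetting the $2$-arrows, the crystal graph of $B_l$ decomposes into connected components as $$B_l=\bigsqcup_{i=0}^{[l/2]}\ \bigsqcup_{\substack{i\le j_0,j_1\le l-i\\ j_0,j_1\equiv l-i\ (\mathrm{mod}\ 3)}}B^{l,i}_{j_0,j_1}.$$ Moreover, $B^{l,i}_{j_0,j_1}$ is isomorphic to the $U_q(A_2)$-crystal $B^{A_2}(j_0\Lambda_0+j_1\Lambda_1)$.
   Context: **The crystal $B_l$.** $B_l$ is the set of $b=(x_1,x_2,x_3,\bar x_3,\bar x_2,\bar x_1)\in\mathbb{Z}_{\ge0}^6$ with $x_3\equiv\bar x_3\pmod2$ and $s(b)=x_1+x_2+\frac{x_3+\bar x_3}2+\bar x_2+\bar x_1\le l$. Write $(x)_+=\max(x,0)$. The $0$- and $1$-operators are as follows (only changed coordinates indicated); the result is $0$ if it does not lie in $B_l$. $\tilde e_1$: $\bar x_2\mapsto\bar x_2+1,\ \bar x_1\mapsto\bar x_1-1$ if $\bar x_2-\bar x_3\ge(x_2-x_3)_+$; $x_3\mapsto x_3+1,\ \bar x_3\mapsto\bar x_3-1$ if $\bar x_2-\bar x_3<0\le x_3-x_2$; $x_1\mapsto x_1+1,\ x_2\mapsto x_2-1$ if $(\bar x_2-\bar x_3)_+<x_2-x_3$. $\tilde f_1$: $x_1\mapsto x_1-1,\ x_2\mapsto x_2+1$ if $(\bar x_2-\bar x_3)_+\le x_2-x_3$; $x_3\mapsto x_3-1,\ \bar x_3\mapsto\bar x_3+1$ if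 $\bar x_2-\bar x_3\le0<x_3-x_2$; $\bar x_2\mapsto\bar x_2-1,\ \bar x_1\mapsto\bar x_1+1$ if $\bar x_2-\bar x_3>(x_2-x_3)_+$. Put $z_1=\bar x_1-x_1$, $z_2=\bar x_2-\bar x_3$, $z_3=x_3-x_2$, $z_4=(\bar x_3-x_3)/2$, $A=(A_1,\dots,A_6)=(0,\ z_1,\ z_1+z_2,\ z_1+z_2+3z_4,\ z_1+z_2+z_3+3z_4,\ 2z_1+z_2+z_3+3z_4)$. $\tilde f_0$: let $k$ be the smallest index with $A_k=\max A$. $k=1$: $x_1\mapsto x_1+1$; $k=2$: $x_3\mapsto x_3+1,\bar x_3\mapsto\bar x_3+1,\bar x_1\mapsto\bar x_1-1$; $k=3$: $x_3\mapsto x_3+2,\bar x_2\mapsto\bar x_2-1$; $k=4$: $x_2\mapsto x_2+1,\bar x_3\mapsto\bar x_3-2$; $k=5$: $x_1\mapsto x_1+1,x_3\mapsto x_3-1,\bar x_3\mapsto\bar x_3-1$; $k=6$: $\bar x_1\mapsto\bar x_1-1$. $\tilde e_0$: let $k$ be the largest index with $A_k=\max A$. $k=1$: $x_1\mapsto x_1-1$; $k=2$: $x_3\mapsto x_3-1,\bar x_3\mapsto\bar x_3-1,\bar x_1\mapsto\bar x_1+1$; $k=3$: $x_3\mapsto x_3-2,\bar x_2\mapsto\bar x_2+1$; $k=4$: $x_2\mapsto x_2-1,\bar x_3\mapsto\bar x_3+2$; $k=5$: $x_1\mapsto x_1-1,x_3\mapsto x_3+1,\bar x_3\mapsto\bar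 x_3+1$; $k=6$: $\bar x_1\mapsto\bar x_1+1$. The crystal graph has an $i$-arrow $b\to b'$ iff $b'=\tilde f_ib$ (there are also $2$-arrows, which are forgotten here). **The components.** For integers $i,j_0,j_1$ with $0\le i\le l/2$, $i\le j_0,j_1\le l-i$, $j_0,j_1\equiv l-i\pmod3$, put $y_a=(l-i-j_a)/3$ ($a=0,1$) and $$\bar b^{l,i}_{j_0,j_1}=\begin{cases}(0,\,y_1,\,-2y_1+3y_0+i,\,y_0+i,\,y_0+j_0,\,0)&\text{if }j_0\le j_1,\\(0,\,y_0,\,y_0+i,\,2y_1-y_0+i,\,-y_1+2y_0+j_0,\,0)&\text{if }j_0>j_1.\end{cases}$$ $B^{l,i}_{j_0,j_1}$ is the connected component of $B_l$, with respect to $\tilde e_a,\tilde f_a$ ($a=0,1$), containing $\bar b^{l,i}_{j_0,j_1}$. $B^{A_2}(j_0\Lambda_0+j_1\Lambda_1)$ is the crystal of the irreducible highest weight $U_q(A_2)$-module of highest weight $j_0\Lambda_0+j_1\Lambda_1$, where the simple roots of $A_2$ are indexed by $\{0,1\}$. *)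

(* Defs.v *)
From HB Require Import structures.
From mathcomp Require Import all_boot all_order all_algebra.
From mathcomp Require Import boolp classical_sets functions.
From Stdlib Require Import Relations.

Set Implicit Arguments.
Unset Strict Implicit.
Unset Printing Implicit Defensive.

Import Order.TTheory GRing.Theory Num.Theory.

Local Open Scope classical_set_scope.
Local Open Scope ring_scope.

(* The index set {0, 1} of the simple roots of A_2 is 'I_2; a weight of A_2 is
   given by its values 'I_2 -> int on the simple coroots, so that
   j0 Lambda_0 + j1 Lambda_1 is the function 0 |-> j0, 1 |-> j1. *)
Definition weight := 'I_2 -> int.

Definition a2_weight (j0 j1 : nat) : weight :=
  fun a => if a == ord0 then Posz j0 else Posz j1.

(** * Crystals *)

(* A crystal is a set of vertices together with operators that may take the
   extra value 0, here [czero], which is an element of the carrier outside of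
   [cverts].  The weight is given by its graph. *)
Record crystal := Crystal {
  ccarrier : Type;
  czero : ccarrier;
  cverts : set ccarrier;
  ce : 'I_2 -> ccarrier -> ccarrier;
  cf : 'I_2 -> ccarrier -> ccarrier;
  cwt : ccarrier -> weight -> Prop }.

Arguments cverts : clear implicits.
Arguments ce : clear implicits.
Arguments cf : clear implicits.
Arguments cwt : clear implicits.

(* The functions epsilon_a, phi_a are not mentioned: for the crystals below they
   are the lengths of the strings of the operators, hence are preserved by any
   bijection that commutes with the operators. *)
Definition crystal_isomorphic (B C : crystal) : Prop :=
  exists psi : ccarrier B -> ccarrier C,
    [/\ psi (czero B) = czero C,
        set_bij (cverts B) (cverts C) psi,
        forall a b, cverts B b -> psi (ce B a b) = ce C a (psi b),
        forall a b, cverts B b -> psi (cf B a b) = cf C a (psi b) &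
        forall b mu, cverts B b -> (cwt B b mu <-> cwt C (psi b) mu)].

(** * The crystal B_l *)

(* [elt x1 x2 x3 y3 y2 y1] is (x_1, x_2, x_3, \bar x_3, \bar x_2, \bar x_1). *)
Record elt := Elt { x1 : int; x2 : int; x3 : int; y3 : int; y2 : int; y1 : int }.

Definition s (b : elt) : int :=
  x1 b + x2 b + ((x3 b + y3 b) %/ 2)%Z + y2 b + y1 b.

Definition inB (l : nat) (b : elt) : bool :=
  [&& 0 <= x1 b, 0 <= x2 b, 0 <= x3 b, 0 <= y3 b, 0 <= y2 b & 0 <= y1 b]
  && (x3 b == y3 b %[mod 2])%Z && (s b <= l%:Z).

Definition Bl (l : nat) : set elt := [set b | inB l b].

Definition restrB (l : nat) (b : elt) : option elt :=
  if inB l b then Some b else None.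

Definition shift (b : elt) (d1 d2 d3 c3 c2 c1 : int) : elt :=
  Elt (x1 b + d1) (x2 b + d2) (x3 b + d3) (y3 b + c3) (y2 b + c2) (y1 b + c1).

Definition pospart (x : int) : int := Num.max x 0.

(* In [e1] and [f1] the three conditions are exhaustive and mutually exclusive;
   the last one is left implicit in the final branch. *)
Definition e1 (l : nat) (b : elt) : option elt :=
  restrB l
   (if y2 b - y3 b >= pospart (x2 b - x3 b) then shift b 0 0 0 0 1 (-1)
    else if y2 b - y3 b < 0 <= x3 b - x2 b then shift b 0 0 1 (-1) 0 0
    else (* pospart (y2 b - y3 b) < x2 b - x3 b *) shift b 1 (-1) 0 0 0 0).

Definition f1 (l : nat) (b : elt) : option elt :=
  restrB l
   (if pospart (y2 b - y3 b) <= x2 b - x3 b then shift b (-1) 1 0 0 0 0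
    else if y2 b - y3 b <= 0 < x3 b - x2 b then shift b 0 0 (-1) 1 0 0
    else (* y2 b - y3 b > pospart (x2 b - x3 b) *) shift b 0 0 0 0 (-1) 1).

Definition Aseq (b : elt) : seq int :=
  let z1 := y1 b - x1 b in
  let z2 := y2 b - y3 b in
  let z3 := x3 b - x2 b in
  let z4 := ((y3 b - x3 b) %/ 2)%Z in
  [:: 0; z1; z1 + z2; z1 + z2 + 3 * z4; z1 + z2 + z3 + 3 * z4;
      2 * z1 + z2 + z3 + 3 * z4].

(* Positions are counted from 0, so that position k corresponds to A_{k+1}. *)
Definition first_argmax (A : seq int) : nat :=
  find (fun c => all (fun d => d <= c) A) A.

Definition last_argmax (A : seq int) : nat :=
  ((size A).-1 - first_argmax (rev A))%N.

Definition f0 (l : nat) (b : elt) : option elt :=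
  restrB l
   match first_argmax (Aseq b) with
   | 0 => shift b 1 0 0 0 0 0
   | 1 => shift b 0 0 1 1 0 (-1)
   | 2 => shift b 0 0 2 0 (-1) 0
   | 3 => shift b 0 1 0 (-2) 0 0
   | 4 => shift b 1 0 (-1) (-1) 0 0
   | _ => shift b 0 0 0 0 0 (-1)
   end.

Definition e0 (l : nat) (b : elt) : option elt :=
  restrB l
   match last_argmax (Aseq b) with
   | 0 => shift b (-1) 0 0 0 0 0
   | 1 => shift b 0 0 (-1) (-1) 0 1
   | 2 => shift b 0 0 (-2) 0 1 0
   | 3 => shift b 0 (-1) 0 2 0 0
   | 4 => shift b (-1) 0 1 1 0 0
   | _ => shift b 0 0 0 0 0 1
   end.

Definition eB (l : nat) (a : 'I_2) : elt -> option elt :=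
  if a == ord0 then e0 l else e1 l.

Definition fB (l : nat) (a : 'I_2) : elt -> option elt :=
  if a == ord0 then f0 l else f1 l.

(** * The components *)

Definition yidx (l i j : nat) : int := Posz ((l - i - j) %/ 3)%N.

Definition bbar (l i j0 j1 : nat) : elt :=
  let y0 := yidx l i j0 in
  let y1 := yidx l i j1 in
  let i' := i%:Z in let j0' := j0%:Z in
  if (j0 <= j1)%N
  then Elt 0 y1 (- 2 * y1 + 3 * y0 + i') (y0 + i') (y0 + j0') 0
  else Elt 0 y0 (y0 + i') (2 * y1 - y0 + i') (- y1 + 2 * y0 + j0') 0.

(* The triples (i, j0, j1); truncated subtraction is exact as i <= l/2. *)
Definition comp_index (l : nat) : set (nat * nat * nat) :=
  [set t | let: (i, j0, j1) := t in
     [/\ (i <= l./2)%N, (i <= j0 <= l - i)%N, (i <= j1 <= l - i)%N,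
         j0 = l - i %[mod 3] & j1 = l - i %[mod 3]]].

Definition step (l : nat) (b b' : elt) : Prop :=
  Bl l b /\ exists a : 'I_2, eB l a b = Some b' \/ fB l a b = Some b'.

Definition component (l : nat) (t : nat * nat * nat) : set elt :=
  let: (i, j0, j1) := t in
  [set b | Bl l b /\ clos_refl_sym_trans elt (step l) (bbar l i j0 j1) b].

(* max {n | g^n b <> 0} *)
Definition string_length (g : elt -> option elt) (b : elt) (n : nat) : Prop :=
  iter n (obind g) (Some b) <> None /\ iter n.+1 (obind g) (Some b) = None.

(* wt b = \sum_a (phi_a b - epsilon_a b) Lambda_a *)
Definition wtB (l : nat) (b : elt) (mu : weight) : Prop :=
  forall a, exists eps phi : nat,
    [/\ string_length (eB l a) b eps, string_length (fB l a) b phi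
      & mu a = phi%:Z - eps%:Z].

Definition component_crystal (l : nat) (t : nat * nat * nat) : crystal := {|
  ccarrier := option elt;
  czero := None;
  cverts := Some @` component l t;
  ce := fun a => obind (eB l a);
  cf := fun a => obind (fB l a);
  cwt := fun ob mu => exists2 b, ob = Some b & wtB l b mu |}.

(** * The crystal of an irreducible highest weight U_q(A_2)-module *)

Notation Qq := {fraction {poly rat}}.

Definition q : Qq := tofrac 'X.

Definition qnum (n : nat) : Qq := (q ^+ n - q ^- n) / (q - q^-1).

Definition qfact (n : nat) : Qq := \prod_(1 <= k < n.+1) qnum k.

Definition cartan (a b : 'I_2) : int := if a == b then 2 else -1.

(* A U_q(A_2)-module structure on V, by generators e_a, f_a, t_a^{+-1} and
   relations; the last two are the q-Serre relations. *)
Record UqA2_module (V : lmodType Qq) := UqA2Module {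
  ue : 'I_2 -> {linear V -> V};
  uf : 'I_2 -> {linear V -> V};
  ut : 'I_2 -> {linear V -> V};
  utV : 'I_2 -> {linear V -> V};
  u_ttV : forall a v, ut a (utV a v) = v;
  u_tVt : forall a v, utV a (ut a v) = v;
  u_tt : forall a b v, ut a (ut b v) = ut b (ut a v);
  u_te : forall a b v, ut a (ue b v) = q ^ cartan a b *: ue b (ut a v);
  u_tf : forall a b v, ut a (uf b v) = q ^ (- cartan a b) *: uf b (ut a v);
  u_ef : forall a b v, ue a (uf b v) - uf b (ue a v) =
           if a == b then (q - q^-1)^-1 *: (ut a v - utV a v) else 0;
  u_ee : forall a b v, a != b ->
           ue a (ue a (ue b v)) - qnum 2 *: ue a (ue b (ue a v))
           + ue b (ue a (ue a v)) = 0;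
  u_ff : forall a b v, a != b ->
           uf a (uf a (uf b v)) - qnum 2 *: uf a (uf b (uf a v))
           + uf b (uf a (uf a v)) = 0 }.

Section CrystalOfModule.
Variables (V : lmodType Qq) (M : UqA2_module V).

Definition submodule (W : set V) : Prop :=
  [/\ W 0, forall c v w, W v -> W w -> W (c *: v + w),
      forall a v, W v -> W (ue M a v), forall a v, W v -> W (uf M a v)
    & forall a v, W v -> W (ut M a v) /\ W (utV M a v)].

Definition irreducible_module : Prop :=
  (exists v : V, v != 0) /\
  forall W : set V, submodule W -> W = [set 0] \/ W = setT.

Definition weight_vector (mu : weight) (v : V) : Prop :=
  forall a, ut M a v = q ^ mu a *: v.

Definition highest_weight_vector (lambda : weight) (u : V) : Prop :=
  [/\ u != 0, forall a, ue M a u = 0 & weight_vector lambda u].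

(* f_a^{(n)} = f_a^n / [n]! *)
Definition divpow (a : 'I_2) (n : nat) (v : V) : V :=
  (qfact n)^-1 *: iter n (uf M a) v.

(* [string_decomp a n w v]: v = \sum_k f_a^{(n_k)} w_k where w_k is killed by
   e_a and has weight m_k with respect to t_a, and n_k <= m_k. Every vector of
   an integrable module has such a decomposition, and the vectors
   \tilde f_a v = \sum_k f_a^{(n_k + 1)} w_k and
   \tilde e_a v = \sum_(k | n_k > 0) f_a^{(n_k - 1)} w_k do not depend on it.
   The bound n_k <= m_k is needed for the latter. *)
Definition string_decomp (a : 'I_2) (r : nat) (n : 'I_r -> nat) (w : 'I_r -> V)
    (v : V) : Prop :=
  (forall k, ue M a (w k) = 0 /\
     exists2 m : nat, (n k <= m)%N & ut M a (w k) = q ^+ m *: w k) /\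
  v = \sum_(k < r) divpow a (n k) (w k).

(* The graphs of the Kashiwara operators on V. *)
Definition kashiwara_f (a : 'I_2) (v v' : V) : Prop :=
  exists (r : nat) (n : 'I_r -> nat) (w : 'I_r -> V),
    string_decomp a n w v /\ v' = \sum_(k < r) divpow a (n k).+1 (w k).

Definition kashiwara_e (a : 'I_2) (v v' : V) : Prop :=
  exists (r : nat) (n : 'I_r -> nat) (w : 'I_r -> V),
    string_decomp a n w v /\
    v' = \sum_(k < r | (0 < n k)%N) divpow a (n k).-1 (w k).

Variable u : V.

(* The vectors \tilde f_{a_1} ... \tilde f_{a_r} u. *)
Inductive fchain : V -> Prop :=
| fchain_base : fchain u
| fchain_step a v v' : fchain v -> kashiwara_f a v v' -> fchain v'.

End CrystalOfModule.

(* The subring of Q(q) of the rational functions that are regular at q = 0. *)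
Definition regular0 (c : Qq) : Prop :=
  exists n d : {poly rat}, d.[0] != 0 /\ c = tofrac n / tofrac d.

Section CrystalBase.
Variables (V : lmodType Qq) (M : UqA2_module V) (u : V).

Definition lattice : set V :=
  [set v | exists (r : nat) (c : 'I_r -> Qq) (w : 'I_r -> V),
     (forall k, regular0 (c k) /\ fchain M u (w k)) /\
     v = \sum_(k < r) c k *: w k].

Definition qlattice : set V := [set q *: v | v in lattice].

(* The elements of L/qL are represented by the cosets v + qL. *)
Definition coset (v : V) : set V := [set w | qlattice (w - v)].

Definition crystal_base : set (set V) :=
  [set coset v | v in [set v | fchain M u v /\ ~ qlattice v]].

(* The operator on the cosets of qL induced by an operator on V. *)
Definition induced (g : V -> V -> Prop) (X : set V) : set V :=
  [set w | exists2 v, X v & exists2 v', g v v' & coset v' w].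

Definition crystal_of_module : crystal := {|
  ccarrier := set V;
  czero := qlattice;
  cverts := crystal_base;
  ce := fun a => induced (kashiwara_e M a);
  cf := fun a => induced (kashiwara_f M a);
  cwt := fun X mu => exists2 v, X v & weight_vector M mu v |}.

End CrystalBase.

(* "C is isomorphic to B^{A_2}(lambda)".  The irreducible highest weight module
   of highest weight lambda and its highest weight vector being unique up to
   isomorphism and scalar, the crystal may be computed from any of them. *)
Definition isomorphic_to_BA2 (lambda : weight) (C : crystal) : Prop :=
  forall (V : lmodType Qq) (M : UqA2_module V) (u : V),
    irreducible_module M -> highest_weight_vector M lambda u ->
    crystal_isomorphic C (crystal_of_module M u).

(* Main.v *)
Require Import Defs.
From HB Require Import structures.
From mathcomp Require Import all_boot all_order all_algebra.
From mathcomp Require Import boolp classical_sets functions.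
From mathcomp Require Import ring zify.
From Stdlib Require Import Relation_Operators.

Set Implicit Arguments.
Unset Strict Implicit.
Unset Printing Implicit Defensive.

Import Order.TTheory GRing.Theory Num.Theory.

Local Open Scope classical_set_scope.
Local Open Scope ring_scope.
(* On the module side, put u_{a,c,d} = f_0^(a) h_{c,d}, where h_{c,d} spans the
   vectors of its weight that are killed by e_0 (0 <= c <= m, 0 <= d <= n,
   0 <= a <= m - c + d).  In this basis the generators act by explicit q-numbers,
   and irreducibility identifies V with the coefficient functions on the triples.
   The basis is orthogonal for the form with (f v, w) = (v, q^-1 t e w), with
   norms congruent to 1 mod q; the form, hence the lattice it defines, does not
   change when the roles of the indices 0 and 1 are swapped.  A leading
   coefficient argument (sums of squares do not cancel over rat) then determines
   f~_1 and e~_1 on the u_{a,c,d} mod q, so that the crystal base is the set of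
   triples with f~_0 : a + 1, and f~_1 : d + 1 if a <= d and (a - 1, c + 1)
   otherwise.

   On the side of B_l, three piecewise linear functions P, Q0, Q1 are constant on
   components, and b |-> (a, c, d), with a = eps_0 b and c, d read off the weight
   of b, intertwines the operators with those of the triples for m = l + Q1 - 2 Q0
   and n = l + Q0 - 2 Q1.  The vertices over (0, 0, 0) are the bbar, determined by
   P, Q0, Q1, and every vertex is raised to one of them. *)

(** * The module as functions on triples *)

(** The basis f_0^(a) h_{c,d} shows the 0-strings but hides the 1-strings, by which f~_1 is defined.
    Instead of a transition matrix between two adapted bases, only the pole orders of e_1 and f_1 at
    q = 0 are used. They bound how deep u_{a,c,d} reaches into its 1-strings modulo q, and they show
    that f~_1 u_{a,c,d} and the expected basis vector have scalar product 1 modulo q. The first has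
    norm at most 1 there and the second norm 1, so over rat they coincide. Irreducibility of V gives
    that coordinates exist and that a vector with zero coordinates is zero; that they are well
    defined comes from the nondegeneracy of the form. For B_l, the functions Q0 and Q1 come from
    eps_0 + eps_1: up to a linear form this is the maximum of -Q0 and z - Q1 with z linear, and the
    term attaining the maximum tells which case of f~_1 on triples applies. Q0 and Q1 determine only
    (j0, j1); P separates the components with equal (j0, j1) and different i. *)

HB.lock Definition qn (K : fieldType) (q x : K) : K := (x - x^-1) / (q - q^-1).

HB.lock Definition qi (K : fieldType) (q : K) (z : int) : K := qn q (q ^ z).

Section QNumbers.
Variables (K : fieldType) (q : K).
Local Notation qn := (qn q).
Local Notation qi := (qi q).

Lemma qiE z : qi z = qn (q ^ z).
Proof. by rewrite qi.unlock. Qed.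

Hypothesis q_gen : forall k : int, q ^ k = 1 -> k = 0.
Hypothesis q0 : q != 0.

Lemma qq0 : q * q - 1 != 0.
Proof.
by rewrite subr_eq0 -expr2; apply/eqP => /(q_gen (k := 2)).
Qed.

Lemma qnE x : x != 0 -> qn x = q * (x * x - 1) / ((q * q - 1) * x).
Proof.
move=> x0; have e : q - q^-1 = (q * q - 1) / q by field.
by rewrite qn.unlock e; field; rewrite x0 q0 qq0.
Qed.

Lemma qX0 (z : int) : q ^ z != 0.
Proof. exact: expfz_neq0. Qed.

Lemma qi0 : qi 0 = 0.
Proof. by rewrite qiE qn.unlock expr0z invr1 subrr mul0r. Qed.

Lemma qi1 : qi 1 = 1.
Proof. by rewrite qiE qnE// expr1z; field; rewrite qq0 q0. Qed.

Lemma qi_sq_neq0 z : z != 0 -> q ^ z * q ^ z - 1 != 0.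
Proof.
move=> z0; rewrite subr_eq0 -expfzDr//; apply/eqP => /q_gen; lia.
Qed.

Lemma qi_neq0 z : z != 0 -> qi z != 0.
Proof.
move=> z0; rewrite qiE qnE ?qX0//.
by rewrite !mulf_neq0 ?invr_neq0 ?mulf_neq0 ?qX0 ?qq0 ?qi_sq_neq0.
Qed.

(** With A = q^a, C = q^c, M = q^m, N = q^n and R = q^r for r = m - c + d, this is the coefficient
    of [e_1, f_1] at (a, c, d). Independent variables put it within reach of [field]; D stands for
    q^d. The last three hypotheses say that [r], [r + 1], [r + 2] are nonzero. *)
Lemma comm_diag (A C R M N : K) : A != 0 -> C != 0 -> R != 0 -> M != 0 ->
  N != 0 -> R * R - 1 != 0 -> R * q * (R * q) - 1 != 0 ->
  R * q * q * (R * q * q) - 1 != 0 ->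
  let D := R * C / M in
  (C * qn (M * D * q * q) * qn (D * q) * qn (R / A * q) / qn (R * q * q)
     * (C^-1 * qn (N / D) / qn (R * q))
   + R * qn (M * N / C * q) * qn (C * q) / qn R
     * (R^-1 * qn (M / C) * qn A / qn (R * q)))
  - (C^-1 * qn (N / D * q) / qn R
       * (C * qn (M * D * q) * qn D * qn (R / A) / qn (R * q))
     + (R * q)^-1 * qn (M / C * q) * qn (A * q) / qn (R * q * q)
       * (R * q * qn (M * N / C * q * q) * qn C / qn (R * q)))
  = qn (N * A / C / D / D).
Proof.
move=> A0 C0 R0 M0 N0 h1 h2 h3 D.
have D0 : D != 0 by rewrite /D !mulf_neq0 ?invr_neq0.
rewrite !qnE ?mulf_neq0 ?invr_neq0//.
rewrite /D; field.
by rewrite M0 C0 R0 A0 N0 q0 h1 h2 h3 qq0.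
Qed.

(** The same coefficient, times [2], at the point (0, m, 0), where r = 0. *)
Lemma comm_diag0 (M N : K) : M != 0 -> N != 0 ->
  qn (M * q * q) * qn N - qn (N * q * q) * qn M = qn (q * q) * qn (N / M).
Proof.
move=> M0 N0; rewrite !qnE ?mulf_neq0 ?invr_neq0//.
by field; rewrite M0 N0 q0 qq0.
Qed.

Lemma comm_sl2 (A R : K) : A != 0 -> R != 0 ->
  qn (A * q) * qn (R / A) - qn (R / A * q) * qn A = qn (R / A / A).
Proof.
move=> A0 R0; rewrite !qnE ?mulf_neq0 ?invr_neq0//.
by field; rewrite R0 A0 q0 qq0.
Qed.

End QNumbers.

(** The integer argument allows differences such as [n - d]; [u] is later [qi q] or its rescaling
    [qa]. *)
Definition zfact (K : fieldType) (u : int -> K) (z : int) : K :=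
  \prod_(1 <= k < `|z|%N.+1) u k%:Z.

Lemma zfactS (K : fieldType) (u : int -> K) (z : int) : 0 <= z ->
  zfact u (z + 1) = u (z + 1) * zfact u z.
Proof.
case: z => // k _; have -> : Posz k + 1 = k.+1 by lia.
by rewrite /zfact /= big_nat_recr//= mulrC.
Qed.

Lemma zfact_neq0 (K : fieldType) (u : int -> K) (z : int) :
  (forall k, 0 < k -> u k != 0) -> zfact u z != 0.
Proof.
move=> u0; rewrite /zfact big_nat_cond.
apply: (big_ind (fun x => x != 0)) => [|x y|k]; first exact: oner_neq0.
  exact: mulf_neq0.
by rewrite andbT => /andP[k0 _]; apply: u0.
Qed.

(** * Operators of U_q(A_2) on functions on triples *)

Section Model.
Variables (K : fieldType) (q : K) (m n : int).
Hypothesis q_gen : forall k : int, q ^ k = 1 -> k = 0.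
Hypothesis q0 : q != 0.
Local Notation "[ z ]" := (qi q z) (format "[ z ]").
Local Notation W := (int -> int -> int -> K).

(** The length of the 0-string that starts at h_{c,d}. *)
Definition rr (c d : int) : int := m - c + d.

Definition rng (a c d : int) : bool :=
  [&& 0 <= a, a <= rr c d, 0 <= c, c <= m, 0 <= d & d <= n].

(* The basis is normalised so that the coefficients below vanish at the boundary
   of [rng]: the operators preserve supported functions without case analysis. *)
Definition supported (w : W) := forall a c d, ~~ rng a c d -> w a c d = 0.

(** From (a, c, d), f_1 goes to (a, c, d + 1) with coefficient [al] and to (a - 1, c + 1, d) with
    coefficient [be]; e_1 goes to (a, c, d - 1) with [ga] and to (a + 1, c - 1, d) with [de]. The
    two targets lie in 0-strings of length r + 1 and r - 1, as in the tensor product with the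
    two-dimensional module, whence the denominators [r + 1]. *)
Definition al (c d : int) := q ^ (- c) * [n - d] / [rr c d + 1].
Definition be (a c d : int) := q ^ (- rr c d) * [m - c] * [a] / [rr c d + 1].
Definition ga (a c d : int) :=
  q ^ c * [m + d + 1] * [d] * [rr c d - a] / [rr c d + 1].
Definition de (c d : int) :=
  q ^ (rr c d + 1) * [m + n - c + 2] * [c] / [rr c d + 1].

Definition wt0 (a c d : int) : int := rr c d - 2 * a.
Definition wt1 (a c d : int) : int := n + a - c - 2 * d.

Definition F0 (w : W) : W := fun a c d => [rr c d - (a - 1)] * w (a - 1) c d.
Definition E0 (w : W) : W := fun a c d => [a + 1] * w (a + 1) c d.
Definition F1 (w : W) : W := fun a c d =>
  al c (d - 1) * w a c (d - 1)
  + be (a + 1) (c - 1) d * w (a + 1) (c - 1) d.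
Definition E1 (w : W) : W := fun a c d =>
  ga a c (d + 1) * w a c (d + 1)
  + de (c + 1) d * w (a - 1) (c + 1) d.
Definition Tz (g : int -> int -> int -> int) (w : W) : W :=
  fun a c d => q ^ g a c d * w a c d.

Lemma F0_supp w : supported w -> supported (F0 w).
Proof.
move=> sw a c d h; rewrite /F0; have [/sw->|h'] := boolP (~~ rng (a - 1) c d).
  by rewrite mulr0.
have -> : rr c d - (a - 1) = 0 by move: h h'; rewrite /rng /rr; lia.
by rewrite qi0 mul0r.
Qed.

Lemma F1_supp w : supported w -> supported (F1 w).
Proof.
move=> sw a c d h; rewrite /F1 -[RHS]addr0; congr (_ + _).
  have [/sw->|h'] := boolP (~~ rng a c (d - 1)); first by rewrite mulr0.
  rewrite /al; have -> : n - (d - 1) = 0 by move: h h'; rewrite /rng /rr; lia.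
  by rewrite qi0 mulr0 !mul0r.
have [/sw->|h'] := boolP (~~ rng (a + 1) (c - 1) d); first by rewrite mulr0.
rewrite /be; have [->|e] := eqVneq (a + 1) 0; first by rewrite qi0 mulr0 !mul0r.
have -> : m - (c - 1) = 0 by move: h h' e; rewrite /rng /rr; lia.
by rewrite qi0 mulr0 !mul0r.
Qed.

Lemma TzF0 g k w : (forall a c d, g a c d = k + g (a - 1) c d) ->
  Tz g (F0 w) = fun a c d => q ^ k * F0 (Tz g w) a c d.
Proof.
move=> hg; do 3!apply/funext => ?.
by rewrite /Tz /F0 hg expfzDr//; ring.
Qed.

Lemma TzF1 g k w : (forall a c d, g a c d = k + g a c (d - 1)) ->
  (forall a c d, g a c d = k + g (a + 1) (c - 1) d) ->
  Tz g (F1 w) = fun a c d => q ^ k * F1 (Tz g w) a c d.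
Proof.
move=> hg hg'; apply/funext => a; apply/funext => c; apply/funext => d.
rewrite /Tz /F1 !mulrDr; congr (_ + _).
  by rewrite hg expfzDr//; ring.
by rewrite hg' expfzDr//; ring.
Qed.

Lemma E0F0 w a c d :
  E0 (F0 w) a c d - F0 (E0 w) a c d = [wt0 a c d] * w a c d.
Proof.
rewrite /E0 /F0 /wt0 addrK subrK !mulrA -mulrBl; congr (_ * _).
rewrite !qiE; have -> : q ^ (rr c d - (a - 1)) = q ^ rr c d / q ^ a * q.
  by rewrite opprD opprK addrA !expfzDr// expr1z invr_expz.
have -> : q ^ (a + 1) = q ^ a * q by rewrite expfzDr// expr1z.
have -> : q ^ (rr c d - a) = q ^ rr c d / q ^ a by rewrite expfzDr// invr_expz.
have -> : q ^ (rr c d - 2 * a) = q ^ rr c d / q ^ a / q ^ a.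
  by rewrite -[2]/(1 + 1 : int) mulrDl mul1r opprD !expfzDr// !invr_expz mulrA.
by rewrite comm_sl2// qX0.
Qed.

Lemma E0F1 w : E0 (F1 w) = F1 (E0 w).
Proof.
do 3!apply/funext => ?; rewrite /E0 /F1 /be; ring.
Qed.

Lemma E1F0 w : E1 (F0 w) = F0 (E1 w).
Proof.
apply/funext => a; apply/funext => c; apply/funext => d.
rewrite /E1 /F0 /ga.
have -> : rr c (d + 1) - (a - 1) = rr c d - (a - 1) + 1 by rewrite /rr; ring.
have -> : rr c (d + 1) - a = rr c d - (a - 1) by rewrite /rr; ring.
have -> : rr (c + 1) d - (a - 1 - 1) = rr c d - (a - 1) by rewrite /rr; ring.
by ring.
Qed.

(** Off the diagonal the products cancel in pairs ([e1] and [e2] below); the diagonal is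
    [comm_diag]. *)
Lemma E1F1 w a c d : supported w ->
  E1 (F1 w) a c d - F1 (E1 w) a c d = [wt1 a c d] * w a c d.
Proof.
move=> sw; rewrite /E1 /F1 ?addrK ?subrK ?addrK.
have e1 : ga a c (d + 1) * be (a + 1) (c - 1) (d + 1)
        = be (a + 1) (c - 1) d * ga (a + 1) (c - 1) (d + 1).
  rewrite /ga /be.
  have -> : rr (c - 1) (d + 1) = rr c d + 2 by rewrite /rr; ring.
  have -> : rr (c - 1) d = rr c d + 1 by rewrite /rr; ring.
  have -> : rr c (d + 1) = rr c d + 1 by rewrite /rr; ring.
  have -> : rr c d + 2 - (a + 1) = rr c d + 1 - a by ring.
  have -> : rr c d + 1 + 1 = rr c d + 2 by ring.
  have -> : - (rr c d + 2) = - (rr c d + 1) - 1 by ring.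
  by rewrite !(expfzDr _ _ q0); ring.
have e2 : de (c + 1) d * al (c + 1) (d - 1)
        = al c (d - 1) * de (c + 1) (d - 1).
  rewrite /de /al.
  have -> : rr (c + 1) (d - 1) = rr c d - 2 by rewrite /rr; ring.
  have -> : rr (c + 1) d = rr c d - 1 by rewrite /rr; ring.
  have -> : rr c (d - 1) = rr c d - 1 by rewrite /rr; ring.
  rewrite subrK.
  have -> : rr c d - 2 + 1 = rr c d - 1 by ring.
  have -> : - (c + 1) = - c - 1 by ring.
  by rewrite !(expfzDr _ _ q0); ring.
suff e3 : (ga a c (d + 1) * al c d + de (c + 1) d * be a c d
     - (al c (d - 1) * ga a c d + be (a + 1) (c - 1) d * de c d)) * w a c d
   = [wt1 a c d] * w a c d.
  rewrite -e3 !mulrDr !(mulrA _ _ (w _ _ _)) e1 e2; ring.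
have [h|/sw->] := boolP (rng a c d); last by rewrite !mulr0.
congr (_ * _).
(* When r = 0 the point is (0, m, 0), and the terms divided by [r] have a zero numerator. *)
have [r0|r0] := eqVneq (rr c d) 0.
  have -> : a = 0 by move: h r0; rewrite /rng /rr; lia.
  have -> : c = m by move: h r0; rewrite /rng /rr; lia.
  have -> : d = 0 by move: h r0; rewrite /rng /rr; lia.
  rewrite /ga /al /de /be /wt1 /rr !qi0 !subrr !add0r !subr0 !qi0 !mulr0 !mul0r.
  have -> : m - (m - 1) = 1 by ring.
  have -> : m + n - m + 2 = n + 2 by ring.
  rewrite !mulr0 !addr0 add0r (qi1 q_gen q0) !mulr1 -!invr_expz !expr1z.
  have h2 : [1 + 1] != 0 by apply: (qi_neq0 q_gen q0).
  apply: (mulfI h2).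
  have -> : [1 + 1] * [n - m] = [m + 1 + 1] * [n] - [n + 2] * [m].
    rewrite !qiE !(expfzDr _ _ q0) -invr_expz !expr1z.
    by rewrite !mulrA comm_diag0// ?qX0.
  field.
  by rewrite oner_neq0 h2 q0 (qX0 q0).
have rp : 0 <= rr c d by move: h; rewrite /rng; lia.
have r2 : rr c d + 1 != 0 by lia.
have r3 : rr c d + 2 != 0 by lia.
have -> : [wt1 a c d] = qn q (q ^ n * q ^ a / q ^ c / q ^ d / q ^ d).
  rewrite qiE; congr (qn q _).
  rewrite !invr_expz -!(expfzDr _ _ q0); congr (_ ^ _); rewrite /wt1; ring.
have eD : q ^ d = q ^ rr c d * q ^ c / q ^ m.
  by rewrite invr_expz -!(expfzDr _ _ q0); congr (_ ^ _); rewrite /rr; ring.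
rewrite !eD -comm_diag ?qX0 -?eD //; last 3 first.
- exact: (qi_sq_neq0 q_gen q0).
- have -> : q ^ rr c d * q = q ^ (rr c d + 1) by rewrite expfzDr// expr1z.
  exact: (qi_sq_neq0 q_gen q0).
- have -> : q ^ rr c d * q * q = q ^ (rr c d + 2).
    by rewrite expfzDr// -exprnP expr2 mulrA.
  exact: (qi_sq_neq0 q_gen q0).
have X2 x : q ^ (x + 2) = q ^ x * q * q.
  by rewrite expfzDr// -exprnP expr2 mulrA.
have X1 x : q ^ (x + 1) = q ^ x * q by rewrite expfzDr// expr1z.
have XV x y : q ^ (x - y) = q ^ x / q ^ y by rewrite expfzDr// invr_expz.
have Xp x y : q ^ (x + y) = q ^ x * q ^ y by rewrite expfzDr.
congr (_ + _ - (_ + _)).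
- rewrite /ga /al.
  have -> : m + (d + 1) + 1 = m + d + 2 by ring.
  have -> : rr c (d + 1) = rr c d + 1 by rewrite /rr; ring.
  have -> : rr c d + 1 - a = rr c d - a + 1 by ring.
  have -> : rr c d + 1 + 1 = rr c d + 2 by ring.
  by move: (rr c d) => R; rewrite !qiE !X2 !X1 !XV Xp -invr_expz; ring.
- rewrite /de /be.
  have -> : m + n - (c + 1) + 2 = m + n - c + 1 by ring.
  have -> : rr (c + 1) d + 1 = rr c d by rewrite /rr; ring.
  by move: (rr c d) => R; rewrite !qiE !X1 !XV !Xp -invr_expz; ring.
- rewrite /ga /al.
  have -> : rr c (d - 1) + 1 = rr c d by rewrite /rr; ring.
  have -> : n - (d - 1) = n - d + 1 by ring.
  by move: (rr c d) => R; rewrite !qiE !X1 !XV !Xp -invr_expz; ring.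
- rewrite /de /be.
  have -> : m - (c - 1) = m - c + 1 by ring.
  have -> : rr (c - 1) d = rr c d + 1 by rewrite /rr; ring.
  have -> : rr c d + 1 + 1 = rr c d + 2 by ring.
  by move: (rr c d) => R; rewrite -!invr_expz !qiE !X2 !X1 !XV !Xp; ring.
Qed.

(** The q-number rescaled to 1 + q^2 + ... + q^(2z - 2) for z > 0, which takes the value 1 at q =
    0. *)
Definition qa (z : int) : K := q ^ (z - 1) * [z].
Lemma qaE z : qa z = (q ^ z * q ^ z - 1) / (q * q - 1).
Proof.
rewrite /qa qiE qnE ?(qX0 q0)// expfzDr// -(invr_expz _ 1) expr1z.
by field; rewrite (qX0 q0) q0 (qq0 q_gen).
Qed.

Local Notation qif := (zfact (qi q)).
Local Notation qaf := (zfact qa).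

(* The ratio of u_{a,c,d} to the basis vector with coordinates [dl a c d]. *)
Definition lam (a c d : int) : K :=
  qif n / (qif d * qif (n - d)) * (qif m / (qif c * qif (m - c)))
  * (qif m / (qif a * qif (rr c d - a))).

(** The norm of u_{a,c,d}. As a quotient of [qa]-factorials without any further power of q, it is
    visibly congruent to 1 modulo q. *)
Definition nuG (a c d : int) : K :=
  qaf (rr c d) / (qaf a * qaf (rr c d - a)) * (qaf m / (qaf c * qaf (m - c)))
  * (qaf n / (qaf d * qaf (n - d)))
  * (qaf (m + n + 1) * qaf (m + d + 1)
     / (qaf (m + n + 1 - c) * qaf (rr c d + 1))).

(** The norm of [dl a c d], since u_{a,c,d} is [lam a c d] times that vector. *)
Definition nu (a c d : int) : K := nuG a c d / (lam a c d ^+ 2).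

Lemma qif_neq0 z : qif z != 0.
Proof. by apply: zfact_neq0 => k k0; apply: (qi_neq0 q_gen q0); lia. Qed.

Lemma qa_neq0 z : z != 0 -> qa z != 0.
Proof. by move=> z0; rewrite mulf_neq0 ?(qX0 q0) ?(qi_neq0 q_gen q0). Qed.

Lemma qaf_neq0 z : qaf z != 0.
Proof. by apply: zfact_neq0 => k k0; apply: qa_neq0; lia. Qed.

Lemma lam_neq0 a c d : lam a c d != 0.
Proof. by rewrite /lam !(mulf_neq0, invr_neq0, qif_neq0). Qed.

Lemma nuG_neq0 a c d : nuG a c d != 0.
Proof. by rewrite /nuG !(mulf_neq0, invr_neq0, qaf_neq0). Qed.

Lemma nu_neq0 a c d : nu a c d != 0.
Proof. by rewrite mulf_neq0 ?nuG_neq0// invr_neq0// expf_neq0// lam_neq0. Qed.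

Lemma lam000 : lam 0 0 0 = 1.
Proof.
have f0 : qif 0 = 1 by rewrite /zfact /= big_geq.
rewrite /lam /rr ?subr0 f0 ?addr0 ?subr0 !mul1r.
by rewrite !divff ?qif_neq0// !mulr1.
Qed.

Lemma nu000 : nu 0 0 0 = 1.
Proof.
have f0 : qaf 0 = 1 by rewrite /zfact /= big_geq.
rewrite /nu lam000 expr1n divr1 /nuG /rr ?subr0 f0 ?addr0 ?subr0 !mul1r.
by rewrite !divff ?mulf_neq0 ?qaf_neq0// !mulr1.
Qed.

Lemma lam_a a c d : 0 <= a -> a + 1 <= rr c d ->
  lam (a + 1) c d = [rr c d - a] / [a + 1] * lam a c d.
Proof.
move=> a0 ar; rewrite /lam.
have e : rr c d - a = rr c d - (a + 1) + 1 by ring.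
rewrite e !zfactS ?subr_ge0// -e.
by field; rewrite ?qif_neq0 ?(qi_neq0 q_gen q0)//; lia.
Qed.

Lemma lam_d a c d : 0 <= d -> d + 1 <= n -> a <= rr c d ->
  lam a c (d + 1) = [n - d] / [d + 1] / [rr c d - a + 1] * lam a c d.
Proof.
move=> d0 dn ar; rewrite /lam.
have e : n - d = n - (d + 1) + 1 by ring.
have e' : rr c (d + 1) - a = rr c d - a + 1 by rewrite /rr; ring.
rewrite e e' !zfactS ?subr_ge0// -e.
field; rewrite ?qif_neq0 ?(qi_neq0 q_gen q0)//; lia.
Qed.

Lemma lam_c a c d : 0 < a -> 0 <= c -> c + 1 <= m -> 
  lam (a - 1) (c + 1) d = [m - c] * [a] / [c + 1] * lam a c d.
Proof.
move=> a0 c0 cm; rewrite /lam.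
have e : m - c = m - (c + 1) + 1 by ring.
have e' : rr (c + 1) d - (a - 1) = rr c d - a by rewrite /rr; ring.
have e2 : a = a - 1 + 1 by ring.
rewrite e e' [in qif a]e2 !zfactS ?subr_ge0// -e -e2.
field; rewrite ?qif_neq0 ?(qi_neq0 q_gen q0)//; lia.
Qed.

Lemma nuG_a a c d : 0 <= a -> a + 1 <= rr c d ->
  nuG (a + 1) c d = qa (rr c d - a) / qa (a + 1) * nuG a c d.
Proof.
move=> a0 ar; rewrite /nuG.
have e : rr c d - a = rr c d - (a + 1) + 1 by ring.
rewrite e [qaf (a + 1)]zfactS// [qaf (_ - _ + 1)]zfactS ?subr_ge0// -e.
field; rewrite ?qaf_neq0 ?qa_neq0//; lia.
Qed.

Lemma nuG_d a c d : 0 <= m -> 0 <= d -> d + 1 <= n -> 0 <= a -> a <= rr c d ->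
  nuG a c (d + 1) = qa (rr c d + 1) / qa (rr c d - a + 1)
    * (qa (n - d) / qa (d + 1)) * (qa (m + d + 1 + 1) / qa (rr c d + 1 + 1))
    * nuG a c d.
Proof.
move=> m0 d0 dn a0 ar; rewrite /nuG.
have e : n - d = n - (d + 1) + 1 by ring.
have e' : rr c (d + 1) = rr c d + 1 by rewrite /rr; ring.
have e1 : rr c d + 1 - a = rr c d - a + 1 by ring.
have e2 : m + (d + 1) + 1 = m + d + 1 + 1 by ring.
have r0 : 0 <= rr c d by lia.
rewrite e e' e1 e2 [qaf (m + d + 1 + 1)]zfactS; last by lia.
rewrite [qaf (rr c d + 1 + 1)]zfactS; last by lia.
rewrite [qaf (rr c d + 1)]zfactS// [qaf (rr c d - a + 1)]zfactS; last by lia.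
rewrite [qaf (d + 1)]zfactS// [qaf (n - _ + 1)]zfactS; last by lia.
rewrite -e; field; rewrite ?qaf_neq0 ?qa_neq0//; lia.
Qed.

Lemma nuG_c a c d : 0 <= n -> 0 < a -> a <= rr c d -> 0 <= c -> c + 1 <= m ->
  nuG (a - 1) (c + 1) d = qa a / qa (rr c d) * (qa (m - c) / qa (c + 1))
    * (qa (m + n + 1 - c) * qa (rr c d + 1)) * nuG a c d.
Proof.
move=> n0 a0 ar c0 cm; rewrite /nuG.
have e : m - c = m - (c + 1) + 1 by ring.
have e' : rr (c + 1) d - (a - 1) = rr c d - a by rewrite /rr; ring.
have e2 : a = a - 1 + 1 by ring.
have e3 : rr (c + 1) d = rr c d - 1 by rewrite /rr; ring.
have e4 : m + n + 1 - c = m + n + 1 - (c + 1) + 1 by ring.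
rewrite e' e3 subrK; move: (rr c d) ar => r ar.
have e5 : r = r - 1 + 1 by ring.
rewrite [qaf (r + 1)]zfactS; last by lia.
rewrite [in qaf r]e5 [qaf (r - 1 + 1)]zfactS -?e5; last by lia.
rewrite [in qaf a]e2 [qaf (a - 1 + 1)]zfactS -?e2; last by lia.
rewrite [in qaf (m + n + 1 - c)]e4 [qaf (_ - (c + 1) + 1)]zfactS -?e4; last by lia.
rewrite [in qaf (m - c)]e [qaf (m - _ + 1)]zfactS -?e; last by lia.
rewrite [qaf (c + 1)]zfactS//.
field; rewrite ?qaf_neq0 ?qa_neq0//; lia.
Qed.

(** Together with [nu_d] and [nu_c], the matrix entries of the adjunction (f v, w) = (v, q^-1 t e
    w), one for each kind of arrow; the power of q is q^-1 t at the source of the arrow. *)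
Lemma nu_a a c d : 0 <= a -> a + 1 <= rr c d ->
  [rr c d - a] * nu (a + 1) c d = q ^ (wt0 a c d - 1) * ([a + 1] * nu a c d).
Proof.
move=> a0 ar; rewrite /nu nuG_a// lam_a// /qa.
have -> : q ^ (wt0 a c d - 1) = q ^ (rr c d - a - 1) / q ^ (a + 1 - 1).
  by rewrite invr_expz -expfzDr//; congr (_ ^ _); rewrite /wt0; ring.
by field; rewrite ?(qX0 q0) ?lam_neq0 ?(qi_neq0 q_gen q0)//; lia.
Qed.

Lemma nu_d a c d : rng a c d -> rng a c (d + 1) ->
  al c d * nu a c (d + 1) = q ^ (wt1 a c d - 1) * (ga a c (d + 1) * nu a c d).
Proof.
rewrite /rng => h h'; rewrite /nu nuG_d ?lam_d /al /ga; try lia.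
have -> : rr c (d + 1) - a = rr c d - a + 1 by rewrite /rr; ring.
have -> : rr c (d + 1) = rr c d + 1 by rewrite /rr; ring.
have -> : m + (d + 1) + 1 = m + d + 1 + 1 by ring.
rewrite /qa.
have -> : q ^ (wt1 a c d - 1) = q ^ (- c) * q ^ (rr c d + 1 - 1) * q ^ (n - d - 1)
    * q ^ (m + d + 1 + 1 - 1)
    / (q ^ (rr c d - a + 1 - 1) * q ^ (d + 1 - 1) * q ^ (rr c d + 1 + 1 - 1) * q ^ c).
  rewrite -!expfzDr// invr_expz -expfzDr//.
  by congr (_ ^ _); rewrite /wt1 /rr; ring.
have r0 : 0 <= rr c d by lia.
by field; rewrite ?(qX0 q0) ?lam_neq0 ?(qi_neq0 q_gen q0)//; lia.
Qed.

Lemma nu_c a c d : rng a c d -> rng (a - 1) (c + 1) d ->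
  be a c d * nu (a - 1) (c + 1) d
  = q ^ (wt1 a c d - 1) * (de (c + 1) d * nu a c d).
Proof.
rewrite /rng => h h'; rewrite /nu nuG_c ?lam_c /be /de; try lia.
have -> : m + n - (c + 1) + 2 = m + n + 1 - c by ring.
have r1 : 0 < rr c d by move: h'; rewrite /rr; lia.
have -> : rr (c + 1) d + 1 = rr c d by rewrite /rr; ring.
rewrite /qa.
have -> : q ^ (wt1 a c d - 1) = q ^ (- rr c d) * q ^ (a - 1) * q ^ (m - c - 1)
    * q ^ (m + n + 1 - c - 1) * q ^ (rr c d + 1 - 1)
    / (q ^ (rr c d - 1) * q ^ (c + 1 - 1) * q ^ rr c d).
  rewrite -!expfzDr// invr_expz -expfzDr//.
  by congr (_ ^ _); rewrite /wt1 /rr; ring.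
by field; rewrite ?(qX0 q0) ?lam_neq0 ?(qi_neq0 q_gen q0)//; lia.
Qed.

Hypotheses (m0 : 0 <= m) (n0 : 0 <= n).

Local Notation T := (int * int * int)%type.

(** The bound m + n suffices because a <= m - c + d. *)
Definition pts : seq T :=
  let s := iota 0 (absz (m + n)).+1 in
  [seq t <- [seq (p, Posz d) | p <- [seq (Posz a, Posz c) | a <- s, c <- s],
                               d <- s] | rng t.1.1 t.1.2 t.2].

Lemma mem_pts a c d : ((a, c, d) \in pts) = rng a c d.
Proof using m0 n0.
clear K q q_gen q0.
rewrite mem_filter; set S := (X in _ && (_ \in X)); rewrite /=.
case: (boolP (rng a c d)) => //= h; rewrite {}/S.
have si (k : nat) : Posz k <= m + n -> k \in iota 0 (absz (m + n)).+1.
  by rewrite mem_iota; lia.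
move: h; rewrite /rng /rr => h.
have [ea ec ed] : [/\ a = `|a|%N, c = `|c|%N & d = `|d|%N] by split; lia.
rewrite ea ec ed; apply/allpairsP; exists ((Posz `|a|, Posz `|c|), `|d|%N).
split => //; last by apply: si => /=; lia.
by apply/allpairsP; exists (`|a|%N, `|c|%N); split => //; apply: si => /=; lia.
Qed.

Lemma pts_uniq : uniq pts.
Proof.
apply/filter_uniq/allpairs_uniq; rewrite ?iota_uniq//.
  by apply: allpairs_uniq; rewrite ?iota_uniq// => -[? ?] [? ?] _ _ [-> ->].
by move=> [? ?] [? ?] _ _ /= [-> ->].
Qed.

(** The bijection [h] need not preserve [s]: the terms that enter or leave [s] vanish. *)
Lemma sum_shift (I : eqType) (s : seq I) (h h' : I -> I) (g : I -> K) :
  uniq s -> cancel h h' -> cancel h' h ->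
  (forall t, t \notin s -> g t = 0) -> (forall t, t \notin s -> g (h t) = 0) ->
  \sum_(t <- s) g t = \sum_(t <- s) g (h t).
Proof.
move=> us hK h'K g0 gh0.
have e1 : \sum_(t <- s | h' t \notin s) g t = 0.
  by apply: big1 => t /gh0; rewrite h'K.
have e2 : \sum_(t <- s | h t \notin s) g (h t) = 0.
  by apply: big1 => t /g0.
rewrite (bigID (fun t => h' t \in s)) /= e1 addr0.
rewrite [RHS](bigID (fun t => h t \in s)) /= e2 addr0.
rewrite -[LHS]big_filter -[RHS]big_filter -(big_map h xpredT g); apply: perm_big; apply: uniq_perm.
- exact: filter_uniq.
- by rewrite map_inj_uniq ?filter_uniq//; apply: can_inj hK.
move=> t; rewrite mem_filter; apply/andP/mapP => [[ht ts]|[y]].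
  by exists (h' t); rewrite ?mem_filter ?h'K ?ts.
by rewrite mem_filter => /andP[hy ys] ->; rewrite hK.
Qed.

Definition form (w w' : W) : K :=
  \sum_(t <- pts) nu t.1.1 t.1.2 t.2 * w t.1.1 t.1.2 t.2 * w' t.1.1 t.1.2 t.2.

Lemma form_F0 w w' : supported w -> supported w' ->
  form (F0 w) w' = q^-1 * form w (Tz wt0 (E0 w')).
Proof.
move=> sw sw'; rewrite /form mulr_sumr.
pose h := fun t : T => (t.1.1 + 1, t.1.2, t.2).
pose h' := fun t : T => (t.1.1 - 1, t.1.2, t.2).
rewrite (@sum_shift _ pts h h'); first 1 last.
- exact: pts_uniq.
- by move=> [[a c] d]; rewrite /h /h' /= addrK.
- by move=> [[a c] d]; rewrite /h /h' /= subrK.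
- by move=> [[a c] d]; rewrite mem_pts => /sw' ->; rewrite mulr0.
- by move=> [[a c] d]; rewrite mem_pts /h /= /F0 addrK => /sw ->; rewrite !(mulr0, mul0r).
apply: eq_big_seq => -[[a c] d]; rewrite mem_pts /h /= => h1.
rewrite /F0 /Tz /E0 addrK.
have [h2|/sw' ->] := boolP (rng (a + 1) c d); last by rewrite !mulr0.
have := @nu_a a c d; move: h1 h2; rewrite /rng => h1 h2.
rewrite expfzDr// -invr_expz expr1z => e.
transitivity (([rr c d - a] * nu (a + 1) c d) * w a c d * w' (a + 1) c d).
  by ring.
by rewrite e; [ring | lia | lia].
Qed.

Lemma form_F1 w w' : supported w -> supported w' ->
  form (F1 w) w' = q^-1 * form w (Tz wt1 (E1 w')).
Proof.
move=> sw sw'; rewrite /form mulr_sumr.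
under eq_bigr do rewrite /F1 mulrDr mulrDl.
under [RHS]eq_bigr do rewrite /Tz /E1 !mulrDr.
rewrite !big_split /=; congr (_ + _).
  pose h := fun t : T => (t.1.1, t.1.2, t.2 + 1).
  pose h' := fun t : T => (t.1.1, t.1.2, t.2 - 1).
  rewrite (@sum_shift _ pts h h'); first 1 last.
  - exact: pts_uniq.
  - by move=> [[a c] d]; rewrite /h /h' /= addrK.
  - by move=> [[a c] d]; rewrite /h /h' /= subrK.
  - by move=> [[a c] d]; rewrite mem_pts => /sw' ->; rewrite mulr0.
  - by move=> [[a c] d]; rewrite mem_pts /h /= addrK => /sw ->; rewrite !(mulr0, mul0r).
  apply: eq_big_seq => -[[a c] d]; rewrite mem_pts /h /= => h1.
  rewrite addrK.
  have [h2|/sw' ->] := boolP (rng a c (d + 1)); last by rewrite !mulr0.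
  have := @nu_d a c d h1 h2.
  rewrite expfzDr// -invr_expz expr1z => e.
  transitivity ((al c d * nu a c (d + 1)) * w a c d * w' a c (d + 1)).
    by ring.
  by rewrite e; ring.
pose h := fun t : T => (t.1.1 - 1, t.1.2 + 1, t.2).
pose h' := fun t : T => (t.1.1 + 1, t.1.2 - 1, t.2).
rewrite (@sum_shift _ pts h h'); first 1 last.
- exact: pts_uniq.
- by move=> [[a c] d]; rewrite /h /h' /= !(addrK, subrK).
- by move=> [[a c] d]; rewrite /h /h' /= !(addrK, subrK).
- by move=> [[a c] d]; rewrite mem_pts => /sw' ->; rewrite mulr0.
- by move=> [[a c] d]; rewrite mem_pts /h /= !(addrK, subrK) => /sw ->; rewrite !(mulr0, mul0r).
apply: eq_big_seq => -[[a c] d]; rewrite mem_pts /h /= => h1.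
rewrite !(addrK, subrK).
have [h2|/sw' ->] := boolP (rng (a - 1) (c + 1) d); last by rewrite !mulr0.
have := @nu_c a c d h1 h2.
rewrite expfzDr// -invr_expz expr1z => e.
transitivity ((be a c d * nu (a - 1) (c + 1) d) * w a c d * w' (a - 1) (c + 1) d).
  by ring.
by rewrite e; ring.
Qed.

Definition dl (a c d : int) : W :=
  fun a' c' d' => ((a', c', d') == (a, c, d))%:R.

Lemma dl_supp a c d : rng a c d -> supported (dl a c d).
Proof.
move=> h a' c' d' h'; rewrite /dl; case: eqP => // -[ea ec ed].
by move: h'; rewrite ea ec ed h.
Qed.

Lemma form_dl a c d w : rng a c d -> form (dl a c d) w = nu a c d * w a c d.
Proof.
move=> h; rewrite /form (bigD1_seq (a, c, d)) ?mem_pts ?pts_uniq//=.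
rewrite big1 ?addr0 /dl ?eqxx ?mulr1// => -[[a' c'] d'] /= /negPf ->.
by rewrite mulr0 mul0r.
Qed.

Lemma form_nondeg w : supported w -> (forall w', supported w' -> form w' w = 0) ->
  w = fun _ _ _ => 0.
Proof.
move=> sw h; apply/funext => a; apply/funext => c; apply/funext => d.
have [r|/sw//] := boolP (rng a c d).
have /eqP := h _ (dl_supp r); rewrite form_dl// mulf_eq0.
by rewrite (negPf (nu_neq0 _ _ _)) => /eqP.
Qed.

Lemma span_ind (P : W -> Prop) :
  (forall k w w', P w -> P w' -> P (fun a c d => k * w a c d + w' a c d)) ->
  (forall a c d, rng a c d -> P (dl a c d)) ->
  forall w, supported w -> P w.
Proof.
move=> Pl Pd w sw.
have r0 : rng 0 0 0 by rewrite /rng /rr; lia.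
have P0 : P (fun _ _ _ => 0).
  have := Pl (-1) _ _ (Pd _ _ _ r0) (Pd _ _ _ r0); congr P.
  by do 3!apply/funext => ?; rewrite mulN1r addNr.
suff : P (fun a c d => \sum_(t <- pts) w t.1.1 t.1.2 t.2 * dl t.1.1 t.1.2 t.2 a c d).
  congr P; apply/funext => a; apply/funext => c; apply/funext => d.
  have [h|h] := boolP (rng a c d).
    rewrite (bigD1_seq (a, c, d)) ?mem_pts ?pts_uniq//= big1 ?addr0.
      by rewrite /dl eqxx mulr1.
    by move=> [[a' c'] d'] /= /negPf; rewrite /dl eq_sym => ->; rewrite mulr0.
  rewrite sw// big_seq big1// => -[[a' c'] d']; rewrite mem_pts /= => h'.
  by rewrite (dl_supp h')// mulr0.
have : {subset pts <= pts} by [].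
move: {1 3}pts => s; elim: s => [|[[a c] d] s IH] hs.
  by under eq_fun do under eq_fun do under eq_fun do rewrite big_nil.
under eq_fun do under eq_fun do under eq_fun do rewrite big_cons.
apply: Pl; first by apply: Pd; rewrite -mem_pts hs ?mem_head.
by apply: IH => t ts; rewrite hs// in_cons ts orbT.
Qed.

Lemma F0_dl a c d :
  F0 (dl a c d) = fun a' c' d' => [rr c d - a] * dl (a + 1) c d a' c' d'.
Proof.
apply/funext => a'; apply/funext => c'; apply/funext => d'.
rewrite /F0 /dl !xpair_eqE.
have -> : (a' - 1 == a) = (a' == a + 1) by lia.
case h : (_ && _ && _); last by rewrite !mulr0.
by move: h => /andP[/andP[/eqP ? /eqP ?] /eqP ?]; subst; rewrite !(addrK, subrK).
Qed.

Lemma F1_dl a c d :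
  F1 (dl a c d) = fun a' c' d' => al c d * dl a c (d + 1) a' c' d'
                                + be a c d * dl (a - 1) (c + 1) d a' c' d'.
Proof.
apply/funext => a'; apply/funext => c'; apply/funext => d'.
rewrite /F1 /dl !xpair_eqE; congr (_ + _).
  have -> : (d' - 1 == d) = (d' == d + 1) by lia.
  case h : (_ && _ && _); last by rewrite !mulr0.
  by move: h => /andP[/andP[/eqP ? /eqP ?] /eqP ?]; subst; rewrite !(addrK, subrK).
have -> : (a' + 1 == a) = (a' == a - 1) by lia.
have -> : (c' - 1 == c) = (c' == c + 1) by lia.
case h : (_ && _ && _); last by rewrite !mulr0.
by move: h => /andP[/andP[/eqP ? /eqP ?] /eqP ?]; subst; rewrite !(addrK, subrK).
Qed.

(* [dl 0 (c + 1) d] is read off F1 (dl 1 c d), the other term being known. *)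
Lemma generated (P : W -> Prop) : P (dl 0 0 0) ->
  (forall k w w', P w -> P w' -> P (fun a c d => k * w a c d + w' a c d)) ->
  (forall w, supported w -> P w -> P (F0 w)) -> (forall w, supported w -> P w -> P (F1 w)) ->
  forall w, supported w -> P w.
Proof.
move=> P0 Pl PF0 PF1; apply: span_ind => // a c d.
have r0 : rng 0 0 0 by rewrite /rng /rr; lia.
have Pz : P (fun _ _ _ => 0).
  have := Pl (-1) _ _ P0 P0; congr P.
  by do 3!apply/funext => ?; rewrite mulN1r addNr.
have PZ k w : k != 0 -> P (fun a c d => k * w a c d) -> P w.
  move=> k0 /(Pl k^-1 _ _)/(_ Pz); congr P.
  by do 3!apply/funext => ?; rewrite addr0 mulKf.
have step_a c' d' : P (dl 0 c' d') -> forall a', rng a' c' d' -> P (dl a' c' d').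
  move=> h; case=> // a'; elim: a' => [//|a' IH] ra.
  have ra' : rng a' c' d' by move: ra; rewrite /rng; lia.
  have := PF0 _ (dl_supp ra') (IH ra'); rewrite F0_dl -PoszD addn1; apply: PZ.
  by apply: (qi_neq0 q_gen q0); move: ra; rewrite /rng; lia.
move=> rg; apply: (step_a) => //; move: rg; rewrite /rng /rr.
move=> h; have {h}[ec ed cm dn] :
  [/\ c = `|c|%N, d = `|d|%N, Posz `|c| <= m & Posz `|d| <= n] by split; lia.
(* The induction on c is for all d at once: [dl 0 (c + 1) d] also requires [dl 1 c (d + 1)]. *)
rewrite {}ec {}ed; elim: `|c|%N `|d|%N cm dn => {c d} [|c IH] d cm dn.
  elim: d dn => [//|d IH] dn.
  have rd : rng 0 0 d by rewrite /rng /rr; lia.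
  have e : F1 (dl 0 0 d) = fun a c d' => al 0 d * dl 0 0 (d + 1) a c d'.
    rewrite F1_dl /be qi0 mulr0 !mul0r.
    by do 3!apply/funext => ?; rewrite mul0r addr0.
  have -> : Posz d.+1 = d + 1 by lia.
  have := PF1 _ (dl_supp rd) (IH _); rewrite e => h.
  apply: PZ (h _); last by lia.
  by rewrite /al !mulf_neq0 ?invr_neq0 ?(qX0 q0) ?(qi_neq0 q_gen q0)//;
    rewrite /rr; lia.
have r1 : rng 1 c d by rewrite /rng /rr; lia.
have P1 : P (dl 1 c d) by apply: (step_a) => //; apply: (IH); lia.
have e : F1 (dl 1 c d) = fun a' c' d' => al c d * dl 1 c (d + 1) a' c' d'
                                + be 1 c d * dl 0 (c + 1) d a' c' d'.
  by rewrite F1_dl.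
have b0 : be 1 c d != 0.
  by rewrite /be !mulf_neq0 ?invr_neq0 ?(qX0 q0) ?(qi_neq0 q_gen q0)//;
    rewrite /rr; lia.
have -> : Posz c.+1 = c + 1 by lia.
apply: (PZ (be 1 c d) _ b0).
(* At d = n there is no triple (1, c, d + 1), but its coefficient [n - d] vanishes. *)
have [dn1|dn1] := eqVneq (Posz d) n.
  have := PF1 _ (dl_supp r1) P1; congr P; rewrite e.
  do 3!apply/funext => ?.
  by rewrite {1}/al dn1 subrr qi0 mulr0 !mul0r add0r.
have P2 : P (dl 1 c (Posz d + 1)).
  apply: (step_a); last by rewrite /rng /rr; lia.
  rewrite (_ : _ + 1 = Posz d.+1); last by lia.
  by apply: (IH); lia.
have := Pl (- al c d) _ _ P2 (PF1 _ (dl_supp r1) P1); congr P; rewrite e.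
by do 3!apply/funext => ?; rewrite mulNr addKr.
Qed.

(* The coefficients of e1 and f1 in the basis u_{a,c,d}. *)
Definition ced (c d : int) : K :=
  q ^ (d + 1 - n) * (qa (m + d + 2) * qa (n - d) / qa (rr c d + 2)).
Definition cec (a c d : int) : K := q ^ (2 * d - n + 1 - a)
  * (qa (m + n - c + 1) * qa (m - c) * qa a / qa (rr c d)).
Definition cfd (a c d : int) : K :=
  q ^ (1 + a - c - d) * (qa (rr c d - a) * qa d / qa (rr c d)).
Definition cfc (c d : int) : K := q ^ (1 - c) * (qa c / qa (rr c d + 2)).

(** This and the next three lemmas pass to the basis u_{a,c,d}. There each coefficient is a power of
    q times a quotient of values of [qa], so the exponent is its order at q = 0. *)
Lemma ced_lam a c d : rng a c d -> rng a c (d + 1) ->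
  ga a c (d + 1) * lam a c (d + 1) = ced c d * lam a c d.
Proof.
rewrite /rng => h h'; rewrite lam_d /ga /ced; try lia.
have -> : rr c (d + 1) - a = rr c d - a + 1 by rewrite /rr; ring.
have -> : rr c (d + 1) + 1 = rr c d + 2 by rewrite /rr; ring.
have -> : m + (d + 1) + 1 = m + d + 2 by ring.
rewrite /qa.
have -> : q ^ (d + 1 - n) = q ^ c * q ^ (rr c d + 2 - 1)
   / (q ^ (m + d + 2 - 1) * q ^ (n - d - 1)).
  rewrite -!expfzDr// invr_expz -expfzDr//.
  by congr (_ ^ _); rewrite /rr; ring.
by field; rewrite ?(qX0 q0) ?(qi_neq0 q_gen q0)//; lia.
Qed.

Lemma cec_lam a c d : rng a c d -> rng (a - 1) (c + 1) d ->
  de (c + 1) d * lam (a - 1) (c + 1) d = cec a c d * lam a c d.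
Proof.
rewrite /rng => h h'; rewrite lam_c /de /cec; try lia.
have r1 : 0 < rr c d by move: h'; rewrite /rr; lia.
have -> : rr (c + 1) d + 1 = rr c d by rewrite /rr; ring.
have -> : m + n - (c + 1) + 2 = m + n - c + 1 by ring.
rewrite /qa.
have -> : q ^ (2 * d - n + 1 - a) = q ^ rr c d * q ^ (rr c d - 1)
   / (q ^ (m + n - c + 1 - 1) * q ^ (m - c - 1) * q ^ (a - 1)).
  rewrite -!expfzDr// invr_expz -expfzDr//.
  by congr (_ ^ _); rewrite /rr; ring.
by field; rewrite ?(qX0 q0) ?(qi_neq0 q_gen q0)//; lia.
Qed.

Lemma cfd_lam a c d : rng a c d -> rng a c (d - 1) ->
  al c (d - 1) * lam a c (d - 1) = cfd a c d * lam a c d.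
Proof.
rewrite /rng => h h'.
have := @lam_d a c (d - 1); rewrite subrK => ->; try lia.
have -> : rr c (d - 1) - a + 1 = rr c d - a by rewrite /rr; ring.
have r1 : rr c (d - 1) + 1 = rr c d by rewrite /rr; ring.
have r2 : 0 < rr c d by lia.
rewrite /al /cfd r1 /qa.
have -> : q ^ (1 + a - c - d) = q ^ (- c) * q ^ (rr c d - 1)
   / (q ^ (rr c d - a - 1) * q ^ (d - 1)).
  rewrite -!expfzDr// invr_expz -expfzDr//.
  by congr (_ ^ _); rewrite /rr; ring.
by field; rewrite ?(qX0 q0) ?(qi_neq0 q_gen q0)//; lia.
Qed.

Lemma cfc_lam a c d : rng a c d -> rng (a + 1) (c - 1) d ->
  be (a + 1) (c - 1) d * lam (a + 1) (c - 1) d = cfc c d * lam a c d.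
Proof.
rewrite /rng => h h'.
have := @lam_c (a + 1) (c - 1) d; rewrite !(addrK, subrK) => ->; try lia.
have r1 : rr (c - 1) d = rr c d + 1 by rewrite /rr; ring.
rewrite /be /cfc r1 /qa.
have -> : rr c d + 1 + 1 = rr c d + 2 by ring.
have -> : q ^ (1 - c) = q ^ (- (rr c d + 1)) * q ^ (rr c d + 2 - 1) / q ^ (c - 1).
  rewrite -!expfzDr// invr_expz -expfzDr//.
  by congr (_ ^ _); rewrite /rr; ring.
by field; rewrite ?(qX0 q0) ?(qi_neq0 q_gen q0)//; lia.
Qed.

End Model.

(** * Coordinates on an irreducible module *)

Section Coordinates.
Variables (V : lmodType Qq) (M : UqA2_module V) (u : V) (mu : weight).
Variables (i j : 'I_2) (m n : nat).
Hypotheses (ij : i != j) (irr : irreducible_module M).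
Hypotheses (hw : highest_weight_vector M mu u) (mui : mu i = m) (muj : mu j = n).

Local Notation W := (int -> int -> int -> Qq).
Local Notation mz := (Posz m).
Local Notation nz := (Posz n).

Lemma q_neq0 : q != 0.
Proof. by rewrite /q tofrac_eq0 polyX_eq0. Qed.

Lemma q_generic (k : int) : q ^ k = 1 -> k = 0.
Proof.
have nat_case (p : nat) : q ^+ p = 1 -> p = 0%N.
  rewrite /q -rmorphXn/= => /eqP; rewrite -[1]tofrac1 tofrac_eq => /eqP e.
  by have := congr1 (fun x : {poly rat} => size x) e; rewrite size_polyXn size_poly1 => -[].
case: k => k; first by move/nat_case->.
rewrite NegzE -invr_expz => /eqP; rewrite invr_eq1 => /eqP.
by rewrite -exprnP => /nat_case.
Qed.

Local Notation qg := q_generic.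
Local Notation q0 := q_neq0.

Lemma ord2_eq (x : 'I_2) : x = i \/ x = j.
Proof.
have [->|xi] := eqVneq x i; first by left.
right; apply/val_inj; move: ij xi; rewrite -!val_eqE /=.
by case: x i j => [[|[]]//= ?] [[|[]]//= ?] [[|[]]//= ?].
Qed.

(** The index [i] plays the part of 0 in the triples, so that the construction can be run for both
    orders of the two indices. *)
Definition modF (x : 'I_2) : W -> W := if x == i then F0 q mz else F1 q mz nz.
Definition modE (x : 'I_2) : W -> W := if x == i then E0 q else E1 q mz nz.
Definition modwt (x : 'I_2) : int -> int -> int -> int :=
  if x == i then wt0 mz else wt1 nz.
Local Notation supp := (supported mz nz).
Definition wlin (k : Qq) (w w' : W) : W := fun a c d => k * w a c d + w' a c d.
Local Notation modT x := (Tz q (modwt x)).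
Local Notation modTV x := (Tz q (fun a c d => - modwt x a c d)).
Local Notation dl0 := (dl Qq 0 0 0).
Local Notation w0 := (fun _ _ _ : int => 0 : Qq).

Let ji : (j == i) = false. Proof. by rewrite eq_sym (negPf ij). Qed.

Lemma modFi : modF i = F0 q mz. Proof. by rewrite /modF eqxx. Qed.
Lemma modFj : modF j = F1 q mz nz. Proof. by rewrite /modF ji. Qed.
Lemma modEi : modE i = E0 q. Proof. by rewrite /modE eqxx. Qed.
Lemma modEj : modE j = E1 q mz nz. Proof. by rewrite /modE ji. Qed.
Lemma modwti : modwt i = wt0 mz. Proof. by rewrite /modwt eqxx. Qed.
Lemma modwtj : modwt j = wt1 nz. Proof. by rewrite /modwt ji. Qed.
Let modE_ := (modFi, modFj, modEi, modEj, modwti, modwtj).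

Lemma rng000 : rng mz nz 0 0 0.
Proof. by rewrite /rng /rr; lia. Qed.

Lemma dl0_supp : supp dl0. Proof. exact/dl_supp/rng000. Qed.

Lemma modF_supp x w : supp w -> supp (modF x w).
Proof. by rewrite /modF; case: ifP => _; [apply: (F0_supp q0) | apply: (F1_supp q0)]. Qed.

Lemma wlin_supp k w w' : supp w -> supp w' -> supp (wlin k w w').
Proof. by move=> h h' a c d r; rewrite /wlin h// h'// mulr0 addr0. Qed.

Lemma modE_lin x k w w' : modE x (wlin k w w') = wlin k (modE x w) (modE x w').
Proof.
by do 3!apply/funext => ?; rewrite /modE; case: ifP => _; rewrite /E0 /E1 /wlin; ring.
Qed.

Lemma Tz_lin g k w w' : Tz q g (wlin k w w') = wlin k (Tz q g w) (Tz q g w').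
Proof. by do 3!apply/funext => ?; rewrite /Tz /wlin; ring. Qed.

Lemma modTF x y w :
  modT x (modF y w) = wlin (q ^ (- cartan x y)) (modF y (modT x w)) w0.
Proof.
rewrite /wlin; under [RHS]eq_fun do under eq_fun do under eq_fun do rewrite addr0.
case: (ord2_eq x) => ->; case: (ord2_eq y) => ->;
  rewrite !modE_ /cartan ?eqxx ?ji ?(negPf ij).
- by apply: (TzF0 _ q0) => a c d; rewrite /wt0 /rr; ring.
- by apply: (TzF1 _ _ q0) => a c d; rewrite /wt0 /rr; ring.
- by apply: (TzF0 _ q0) => a c d; rewrite /wt1 /rr; ring.
- by apply: (TzF1 _ _ q0) => a c d; rewrite /wt1 /rr; ring.
Qed.

Lemma modTVF x y w :
  modTV x (modF y w) = wlin (q ^ cartan x y) (modF y (modTV x w)) w0.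
Proof.
rewrite /wlin; under [RHS]eq_fun do under eq_fun do under eq_fun do rewrite addr0.
case: (ord2_eq x) => ->; case: (ord2_eq y) => ->;
  rewrite !modE_ /cartan ?eqxx ?ji ?(negPf ij).
- by apply: (TzF0 _ q0) => a c d; rewrite /wt0 /rr; ring.
- by apply: (TzF1 _ _ q0) => a c d; rewrite /wt0 /rr; ring.
- by apply: (TzF0 _ q0) => a c d; rewrite /wt1 /rr; ring.
- by apply: (TzF1 _ _ q0) => a c d; rewrite /wt1 /rr; ring.
Qed.

Lemma modEF x y w : supp w -> modE x (modF y w) =
  wlin 1 (modF y (modE x w))
    (if x == y then fun a c d => (q - q^-1)^-1 * (modT x w a c d - modTV x w a c d)
     else w0).
Proof.
move=> sw; apply/funext => a; apply/funext => c; apply/funext => d.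
have qE z : qi q (z a c d) * w a c d
    = (q - q^-1)^-1 * (Tz q z w a c d - Tz q (fun a c d => - z a c d) w a c d).
  by rewrite qiE qn.unlock invr_expz /Tz; ring.
rewrite /wlin; case: (ord2_eq x) => ->; case: (ord2_eq y) => ->;
  rewrite ?eqxx ?ji ?(negPf ij) !modE_ mul1r.
- by rewrite -qE -(E0F0 _ qg q0) addrC subrK.
- by rewrite E0F1 addr0.
- by rewrite E1F0 addr0.
- by rewrite -qE -(E1F1 qg q0 _ _ _ sw) addrC subrK.
Qed.

Lemma modE_dl0 x : modE x dl0 = w0.
Proof.
apply/funext => a; apply/funext => c; apply/funext => d.
case: (ord2_eq x) => ->; rewrite !modE_ /E0 /E1 /dl !xpair_eqE.
  have [->|_] := eqVneq (a + 1) 0; last by rewrite mulr0.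
  by rewrite qi0 mul0r.
rewrite -[RHS]addr0; congr (_ + _).
  have [h|_] := eqVneq (d + 1) 0; last by rewrite !andbF mulr0.
  by rewrite /ga h qi0 mulr0 !mul0r.
have [h|_] := eqVneq (c + 1) 0; last by rewrite andbF mulr0.
by rewrite /de h qi0 mulr0 !mul0r.
Qed.

Lemma modwt000 x : modwt x 0 0 0 = mu x.
Proof.
by case: (ord2_eq x) => ->; rewrite !modE_ ?mui ?muj /wt0 /wt1 /rr; ring.
Qed.

Lemma Tz_dl0 g : Tz q g dl0 = wlin (q ^ g 0 0 0) dl0 w0.
Proof.
do 3!apply/funext => ?; rewrite /Tz /wlin /dl addr0.
by case: eqP => [[-> -> ->]|_] //; rewrite !mulr0.
Qed.

Lemma linearZZ (f : {linear V -> V}) k v : f (k *: v) = k *: f v.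
Proof. by rewrite linearZ. Qed.

(* The graph of an isomorphism from V to the supported functions: it is the
   submodule of the product generated by (u, dl0), and [relV0] and [relW0] make it
   functional and injective. *)
Inductive rel : V -> W -> Prop :=
| rel_base : rel u dl0
| rel_lin k v v' w w' : rel v w -> rel v' w' -> rel (k *: v + v') (wlin k w w')
| rel_F x v w : rel v w -> rel (uf M x v) (modF x w).

Lemma rel_supp v w : rel v w -> supp w.
Proof.
by elim=> [|*|*]; [exact: dl0_supp | exact: wlin_supp | exact: modF_supp].
Qed.

Lemma rel00 : rel 0 w0.
Proof.
have := rel_lin (-1) rel_base rel_base.
rewrite scaleN1r addNr; congr rel.
by do 3!apply/funext => ?; rewrite /wlin mulN1r addNr.
Qed.

Lemma relZ k v w : rel v w -> rel (k *: v) (wlin k w w0).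
Proof. by move=> h; have := rel_lin k h rel00; rewrite addr0. Qed.

(** The defining relations give the commutation of t with f; conjugation by t^-1 gives that of
    t^-1. *)
Lemma utV_eigen x y v k : k != 0 -> (forall v, ut M x (uf M y v) = k *: uf M y (ut M x v)) ->
  utV M x (uf M y v) = k^-1 *: uf M y (utV M x v).
Proof.
move=> k0 h; rewrite -{1}(u_ttV M x v).
have := congr1 (utV M x) (h (utV M x v)); rewrite u_tVt linearZ /= => ->.
by rewrite scalerA mulVf// scale1r.
Qed.

Lemma rel_T x v w : rel v w -> rel (ut M x v) (modT x w).
Proof.
elim=> {v w} [|k v v' w w' _ h _ h'|y v w _ h].
- case: hw => _ _ /(_ x) ->; rewrite Tz_dl0 modwt000.
  exact/relZ/rel_base.
- by rewrite linearP Tz_lin; apply: rel_lin.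
by rewrite u_tf modTF; apply/relZ/rel_F.
Qed.

Lemma rel_TV x v w : rel v w -> rel (utV M x v) (modTV x w).
Proof.
elim=> {v w} [|k v v' w w' _ h _ h'|y v w _ h].
- have e : utV M x u = q ^ (- mu x) *: u.
    case: hw => _ _ /(_ x) e.
    have := congr1 (utV M x) e; rewrite u_tVt linearZ /= => {2}->.
    by rewrite scalerA -invr_expz mulVf ?scale1r// expfz_neq0 ?q_neq0.
  rewrite e Tz_dl0 modwt000; exact/relZ/rel_base.
- by rewrite linearP Tz_lin; apply: rel_lin.
rewrite (utV_eigen _ (k := q ^ (- cartan x y))) ?expfz_neq0 ?q_neq0//; last first.
  by move=> ?; rewrite u_tf.
by rewrite invr_expz opprK modTVF; apply/relZ/rel_F.
Qed.

(** [rel] is generated by the f's alone: e is moved past them, through the commutator, until it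
    reaches u. *)
Lemma rel_E x v w : rel v w -> rel (ue M x v) (modE x w).
Proof.
elim=> {v w} [|k v v' w w' _ h _ h'|y v w r h].
- by case: hw => _ /(_ x) -> _; rewrite modE_dl0; apply: rel00.
- by rewrite linearP modE_lin; apply: rel_lin.
rewrite modEF; last exact: rel_supp r.
have -> : ue M x (uf M y v) = 1 *: uf M y (ue M x v)
    + (if x == y then (q - q^-1)^-1 *: (ut M x v - utV M x v) else 0).
  by rewrite scale1r -u_ef addrC subrK.
apply: rel_lin; first exact: rel_F.
case: ifP => _; last exact: rel00.
have -> : ut M x v - utV M x v = -1 *: utV M x v + ut M x v.
  by rewrite scaleN1r addrC.
have := relZ (q - q^-1)^-1 (rel_lin (-1) (rel_TV x r) (rel_T x r)); congr rel.
by do 3!apply/funext => ?; rewrite /wlin; ring.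
Qed.

(* [grd] acts by q ^ (tot - h) at height h, and [hkill N] annihilates the vectors
   whose components have heights 1, ..., N. *)
Definition grd (v : V) : V := ut M i (ut M j v).
Definition tot : int := (m + n)%N.

Lemma grdP k v v' : grd (k *: v + v') = k *: grd v + grd v'.
Proof. by rewrite /grd (linearP (ut M j)) (linearP (ut M i)). Qed.

Lemma grd0 : grd 0 = 0.
Proof. by rewrite /grd !raddf0. Qed.

Lemma grdZ k v : grd (k *: v) = k *: grd v.
Proof. by rewrite -[k *: v]addr0 grdP grd0 addr0. Qed.

Lemma grdB v v' : grd (v - v') = grd v - grd v'.
Proof. by rewrite addrC -scaleN1r grdP scaleN1r addrC. Qed.

Fixpoint hkill (N : nat) (v : V) : V :=
  if N is N'.+1 then grd (hkill N' v) - q ^ (tot - N%:Z) *: hkill N' v else v.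

Lemma hkillP N k v v' : hkill N (k *: v + v') = k *: hkill N v + hkill N v'.
Proof.
elim: N => //= N ->; rewrite grdP scalerDr scalerBr opprD !scalerA [_ * k]mulrC.
exact: addrACA.
Qed.

Lemma hkill0 N : hkill N 0 = 0.
Proof.
by have := hkillP N (-1) 0 0; rewrite scaleN1r addNr => ->; rewrite scaleN1r addNr.
Qed.

Lemma hkill_le N N' v : (N <= N')%N -> hkill N v = 0 -> hkill N' v = 0.
Proof.
move=> /subnK <- h; elim: (N' - N)%N => // k IH.
by rewrite addSn /= IH grd0 scaler0 subr0.
Qed.

Lemma grdF x v : grd (uf M x v) = q^-1 *: uf M x (grd v).
Proof.
rewrite /grd u_tf (linearZZ (ut M i)) /= u_tf scalerA -expfzDr ?q_neq0//.
suff -> : - cartan j x - cartan i x = -1 by [].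
by case: (ord2_eq x) => ->; rewrite /cartan ?eqxx ?ji ?(negPf ij).
Qed.

Lemma grd_hkill N v : grd (hkill N v) = hkill N (grd v).
Proof.
by elim: N v => //= N IH v; rewrite -IH grdB grdZ.
Qed.

(** As f raises the height by 1, passing it turns the factor for height k into q^-1 times the factor
    for height k - 1. The heights 1, ..., N + 1 become 0, ..., N, and the factor for height 0 is
    written apart. *)
Lemma hkillF N x v :
  hkill N.+1 (uf M x v)
  = q ^- N.+1 *: uf M x (hkill N (grd v - q ^ tot *: v)).
Proof.
elim: N => [|N IH].
  rewrite /= grdF -[(tot - 1)]/(tot + -1) expfzDr ?q_neq0// mulrC.
  by rewrite -[_ * _ *: _]scalerA -scalerBr (linearB (uf M x)) (linearZZ (uf M x)).
have -> : hkill N.+2 (uf M x v)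
  = grd (hkill N.+1 (uf M x v)) - q ^ (tot - N.+2%:Z) *: hkill N.+1 (uf M x v) by [].
rewrite {}IH; set z := grd v - _.
have -> : hkill N.+1 z = grd (hkill N z) - q ^ (tot - N.+1%:Z) *: hkill N z by [].
have e : q ^ (tot - N.+2%:Z) = q^-1 * q ^ (tot - N.+1%:Z).
  by rewrite -[q^-1]/(q ^ -1) -expfzDr ?q_neq0//; congr (_ ^ _); lia.
rewrite grdZ grdF (linearB (uf M x)) (linearZZ (uf M x)) e scalerBr !scalerA.
have -> : q ^- N.+2 = q ^- N.+1 / q by rewrite exprS invfM mulrC.
by congr (_ - _ *: _); ring.
Qed.

Lemma expq_sub_neq0 (T k : int) : k != 0 -> q ^ T - q ^ (T - k) != 0.
Proof.
move=> k0; rewrite subr_eq0; apply: contra k0 => /eqP h; apply/eqP/q_generic.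
apply: (@mulfI _ (q ^ (T - k))); first by rewrite expfz_neq0 ?q_neq0.
by rewrite -expfzDr ?q_neq0// subrK mulr1.
Qed.

(** u has height 0, so every factor acts on it by a nonzero scalar. *)
Lemma hkill_u N : hkill N u != 0.
Proof.
have [u0 _ wu] := hw; have gu : grd u = q ^ tot *: u.
  by rewrite /grd (wu j) linearZZ (wu i) scalerA muj mui -expfzDr ?q_neq0// addrC.
suff [k k0 ->] : exists2 k, k != 0 & hkill N u = k *: u.
  by rewrite scaler_eq0 negb_or k0.
elim: N => [|N [k k0 e]]; first by exists 1; rewrite ?oner_neq0 ?scale1r.
exists ((q ^ tot - q ^ (tot - N.+1%:Z)) * k).
  apply: mulf_neq0 k0; exact: (@expq_sub_neq0 tot N.+1%:Z isT).
by rewrite /= e grdZ gu mulrBl scalerBl !scalerA [k * _]mulrC.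
Qed.

(** Every vector obtained by an f has only components of positive height, so w(0, 0, 0) is the
    coefficient of u in v. Both [relV0] and [relW0] rest on this. *)
Lemma rel_top v w : rel v w -> exists N, hkill N (v - w 0 0 0 *: u) = 0.
Proof.
elim=> {v w} [|k v v' w w' _ [N h] _ [N' h']|x v w r [N h]].
- by exists 0%N; rewrite /= /dl eqxx scale1r subrr.
- exists (maxn N N'); rewrite /wlin.
  have -> : k *: v + v' - (k * w 0 0 0 + w' 0 0 0) *: u
     = k *: (v - w 0 0 0 *: u) + (v' - w' 0 0 0 *: u).
    by rewrite scalerDl opprD addrACA scalerBr scalerA.
  rewrite hkillP (hkill_le (leq_maxl N N') h) (hkill_le (leq_maxr N N') h').
  by rewrite scaler0 addr0.
exists N.+1; have -> : modF x w 0 0 0 = 0.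
  have sw := rel_supp r.
  case: (ord2_eq x) => ->; rewrite !modE_ /F0 /F1.
    by rewrite sw ?mulr0 // /rng; lia.
  by rewrite !sw ?mulr0 ?addr0 // /rng; lia.
(* The factor for height 0 removes the multiple of u from v, and [hkill N] kills the rest. *)
rewrite scale0r subr0 hkillF.
have -> : v = w 0 0 0 *: u + (v - w 0 0 0 *: u) by rewrite addrC subrK.
have [u0 _ wu] := hw; have gu : grd u = q ^ tot *: u.
  by rewrite /grd (wu j) linearZZ (wu i) scalerA muj mui -expfzDr ?q_neq0// addrC.
set v1 := v - _ in h *; rewrite grdP gu scalerDr opprD addrACA !scalerA.
rewrite [q ^ _ * _]mulrC subrr add0r -scaleNr addrC hkillP h scaler0 add0r.
by rewrite -grd_hkill h grd0 raddf0 scaler0.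
Qed.

(** These vectors form a submodule, so it is enough that u is not among them: some [hkill N] would
    kill u. *)
Lemma relV0 v : rel v w0 -> v = 0.
Proof.
move=> h; have sub : submodule M [set v | rel v w0].
  split=> /= [|k v1 v2 h1 h2|x v1 h1|x v1 h1|x v1 h1].
  - exact: rel00.
  - have := rel_lin k h1 h2; congr rel.
    by do 3!apply/funext => ?; rewrite /wlin mulr0 addr0.
  - have := rel_E x h1; congr rel; do 3!apply/funext => ?.
    by rewrite /modE; case: ifP => _; rewrite /E0 /E1 !mulr0 ?addr0.
  - have := rel_F x h1; congr rel; do 3!apply/funext => ?.
    by rewrite /modF; case: ifP => _; rewrite /F0 /F1 !mulr0 ?addr0.
  split; [have := rel_T x h1|have := rel_TV x h1]; congr rel;
    by do 3!apply/funext => ?; rewrite /Tz mulr0.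
case: irr => _ /(_ _ sub) [e|e].
  by have : [set v | rel v w0] v by []; rewrite e.
have : [set v | rel v w0] u by rewrite e.
move=> /= /rel_top [N]; rewrite scale0r subr0 => /eqP.
by rewrite (negPf (hkill_u N)).
Qed.

(** The functions related to 0 vanish at the origin and are stable under e and t. By adjunction they
    are orthogonal to all that is generated from [dl0], which is everything. *)
Lemma relW0 w : rel 0 w -> w = w0.
Proof.
move=> h; apply: (form_nondeg q_generic q_neq0 _ _ (rel_supp h)) => // w' sw'.
have top w1 : rel 0 w1 -> w1 0 0 0 = 0.
  move=> /rel_top [N]; rewrite sub0r -scaleNr -[_ *: u]addr0 hkillP hkill0 addr0.
  move=> /eqP; rewrite scaler_eq0 (negPf (hkill_u N)) orbF oppr_eq0 => /eqP//.
suff : forall w1, rel 0 w1 -> form q mz nz w' w1 = 0 by apply.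
pose P w' := forall w1, rel 0 w1 -> form q mz nz w' w1 = 0.
apply: (@generated _ _ mz nz q_generic q_neq0 _ _ P) sw' => // {w'}.
- by move=> w1 /top h1; rewrite form_dl ?rng000 ?q_neq0// h1 mulr0.
- move=> k w1 w2 h1 h2 w3 r3.
  have -> : form q mz nz (fun a c d => k * w1 a c d + w2 a c d) w3
     = k * form q mz nz w1 w3 + form q mz nz w2 w3.
    by rewrite /form mulr_sumr -big_split; apply: eq_bigr => t _ /=; ring.
  by rewrite h1// h2// mulr0 addr0.
- move=> w1 s1 h1 w2 r2.
  rewrite (form_F0 q_generic q_neq0)//; last exact: rel_supp r2.
  have := rel_T i (rel_E i r2); rewrite !raddf0 modEi modwti => /h1 ->.
  by rewrite mulr0.
move=> w1 s1 h1 w2 r2.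
rewrite (form_F1 q_generic q_neq0)//; last exact: rel_supp r2.
have := rel_T j (rel_E j r2); rewrite !raddf0 modEj modwtj => /h1 ->.
by rewrite mulr0.
Qed.

Lemma rel_total v : exists w, rel v w.
Proof.
have sub : submodule M [set v | exists w, rel v w].
  split=> /= [|k v1 v2 [w1 h1] [w2 h2]|x v1 [w1 h1]|x v1 [w1 h1]|x v1 [w1 h1]].
  - by exists w0; apply: rel00.
  - by exists (wlin k w1 w2); apply: rel_lin.
  - by exists (modE x w1); apply: rel_E.
  - by exists (modF x w1); apply: rel_F.
  - by split; [exists (modT x w1); apply: rel_T | exists (modTV x w1); apply: rel_TV].
case: irr => _ /(_ _ sub) [e|e].
  have : [set v | exists w, rel v w] u by exists dl0; apply: rel_base.
  by rewrite e => /= u0; case: hw; rewrite u0 eqxx.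
by have : [set v | exists w, rel v w] v by rewrite e.
Qed.

Lemma rel_onto w : supp w -> exists v, rel v w.
Proof.
apply: (@generated _ _ mz nz q_generic q_neq0 _ _ (fun w => exists v, rel v w)) => //.
- by exists u; apply: rel_base.
- by move=> k w1 w2 [v1 h1] [v2 h2]; exists (k *: v1 + v2); apply: rel_lin.
- by move=> w1 s1 [v1 h1]; exists (uf M i v1); rewrite -modFi; apply: rel_F.
by move=> w1 s1 [v1 h1]; exists (uf M j v1); rewrite -modFj; apply: rel_F.
Qed.

End Coordinates.

(* Coordinates on V in which u is the origin: f_i and e_i act by F0 and E0 and
   the other two operators by F1 and E1. *)
Record coords (V : lmodType Qq) (M : UqA2_module V) (u : V) (i j : 'I_2)
    (m n : nat) := Coords {
  crd :> V -> int -> int -> int -> Qq;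
  crdP : forall k v w, crd (k *: v + w) = wlin k (crd v) (crd w);
  crd_inj : injective crd;
  crd_supp : forall v, supported m n (crd v);
  crd_onto : forall w, supported m n w -> exists v, crd v = w;
  crd_u : crd u = dl Qq 0 0 0;
  crd_ei : forall v, crd (ue M i v) = E0 q (crd v);
  crd_ej : forall v, crd (ue M j v) = E1 q m n (crd v);
  crd_fi : forall v, crd (uf M i v) = F0 q m (crd v);
  crd_fj : forall v, crd (uf M j v) = F1 q m n (crd v);
  crd_ti : forall v, crd (ut M i v) = Tz q (wt0 m) (crd v);
  crd_tj : forall v, crd (ut M j v) = Tz q (wt1 n) (crd v) }.

Lemma coords_exist (V : lmodType Qq) (M : UqA2_module V) (u : V) (mu : weight)
    (i j : 'I_2) (m n : nat) : i != j -> irreducible_module M ->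
  highest_weight_vector M mu u -> mu i = m -> mu j = n ->
  inhabited (coords M u i j m n).
Proof.
move=> ij irr hw mui muj.
have [crd crdR] := choice (rel_total ij irr hw mui muj).
have uniqW v w w' : rel M u i m n v w -> rel M u i m n v w' -> w = w'.
  move=> r r'; have := rel_lin (-1) r r'; rewrite scaleN1r addNr.
  move=> /(relW0 ij hw mui muj) e.
  apply/funext => a; apply/funext => c; apply/funext => d.
  have /(congr1 (fun g => g a c d)) := e.
  by rewrite /wlin mulN1r addrC => /subr0_eq.
have crdE v w : rel M u i m n v w -> crd v = w by apply: uniqW.
constructor; apply: (@Coords _ _ _ _ _ _ _ crd).
- by move=> k v w; apply/crdE/rel_lin.
- move=> v v' e; have := rel_lin (-1) (crdR v) (crdR v').
  rewrite e => h; apply/eqP; rewrite eq_sym -subr_eq0 addrC -scaleN1r; apply/eqP.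
  apply: (relV0 ij irr hw mui muj); move: h; congr rel.
  by do 3!apply/funext => ?; rewrite /wlin mulN1r addNr.
- by move=> v; exact: (rel_supp mui muj (crdR v)).
- by move=> w /(rel_onto M u ij)[v /crdE]; exists v.
- exact/crdE/rel_base.
- by move=> v; apply: crdE; rewrite -(modEi i m n); apply: (rel_E ij hw mui muj).
- by move=> v; apply: crdE; rewrite -(modEj m n ij); apply: (rel_E ij hw mui muj).
- by move=> v; apply: crdE; rewrite -(modFi i m n); apply: rel_F.
- by move=> v; apply: crdE; rewrite -(modFj m n ij); apply: rel_F.
- by move=> v; apply: crdE; rewrite -(modwti i m n); apply: (rel_T ij hw mui muj).
by move=> v; apply: crdE; rewrite -(modwtj m n ij); apply: (rel_T ij hw mui muj).
Qed.

(** * Rational functions regular at q = 0 and their values there *)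

Lemma fracP (R : idomainType) (c : {fraction R}) :
  exists n d : R, d != 0 /\ c = tofrac n / tofrac d.
Proof.
elim/quotW: c => x; exists (frac x).1, (frac x).2; split; first exact: denom_ratioP.
rewrite /tofrac /=; unlock; rewrite !piE /mulf /invf.
by rewrite !numden_Ratio ?oner_neq0 ?denom_ratioP// mul1r mulr1 Ratio_numden.
Qed.

Definition cst (r : rat) : Qq := tofrac r%:P.

(* [res c r]: c is regular at q = 0 and takes the value r there. *)
Definition res (c : Qq) (r : rat) : Prop :=
  exists2 d, regular0 d & c = cst r + q * d.

Lemma cst0 : cst 0 = 0. Proof. by rewrite /cst polyC0 tofrac0. Qed.
Lemma cst1 : cst 1 = 1. Proof. by rewrite /cst polyC1 tofrac1. Qed.
Lemma cstD r r' : cst (r + r') = cst r + cst r'.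
Proof. by rewrite /cst polyCD tofracD. Qed.
Lemma cstM r r' : cst (r * r') = cst r * cst r'.
Proof. by rewrite /cst polyCM tofracM. Qed.

Lemma regP (n d : {poly rat}) : d.[0] != 0 -> regular0 (tofrac n / tofrac d).
Proof. by exists n, d. Qed.

Lemma reg_poly (p : {poly rat}) : regular0 (tofrac p).
Proof.
by rewrite -[tofrac p]divr1 -tofrac1; apply: regP; rewrite hornerC oner_neq0.
Qed.

Lemma reg_cst r : regular0 (cst r). Proof. exact: reg_poly. Qed.

Lemma reg_q : regular0 q. Proof. exact: reg_poly. Qed.

Lemma root0_neq0 (d : {poly rat}) : d.[0] != 0 -> tofrac d != 0.
Proof. by rewrite tofrac_eq0; apply: contra => /eqP->; rewrite horner0. Qed.

Lemma regD c c' : regular0 c -> regular0 c' -> regular0 (c + c').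
Proof.
move=> [n [d [d0 ->]]] [n' [d' [d'0 ->]]].
exists (n * d' + n' * d), (d * d'); rewrite hornerM mulf_neq0//; split => //.
by rewrite tofracD !tofracM addf_div ?root0_neq0.
Qed.

Lemma regM c c' : regular0 c -> regular0 c' -> regular0 (c * c').
Proof.
move=> [n [d [d0 ->]]] [n' [d' [d'0 ->]]].
exists (n * n'), (d * d'); rewrite hornerM mulf_neq0//; split => //.
by rewrite !tofracM mulf_div.
Qed.

Lemma reg0 : regular0 0. Proof. by rewrite -cst0; apply: reg_cst. Qed.
Lemma reg1 : regular0 1. Proof. by rewrite -cst1; apply: reg_cst. Qed.

Lemma regN c : regular0 c -> regular0 (- c).
Proof.
move=> h; rewrite -mulN1r; apply: regM => //.
by rewrite -tofrac1 -tofracN; apply: reg_poly.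
Qed.

Lemma regX c k : regular0 c -> regular0 (c ^+ k).
Proof.
by move=> h; elim: k => [|k IH]; rewrite ?expr0 ?exprS; [apply: reg1|apply: regM].
Qed.

Lemma reg_qz (z : int) : 0 <= z -> regular0 (q ^ z).
Proof. by case: z => // k _; rewrite -exprnP; apply/regX/reg_q. Qed.

Lemma reg_sum (I : Type) (s : seq I) (P : pred I) (F : I -> Qq) :
  (forall i, P i -> regular0 (F i)) -> regular0 (\sum_(i <- s | P i) F i).
Proof.
move=> h; apply: (big_ind regular0) => //; [exact: reg0 | exact: regD].
Qed.

Lemma res_reg c r : res c r -> regular0 c.
Proof. by move=> [d hd ->]; apply: regD; [exact: reg_cst | apply: regM; [exact: reg_q|]]. Qed.

Lemma reg_res c : regular0 c -> exists r, res c r.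
Proof.
move=> [n [d [d0 ->]]]; exists (n.[0] / d.[0]).
have : root (n - (n.[0] / d.[0])%:P * d) 0.
  by rewrite /root !hornerE mulfVK// subrr.
case/factor_theorem => p; rewrite polyC0 subr0 => e.
exists (tofrac p / tofrac d); first exact: regP.
have -> : n = (n.[0] / d.[0])%:P * d + p * 'X by rewrite -e addrC subrK.
have h0 : (p * 'X).[0] = 0 :> rat by rewrite hornerMX mulr0.
rewrite hornerD h0 addr0 hornerM hornerC mulfVK//.
by rewrite tofracD !tofracM -/q mulrDl mulfK ?root0_neq0// mulrA [q * _]mulrC.
Qed.

Lemma res_cst r : res (cst r) r.
Proof. by exists 0; [exact: reg0 | rewrite mulr0 addr0]. Qed.

Lemma res0 : res 0 0. Proof. by rewrite -{1}cst0; apply: res_cst. Qed.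
Lemma res1 : res 1 1. Proof. by rewrite -{1}cst1; apply: res_cst. Qed.

Lemma res_qM d : regular0 d -> res (q * d) 0.
Proof. by move=> h; exists d; rewrite // cst0 add0r. Qed.

Lemma res0P c : res c 0 -> exists2 d, regular0 d & c = q * d.
Proof. by move=> [d h]; rewrite cst0 add0r; exists d. Qed.

Lemma resD c c' r r' : res c r -> res c' r' -> res (c + c') (r + r').
Proof.
move=> [d hd ->] [d' hd' ->]; exists (d + d'); first exact: regD.
by rewrite cstD; ring.
Qed.

Lemma resM c c' r r' : res c r -> res c' r' -> res (c * c') (r * r').
Proof.
move=> [d hd ->] [d' hd' ->].
exists (cst r * d' + d * cst r' + q * (d * d')); last by rewrite cstM; ring.
by repeat (first [apply: regD | apply: regM]) => //; (exact: reg_cst || exact: reg_q).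
Qed.

Lemma resN c r : res c r -> res (- c) (- r).
Proof.
have h : res (-1) (-1).
  have -> : (-1 : Qq) = cst (-1) by rewrite /cst polyCN polyC1 tofracN tofrac1.
  exact: res_cst.
by move=> /(resM h); rewrite !mulN1r.
Qed.

Lemma resB c c' r r' : res c r -> res c' r' -> res (c - c') (r - r').
Proof. by move=> h /resN; apply: resD. Qed.

Lemma res_eq c r r' : res c r -> res c r' -> r = r'.
Proof.
move=> h h'; have := resB h h'; rewrite subrr => -[d [n [e [e0 ->]]]] /esym h1.
apply/eqP; rewrite -subr_eq0; apply/eqP.
have e1 : tofrac ((r - r')%:P * e + 'X * n) = 0.
  rewrite tofracD !tofracM -/(cst _) -/q.
  have -> : cst (r - r') = - (q * (tofrac n / tofrac e)).
    by apply/eqP; rewrite -addr_eq0 h1.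
  by rewrite mulNr mulrA mulrVK ?unitfE ?root0_neq0// addNr.
move/eqP: e1; rewrite tofrac_eq0 => /eqP /(congr1 (fun p => p.[0])).
rewrite !hornerE ?mul0r ?addr0 => /eqP; rewrite mulf_eq0 (negPf e0) orbF.
by move/eqP.
Qed.

Lemma resV c r : r != 0 -> res c r -> res c^-1 r^-1.
Proof.
move=> r0 h.
have [s hs] : exists s, res c^-1 s.
  have [n [d [d0 e]]] := res_reg h.
  apply: reg_res; exists d, n; split; last by rewrite e invf_div.
  (* If the numerator vanished at 0, then q would divide c and its value r would be 0. *)
  apply/eqP => n0; have := reg_res (reg_poly n) => -[s].
  have : root n 0 by apply/eqP.
  case/factor_theorem => p; rewrite polyC0 subr0 => en.
  have h0 : res c 0.
    rewrite e en tofracM -/q mulrAC mulrC.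
    by apply: res_qM; apply: regP.
  by move: r0; rewrite (res_eq h h0) eqxx.
have c0 : c != 0.
  by apply/eqP => c0; move: h r0; rewrite c0 => /(res_eq res0) <-; rewrite eqxx.
have := resM h hs; rewrite divff// => /(res_eq res1) e.
suff <- : s = r^-1 by [].
by apply: (mulfI r0); rewrite -e divff.
Qed.

Lemma res_sum (I : Type) (s : seq I) (P : pred I) (F : I -> Qq) (f : I -> rat) :
  (forall i, P i -> res (F i) (f i)) ->
  res (\sum_(i <- s | P i) F i) (\sum_(i <- s | P i) f i).
Proof. by move=> h; apply: (big_ind2 res) => // [|*]; [exact: res0 | exact: resD]. Qed.

Lemma clear_denom c : exists N, regular0 (q ^+ N * c).
Proof.
have [n [d [d0 ->]]] := fracP c.
(* k is the multiplicity of the root 0 in the denominator. *)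
have [k [p h ->]] := multiplicity_XsubC d 0; rewrite d0 /= in h.
exists k; rewrite polyC0 subr0 tofracM tofracXn -/q.
suff -> : q ^+ k * (tofrac n / (tofrac p * q ^+ k)) = tofrac n / tofrac p.
  exact: regP.
by rewrite invfM mulrC -!mulrA mulVf ?mulr1// expf_neq0 ?q_neq0.
Qed.

Lemma clear_denoms (I : eqType) (s : seq I) (F : I -> Qq) :
  exists N, forall i, i \in s -> regular0 (q ^+ N * F i).
Proof.
elim: s => [|i s [N h]]; first by exists 0%N.
have [N' h'] := clear_denom (F i).
exists (N + N')%N => k; rewrite in_cons exprD => /orP[/eqP->|ks].
  by rewrite -mulrA; apply: regM h'; apply/regX/reg_q.
by rewrite mulrAC mulrC; apply: regM (h _ ks); apply/regX/reg_q.
Qed.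

(* Squares of leading coefficients cannot cancel over rat. *)
Lemma reg_sum_squares (I : eqType) (s : seq I) (nu F : I -> Qq) :
  (forall i, i \in s -> res (nu i) 1) ->
  regular0 (\sum_(i <- s) nu i * F i ^+ 2) ->
  forall i, i \in s -> regular0 (F i).
Proof.
move=> hnu hs; have [N] := clear_denoms s F.
elim: N => [|N IH] h i is_; first by have := h i is_; rewrite mul1r.
apply: IH is_ => {i} i is_.
pose G i := q ^+ N.+1 * F i.
have /choice [r hr] : forall i, exists r, i \in s -> res (G i) r.
  move=> k; have [/h/reg_res[r]|] := boolP (k \in s); first by exists r.
  by exists 0.
(* The sum times q^(2N + 2) vanishes at 0, so the values of q^(N + 1) F have zero sum of squares.
   Each of them is 0, and one factor q can be removed from the bound. *)
have e : \sum_(i <- s) r i ^+ 2 = 0.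
  apply: (@res_eq (\sum_(i <- s) nu i * G i ^+ 2)).
    rewrite big_seq [X in res _ X]big_seq; apply: res_sum => k ks.
    rewrite -[_ ^+ 2 in X in res _ X]mul1r; apply: resM; first exact: hnu.
    by rewrite !expr2; apply: resM; exact: hr.
  have -> : \sum_(i <- s) nu i * G i ^+ 2
     = q * (q ^+ (N + N.+1) * \sum_(i <- s) nu i * F i ^+ 2).
    rewrite mulrA -exprS mulr_sumr; apply: eq_bigr => k _.
    by rewrite /G exprMn -exprM mulrCA; congr (_ ^+ _ * _); lia.
  by apply/res_qM/regM => //; apply/regX/reg_q.
have r0 : r i = 0.
  move/eqP: e; rewrite psumr_eq0; last by move=> k _; rewrite sqr_ge0.
  by move/allP/(_ i is_); rewrite sqrf_eq0 => /eqP.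
have := hr i is_; rewrite r0 => /res0P[d hd]; rewrite /G exprS -mulrA.
by move/(mulfI q_neq0) ->.
Qed.

Lemma qnum_qi k : qnum k = qi q k.
Proof. by rewrite qiE qn.unlock /qnum exprnP exprnN. Qed.

Lemma qz_inj (x y : int) : q ^ x = q ^ y -> x = y.
Proof.
move=> e; apply/subr0_eq/q_generic.
by rewrite expfzDr ?q_neq0// e -expfzDr ?q_neq0// subrr.
Qed.

Lemma ratio_simpl (K : fieldType) (x y z t : K) : x != 0 -> y != 0 -> z != 0 ->
  x * (z * t) / (x / y * z) = y * t.
Proof. by move=> x0 y0 z0; field; rewrite x0 y0 z0. Qed.

Lemma ratio_simplr (K : fieldType) (x y z t : K) : y != 0 -> z != 0 ->
  y * (x / y * z * t) / z = x * t.
Proof. by move=> y0 z0; field; rewrite y0 z0. Qed.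

Lemma nu_simpl (K : fieldType) (x l y z : K) : l != 0 ->
  x / l ^+ 2 * (l * y) * (l * z) = x * (y * z).
Proof. by move=> l0; field. Qed.

Lemma res_qa (k : nat) : (0 < k)%N -> res (qa q k) 1.
Proof.
move=> k0; rewrite (qaE q_generic q_neq0).
have rq : res q 0 by rewrite -[q]mulr1; apply/res_qM/reg1.
have rk : res (q ^ k) 0.
  case: k k0 => // k _; rewrite -exprnP exprS; apply: res_qM.
  exact/regX/reg_q.
have -> : 1 = (0 * 0 - 1) / (0 * 0 - 1) :> rat by [].
by apply: resM; [|apply: resV => //]; apply: resB res1; apply: resM.
Qed.

(** * Kashiwara operators of index i, the form and the lattice in coordinates *)

Section GCoordinates.
Variables (V : lmodType Qq) (M : UqA2_module V) (u : V) (i j : 'I_2) (m n : nat).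
Variable C : coords M u i j m n.
Local Notation W := (int -> int -> int -> Qq).
Local Notation mz := (Posz m).
Local Notation nz := (Posz n).
Local Notation RG := (rng mz nz).
Local Notation LM := (lam q mz nz).
Local Notation RR := (rr mz).

Let lam0 a c d : LM a c d != 0.
Proof. exact: (lam_neq0 _ _ q_generic q_neq0). Qed.

Let qi_n0 z : z != 0 -> qi q z != 0.
Proof. exact: (qi_neq0 q_generic q_neq0). Qed.

(** Division by [lam] passes to the basis u_{a,c,d}, which is adapted to the divided powers of
    f_i. *)
Definition gc (v : V) (a c d : int) : Qq := C v a c d / LM a c d.

Lemma crd_gc v a c d : C v a c d = LM a c d * gc v a c d.
Proof. by rewrite /gc mulrC divfK. Qed.

Lemma gcP k v w a c d : gc (k *: v + w) a c d = k * gc v a c d + gc w a c d.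
Proof. by rewrite /gc crdP /wlin mulrDl mulrA. Qed.

Lemma gc0 a c d : gc 0 a c d = 0.
Proof. by have := gcP (-1) 0 0 a c d; rewrite scaleN1r addNr mulN1r addNr. Qed.

Lemma gcZ k v a c d : gc (k *: v) a c d = k * gc v a c d.
Proof. by rewrite -[k *: v]addr0 gcP gc0 addr0. Qed.

Lemma gcD v w a c d : gc (v + w) a c d = gc v a c d + gc w a c d.
Proof. by rewrite -{1}[v]scale1r gcP mul1r. Qed.

Lemma gcB v w a c d : gc (v - w) a c d = gc v a c d - gc w a c d.
Proof. by rewrite addrC -scaleN1r gcP mulN1r addrC. Qed.

Lemma gc_sum (I : Type) (s : seq I) (P : pred I) (F : I -> V) a c d :
  gc (\sum_(k <- s | P k) F k) a c d = \sum_(k <- s | P k) gc (F k) a c d.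
Proof.
by apply: (big_morph (fun v => gc v a c d)) => [v w|]; [exact: gcD | exact: gc0].
Qed.

Lemma gc_out v a c d : ~~ RG a c d -> gc v a c d = 0.
Proof. by move=> h; rewrite /gc crd_supp// mul0r. Qed.

Lemma gc_inj v w : (forall a c d, RG a c d -> gc v a c d = gc w a c d) -> v = w.
Proof.
move=> h; apply: (crd_inj (c := C)).
apply/funext => a; apply/funext => c; apply/funext => d.
by rewrite !crd_gc; have [/h ->//|r] := boolP (RG a c d); rewrite !gc_out.
Qed.

(** Values of [g] outside the range are discarded, so that a vector with these coordinates
    exists. *)
Definition gmk (g : W) : V := xget 0
  [set v | C v = fun a c d => if RG a c d then LM a c d * g a c d else 0].

Lemma gmkE g a c d : gc (gmk g) a c d = if RG a c d then g a c d else 0.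
Proof.
have [v hv] : exists v, C v = fun a c d => if RG a c d then LM a c d * g a c d else 0.
  by apply: crd_onto => ? ? ? /negPf ->.
rewrite /gc /gmk; case: xgetP => [w _ -> |/(_ v)/(_ hv) //].
by case: ifP => _; rewrite ?mul0r// mulrC mulKf.
Qed.

Lemma gc_fi v a c d : RG a c d -> gc (uf M i v) a c d = qi q a * gc v (a - 1) c d.
Proof.
move=> h; have [->|a0] := eqVneq a 0.
  by rewrite qi0 mul0r /gc crd_fi /F0 crd_supp ?mulr0 ?mul0r// /rng; lia.
rewrite {1}/gc crd_fi /F0 crd_gc.
have -> : LM a c d = qi q (RR c d - (a - 1)) / qi q a * LM (a - 1) c d.
  have := @lam_a _ q mz nz q_generic q_neq0 (a - 1) c d; rewrite subrK; apply.
    by move: h; rewrite /rng; lia.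
  by move: h; rewrite /rng; lia.
have r0 : qi q (RR c d - (a - 1)) != 0.
  by apply: qi_n0; move: h; rewrite /rng /rr; lia.
exact: (ratio_simpl _ r0 (qi_n0 a0) (lam0 _ _ _)).
Qed.

Lemma gc_ei v a c d : RG a c d ->
  gc (ue M i v) a c d = qi q (RR c d - a) * gc v (a + 1) c d.
Proof.
move=> h; have [r|r] := boolP (RG (a + 1) c d); last first.
  by rewrite {1}/gc crd_ei /E0 crd_supp// gc_out// !mulr0 mul0r.
rewrite {1}/gc crd_ei /E0 crd_gc.
have -> : LM (a + 1) c d = qi q (RR c d - a) / qi q (a + 1) * LM a c d.
  by apply: (lam_a _ q_generic q_neq0); move: h r; rewrite /rng; lia.
have a1 : qi q (a + 1) != 0 by apply: qi_n0; move: h; rewrite /rng; lia.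
exact: (ratio_simplr _ _ a1 (lam0 _ _ _)).
Qed.

Lemma gc_ti v a c d : gc (ut M i v) a c d = q ^ wt0 mz a c d * gc v a c d.
Proof. by rewrite /gc crd_ti /Tz mulrA. Qed.

Lemma gc_tj v a c d : gc (ut M j v) a c d = q ^ wt1 nz a c d * gc v a c d.
Proof. by rewrite /gc crd_tj /Tz mulrA. Qed.

Lemma gc_divpowS k w a c d : gc (divpow M i k.+1 w) a c d =
  if RG a c d then qi q a / qi q k.+1 * gc (divpow M i k w) (a - 1) c d else 0.
Proof.
case: ifP => [h|/negbT/gc_out//].
have -> : divpow M i k.+1 w = (qi q k.+1)^-1 *: uf M i (divpow M i k w).
  rewrite /divpow linearZZ scalerA /qfact big_nat_recr//= invfM mulrC.
  by rewrite -qnum_qi.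
by rewrite gcZ gc_fi// mulrCA mulrA.
Qed.

(** A vector killed by e_i lives on a = 0, its weight fixes r, and each f_i raises a by 1. *)
Lemma gc_divpow_supp k w mk a c d : ue M i w = 0 -> ut M i w = q ^+ mk *: w ->
  gc (divpow M i k w) a c d != 0 -> a = k /\ RR c d = mk.
Proof.
move=> e0 t0; elim: k a => [|k IH] a; last first.
  rewrite gc_divpowS; case: ifP => [_|_]; last by rewrite eqxx.
  rewrite mulf_eq0 negb_or => /andP[_ /IH [ea ->]]; split => //.
  by rewrite -addn1 PoszD -ea subrK.
have -> : divpow M i 0 w = w by rewrite /divpow /qfact big_geq// invr1 scale1r.
have [h g0|/gc_out ->] := boolP (RG a c d); last by rewrite eqxx.
have ea : a = 0.
  apply/eqP; apply/negPn/negP => a0.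
  have h' : RG (a - 1) c d by move: h a0; rewrite /rng; lia.
  have := gc_ei w h'; rewrite e0 gc0 subrK => /esym/eqP.
  rewrite mulf_eq0 (negPf g0) orbF; apply/negP/qi_n0.
  by move: h; rewrite /rng; lia.
split=> //; have := gc_ti w a c d; rewrite t0 gcZ => /(mulIf g0).
by rewrite exprnP => /qz_inj; rewrite /wt0 ea; lia.
Qed.

Lemma gc_divpow_succ k w mk a c d : ue M i w = 0 -> ut M i w = q ^+ mk *: w ->
  gc (divpow M i k.+1 w) a c d =
  if RG a c d then gc (divpow M i k w) (a - 1) c d else 0.
Proof.
move=> e0 t0; rewrite gc_divpowS; case: ifP => // h.
have [->|g0] := eqVneq (gc (divpow M i k w) (a - 1) c d) 0; first by rewrite mulr0.
have [ea _] := gc_divpow_supp e0 t0 g0.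
have -> : a = k.+1 by rewrite -addn1 PoszD -ea subrK.
have k0 : qi q k.+1 != 0 by exact: qi_n0.
by rewrite (divff k0) mul1r.
Qed.

(** Shifting back from k + 1 loses nothing: a component lost at the end of its string would have r =
    k, against k + 1 <= mk. *)
Lemma gc_divpow_pred k w mk a c d : ue M i w = 0 -> ut M i w = q ^+ mk *: w ->
  (k.+1 <= mk)%N -> gc (divpow M i k w) a c d =
  if RG a c d then gc (divpow M i k.+1 w) (a + 1) c d else 0.
Proof.
move=> e0 t0 km; case: ifP => [h|/negbT/gc_out//].
rewrite (gc_divpow_succ _ _ _ _ e0 t0) addrK; case: ifP => // h'.
apply/eqP/negPn/negP => /(gc_divpow_supp e0 t0) [ea er].
by move: h h'; rewrite /rng er ea; lia.
Qed.

(** In this basis the Kashiwara operators of index i only shift a. Their graphs, given by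
    existential decompositions, are therefore graphs of linear maps ([kash_f], [kash_e]). *)
Definition KF v := gmk (fun a c d => gc v (a - 1) c d).
Definition KE v := gmk (fun a c d => gc v (a + 1) c d).
Definition gvec a c d := gmk (dl Qq a c d).

Lemma gc_KF v a c d : gc (KF v) a c d = if RG a c d then gc v (a - 1) c d else 0.
Proof. exact: gmkE. Qed.

Lemma gc_KE v a c d : gc (KE v) a c d = if RG a c d then gc v (a + 1) c d else 0.
Proof. exact: gmkE. Qed.

Lemma gc_gvec a c d a' c' d' : RG a c d ->
  gc (gvec a c d) a' c' d' = dl Qq a c d a' c' d'.
Proof. by move=> h; rewrite gmkE; case: ifP => // /negbT /(dl_supp _ h) ->. Qed.

Lemma kash_KF v v' : kashiwara_f M i v v' -> v' = KF v.
Proof.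
move=> [r [k [w [[hw ->] ->]]]]; apply: gc_inj => a c d h.
rewrite gc_KF h !gc_sum; apply: eq_bigr => s _.
have [e0 [mk km t0]] := hw s.
by rewrite (gc_divpow_succ _ _ _ _ e0 t0) h.
Qed.

Lemma kash_KE v v' : kashiwara_e M i v v' -> v' = KE v.
Proof.
move=> [r [k [w [[hw ->] ->]]]]; apply: gc_inj => a c d h.
rewrite gc_KE h !gc_sum [LHS]big_mkcond; apply: eq_bigr => s _.
have [e0 [mk km t0]] := hw s.
case: (k s) km => [|p] km /=; last by rewrite (gc_divpow_pred _ _ _ e0 t0 km) h.
(* The terms with n_k = 0 are omitted from the sum; the shift kills them as well, since they live on
   a = 0. *)
apply/esym/eqP/negPn/negP => /(gc_divpow_supp e0 t0) [ea _].
by move: h; rewrite /rng; lia.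
Qed.

Lemma divpowZ k x w : divpow M i k (x *: w) = x *: divpow M i k w.
Proof.
rewrite /divpow scalerA mulrC -scalerA; congr (_ *: _).
by elim: k => //= k ->; rewrite linearZZ.
Qed.

Lemma ue_gvec c d : RG 0 c d -> ue M i (gvec 0 c d) = 0.
Proof.
move=> h; apply: gc_inj => a' c' d' h'; rewrite gc_ei// gc_gvec// gc0 /dl.
case: eqP => [[e _ _]|]; last by rewrite mulr0.
by move: h'; rewrite /rng; lia.
Qed.

Lemma ut_gvec c d : RG 0 c d ->
  ut M i (gvec 0 c d) = q ^+ absz (RR c d) *: gvec 0 c d.
Proof.
move=> h; apply: gc_inj => a' c' d' h'; rewrite gc_ti gcZ gc_gvec// /dl.
case: eqP => [[-> -> ->]|]; last by rewrite !mulr0.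
rewrite /wt0 mulr0 subr0 exprnP; congr (q ^ _ * _).
by move: h; rewrite /rng; lia.
Qed.

Lemma divpow_gvec k a c d : a = Posz k -> RG a c d ->
  divpow M i k (gvec 0 c d) = gvec a c d.
Proof.
move=> -> {a} h; have h0 : RG 0 c d by move: h; rewrite /rng; lia.
move: h; elim: k => [|k IH] h.
  by rewrite /divpow /qfact big_geq// invr1 scale1r.
have h' : RG k c d by move: h; rewrite /rng; lia.
apply: gc_inj => a' c' d' r; rewrite (gc_divpow_succ _ _ _ _ (ue_gvec h0) (ut_gvec h0)) r IH//.
by rewrite !gc_gvec// /dl !xpair_eqE; congr (_ && _ && _)%:R; lia.
Qed.

Lemma pts_rng a c d : ((a, c, d) \in pts mz nz) = RG a c d.
Proof. exact: mem_pts. Qed.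

Lemma gvec_decomp v : v = \sum_(t <- pts mz nz) gc v t.1.1 t.1.2 t.2 *: gvec t.1.1 t.1.2 t.2.
Proof.
apply: gc_inj => a c d h; rewrite gc_sum.
rewrite (bigD1_seq (a, c, d)) ?pts_uniq ?pts_rng//= gcZ gc_gvec// /dl eqxx mulr1.
rewrite big_seq_cond big1 ?addr0// => -[[a' c'] d'] /andP[].
rewrite pts_rng => h' /= ne; rewrite gcZ gc_gvec// /dl eq_sym (negPf ne).
by rewrite mulr0.
Qed.

Lemma exists_decomp v : exists (r : nat) (k : 'I_r -> nat) (w : 'I_r -> V),
  string_decomp M i k w v.
Proof.
pose s := pts mz nz; pose t0 : int * int * int := (0, 0, 0).
pose T (p : 'I_(size s)) := nth t0 s p.
exists (size s), (fun p => absz (T p).1.1),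
  (fun p => gc v (T p).1.1 (T p).1.2 (T p).2 *: gvec 0 (T p).1.2 (T p).2).
have hT p : RG (T p).1.1 (T p).1.2 (T p).2.
  have : T p \in s by apply: mem_nth.
  by case: (T p) => -[a c] d; rewrite pts_rng.
split=> [p|].
  have h0 : RG 0 (T p).1.2 (T p).2 by move: (hT p); rewrite /rng; lia.
  split.
    by rewrite linearZZ ue_gvec// scaler0.
  exists (absz (RR (T p).1.2 (T p).2)); first by move: (hT p); rewrite /rng; lia.
  by rewrite linearZZ ut_gvec// !scalerA mulrC.
rewrite {1}(gvec_decomp v) (big_nth t0) big_mkord; apply: eq_bigr => p _.
rewrite -/(T p) divpowZ (@divpow_gvec _ (T p).1.1)//.
by move: (hT p); rewrite /rng; lia.
Qed.

Lemma kash_f v v' : kashiwara_f M i v v' <-> v' = KF v.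
Proof.
split=> [/kash_KF//|->].
have [r [k [w h]]] := exists_decomp v.
have h' : kashiwara_f M i v (\sum_(s < r) divpow M i (k s).+1 (w s)).
  by exists r, k, w.
by rewrite -(kash_KF h').
Qed.

Lemma kash_e v v' : kashiwara_e M i v v' <-> v' = KE v.
Proof.
split=> [/kash_KE//|->].
have [r [k [w h]]] := exists_decomp v.
have h' : kashiwara_e M i v (\sum_(s < r | (0 < k s)%N) divpow M i (k s).-1 (w s)).
  by exists r, k, w.
by rewrite -(kash_KE h').
Qed.

Definition formV v w := form q mz nz (C v) (C w).

Lemma formV_gc v w : formV v w =
  \sum_(t <- pts mz nz) nuG q mz nz t.1.1 t.1.2 t.2
    * (gc v t.1.1 t.1.2 t.2 * gc w t.1.1 t.1.2 t.2).
Proof.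
rewrite /formV /form; apply: eq_bigr => t _; rewrite !crd_gc /nu.
exact: (nu_simpl _ _ _ (lam0 _ _ _)).
Qed.

Lemma formV_fi v w : formV (uf M i v) w = q^-1 * formV v (ut M i (ue M i w)).
Proof.
rewrite /formV crd_fi crd_ti crd_ei.
by apply: (form_F0 q_generic q_neq0) => //; apply: crd_supp.
Qed.

Lemma formV_fj v w : formV (uf M j v) w = q^-1 * formV v (ut M j (ue M j w)).
Proof.
rewrite /formV crd_fj crd_tj crd_ej.
by apply: (form_F1 q_generic q_neq0) => //; apply: crd_supp.
Qed.

Lemma formVP k v v' w : formV (k *: v + v') w = k * formV v w + formV v' w.
Proof.
rewrite !formV_gc mulr_sumr -big_split; apply: eq_bigr => t _ /=.
by rewrite gcP mulrDl mulrDr -(mulrA k) mulrCA.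
Qed.

Lemma coords_ind (P : V -> Prop) : P u ->
  (forall k v w, P v -> P w -> P (k *: v + w)) ->
  (forall v, P v -> P (uf M i v)) -> (forall v, P v -> P (uf M j v)) ->
  forall v, P v.
Proof.
move=> Pu Pl Pi Pj v.
suff [v' Pv' /crd_inj <-//] : exists2 v', P v' & C v' = C v.
apply: (@generated _ _ mz nz q_generic q_neq0 _ _
  (fun w => exists2 v', P v' & C v' = w)) (crd_supp C v) => //.
- by exists u; rewrite // crd_u.
- move=> k w w' [v1 P1 <-] [v2 P2 <-]; exists (k *: v1 + v2); first exact: Pl.
  by rewrite crdP.
- by move=> w _ [v1 P1 <-]; exists (uf M i v1); [exact: Pi | rewrite crd_fi].
by move=> w _ [v1 P1 <-]; exists (uf M j v1); [exact: Pj | rewrite crd_fj].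
Qed.

Lemma crd000_fi v : C (uf M i v) 0 0 0 = 0.
Proof. by rewrite crd_fi /F0 crd_supp ?mulr0. Qed.

Lemma crd000_fj v : C (uf M j v) 0 0 0 = 0.
Proof.
rewrite crd_fj /F1 !crd_supp ?mulr0 ?addr0// /rng; lia.
Qed.

Lemma formV_u w : formV u w = C w 0 0 0.
Proof.
have h : RG 0 0 0 by rewrite /rng /rr; lia.
by rewrite /formV crd_u form_dl// (nu000 _ _ q_generic q_neq0) mul1r.
Qed.

Lemma res_nuG a c d : res (nuG q mz nz a c d) 1.
Proof.
have fac z : res (zfact (qa q) z) 1.
  rewrite /zfact big_nat_cond; apply: (big_ind (fun x => res x 1)).
  - exact: res1.
  - by move=> x y hx hy; have := resM hx hy; rewrite mulr1.
  by move=> k; rewrite andbT => /andP[k0 _]; apply: res_qa.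
have mul1 x y : res x 1 -> res y 1 -> res (x * y) 1.
  by move=> hx hy; have := resM hx hy; rewrite mulr1.
have div1 x y z : res x 1 -> res y 1 -> res z 1 -> res (x / (y * z)) 1.
  move=> hx hy hz; apply: (mul1 _ _ hx).
  by have := resV (oner_neq0 _) (mul1 _ _ hy hz); rewrite invr1.
rewrite /nuG; apply: (mul1); last by apply: (div1); [apply: (mul1) | |]; apply: (fac).
by apply: (mul1); [apply: (mul1)|]; apply: (div1); apply: (fac).
Qed.

Definition lat v := forall a c d, RG a c d -> regular0 (gc v a c d).

Lemma lat_reg v a c d : lat v -> regular0 (gc v a c d).
Proof.
by move=> h; have [/h//|/gc_out->] := boolP (RG a c d); apply: reg0.
Qed.

(** The norms being congruent to 1, [reg_sum_squares] recovers regular coordinates from a regular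
    square. This describes the lattice without reference to a basis. *)
Lemma lat_form v : lat v <-> regular0 (formV v v).
Proof.
rewrite formV_gc; split=> [h|].
  apply: reg_sum => t _; apply: regM; first exact: (res_reg (res_nuG _ _ _)).
  by apply: regM; apply: lat_reg.
under eq_bigr do rewrite -expr2.
move=> /(reg_sum_squares (fun t _ => res_nuG t.1.1 t.1.2 t.2)) h a c d r.
by apply: (h (a, c, d)); rewrite pts_rng.
Qed.

Lemma res_formV v w (r r' : int -> int -> int -> rat) :
  (forall a c d, RG a c d -> res (gc v a c d) (r a c d)) ->
  (forall a c d, RG a c d -> res (gc w a c d) (r' a c d)) ->
  res (formV v w) (\sum_(t <- pts mz nz) r t.1.1 t.1.2 t.2 * r' t.1.1 t.1.2 t.2).
Proof.
move=> h h'; rewrite formV_gc big_seq [X in res _ X]big_seq.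
apply: res_sum => -[[a c] d]; rewrite pts_rng => rg /=.
rewrite -[X in res _ X]mul1r; apply: resM; first exact: res_nuG.
by apply: resM; [apply: h | apply: h'].
Qed.

Lemma latP k v w : regular0 k -> lat v -> lat w -> lat (k *: v + w).
Proof.
by move=> hk hv hw a c d r; rewrite gcP; apply: regD (hw _ _ _ r); apply: regM (hv _ _ _ r).
Qed.

Definition small v := forall a c d, RG a c d -> res (gc v a c d) 0.

Lemma smallE v a c d : small v -> res (gc v a c d) 0.
Proof. by move=> h; have [/h//|/gc_out->] := boolP (RG a c d); apply: res0. Qed.

Lemma smallP k v w : regular0 k -> small v -> small w -> small (k *: v + w).
Proof.
move=> /reg_res[r hk] hv hw a c d rg; rewrite gcP -[X in res _ X]addr0.
by apply: resD (hw _ _ _ rg); rewrite -(mulr0 r); apply: resM (hv _ _ _ rg).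
Qed.

Lemma small_q v : small v <-> exists2 w, lat w & v = q *: w.
Proof.
split=> [h|[w hw ->] a c d r]; last by rewrite gcZ; apply/res_qM/hw.
exists (q^-1 *: v); last by rewrite scalerA divff ?q_neq0// scale1r.
move=> a c d r; have [x hx e] := res0P (h _ _ _ r).
by rewrite gcZ e mulKf ?q_neq0.
Qed.

Lemma small_KF v : small v -> small (KF v).
Proof. by move=> h a c d r; rewrite gc_KF r; apply: smallE. Qed.

Lemma small_KE v : small v -> small (KE v).
Proof. by move=> h a c d r; rewrite gc_KE r; apply: smallE. Qed.

Lemma KFB v w : KF (v - w) = KF v - KF w.
Proof. by apply: gc_inj => a c d r; rewrite gcB !gc_KF r gcB. Qed.

Lemma KEB v w : KE (v - w) = KE v - KE w.
Proof. by apply: gc_inj => a c d r; rewrite gcB !gc_KE r gcB. Qed.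

Lemma KF_gvec a c d : RG a c d ->
  KF (gvec a c d) = if RG (a + 1) c d then gvec (a + 1) c d else 0.
Proof.
move=> h; apply: gc_inj => a' c' d' r; rewrite gc_KF r gc_gvec//.
have -> : dl Qq a c d (a' - 1) c' d' = dl Qq (a + 1) c d a' c' d'.
  by rewrite /dl !xpair_eqE; congr (_ && _ && _)%:R; lia.
case: ifP => [h'|h']; first by rewrite gc_gvec.
rewrite gc0 /dl; case: eqP => // -[ea ec ed].
by move: r; rewrite ea ec ed h'.
Qed.

Lemma KE_gvec a c d : RG a c d ->
  KE (gvec a c d) = if RG (a - 1) c d then gvec (a - 1) c d else 0.
Proof.
move=> h; apply: gc_inj => a' c' d' r; rewrite gc_KE r gc_gvec//.
have -> : dl Qq a c d (a' + 1) c' d' = dl Qq (a - 1) c d a' c' d'.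
  by rewrite /dl !xpair_eqE; congr (_ && _ && _)%:R; lia.
case: ifP => [h'|h']; first by rewrite gc_gvec.
rewrite gc0 /dl; case: eqP => // -[ea ec ed].
by move: r; rewrite ea ec ed h'.
Qed.

Lemma lat_gvec a c d : RG a c d -> lat (gvec a c d).
Proof.
move=> h a' c' d' _; rewrite gc_gvec// /dl.
by case: eqP => _; [exact: reg1 | exact: reg0].
Qed.

Lemma lat_KF v : lat v -> lat (KF v).
Proof. by move=> h a c d r; rewrite gc_KF r; apply: lat_reg. Qed.

End GCoordinates.

(** The adjunction reduces the claim to v = u, where the form gives the coefficient of u; that
    coefficient vanishes on the images of both f's. None of this depends on the order of the
    indices. *)
Lemma formV_unique (V : lmodType Qq) (M : UqA2_module V) (u : V) (i j : 'I_2)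
    (m n : nat) (C : coords M u i j m n) (D : coords M u j i n m) v w :
  formV C v w = formV D v w.
Proof.
elim/(coords_ind C): v w => [|k v v' IH IH'|v IH|v IH] w.
- rewrite !formV_u; elim/(coords_ind C): w => [|k v w IH IH'|w _|w _].
  + by rewrite !crd_u.
  + by rewrite !crdP /wlin IH IH'.
  + by rewrite crd000_fi crd000_fj.
  by rewrite crd000_fi crd000_fj.
- by rewrite !formVP IH IH'.
- by rewrite formV_fi formV_fj IH.
by rewrite formV_fi formV_fj IH.
Qed.

Lemma lat_unique (V : lmodType Qq) (M : UqA2_module V) (u : V) (i j : 'I_2)
    (m n : nat) (C : coords M u i j m n) (D : coords M u j i n m) v :
  lat C v <-> lat D v.
Proof. by rewrite !lat_form (formV_unique C D). Qed.

Lemma small_unique (V : lmodType Qq) (M : UqA2_module V) (u : V) (i j : 'I_2)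
    (m n : nat) (C : coords M u i j m n) (D : coords M u j i n m) v :
  small C v <-> small D v.
Proof.
rewrite !small_q; split=> -[w hw ->]; exists w => //.
  exact/(lat_unique C D).
exact/(lat_unique C D).
Qed.

(** * Operators of index j modulo q on the basis adapted to i *)

Lemma qi_qa z : qi q z = q ^ (1 - z) * qa q z.
Proof.
rewrite /qa mulrA -expfzDr ?q_neq0//.
by rewrite (_ : 1 - z + (z - 1) = 0) ?expr0z ?mul1r//; lia.
Qed.

Lemma res_qaz z : 0 < z -> res (qa q z) 1.
Proof. by case: z => // z z0; apply: res_qa. Qed.

Lemma res_qz z : 0 < z -> res (q ^ z) 0.
Proof.
case: z => // -[|z] // _; rewrite -exprnP exprS; apply: res_qM.
exact/regX/reg_q.
Qed.

Lemma res_mul1 x y : res x 1 -> res y 1 -> res (x * y) 1.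
Proof. by move=> hx hy; have := resM hx hy; rewrite mulr1. Qed.

Lemma res_div1 x y : res x 1 -> res y 1 -> res (x / y) 1.
Proof.
by move=> hx hy; apply: res_mul1 => //; have := resV (oner_neq0 _) hy; rewrite invr1.
Qed.

Lemma shift_coef (K : fieldType) (x g l l' k : K) : l' != 0 ->
  x * l = k * l' -> x * (l * g) / l' = k * g.
Proof. by move=> l0 e; rewrite mulrA e mulrAC mulrK ?unitfE// . Qed.

(** This is c + max(d - a, 0), the value of epsilon_1 at the triple in the model crystal. *)
Definition eps1 (a c d : int) : int := if a <= d then c + (d - a) else c.
Definition ff1 (a c d : int) : int * int * int :=
  if a <= d then (a, c, d + 1) else (a - 1, c + 1, d).

Section Residues.
Variables (V : lmodType Qq) (M : UqA2_module V) (u : V) (i j : 'I_2) (m n : nat).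
Variable C : coords M u i j m n.
Variable D : coords M u j i n m.
Local Notation mz := (Posz m).
Local Notation nz := (Posz n).
Local Notation RG := (rng mz nz).
Local Notation RD := (rng nz mz).
Local Notation LM := (lam q mz nz).
Local Notation RR := (rr mz).
Local Notation G := (gvec C).

Let lam0 a c d : LM a c d != 0.
Proof. exact: (lam_neq0 _ _ q_generic q_neq0). Qed.

Lemma gc_ej v a c d : RG a c d -> gc C (ue M j v) a c d =
  ced q mz nz c d * gc C v a c (d + 1) + cec q mz nz a c d * gc C v (a - 1) (c + 1) d.
Proof.
move=> h; rewrite {1}/gc crd_ej /E1 mulrDl !crd_gc; congr (_ + _).
  have [r|r] := boolP (RG a c (d + 1)); last by rewrite gc_out// !mulr0 mul0r.
  exact: (shift_coef _ (lam0 _ _ _) (ced_lam q_generic q_neq0 _ _ h r)).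
have [r|r] := boolP (RG (a - 1) (c + 1) d); last by rewrite gc_out// !mulr0 mul0r.
exact: (shift_coef _ (lam0 _ _ _) (cec_lam q_generic q_neq0 _ _ h r)).
Qed.

Lemma gc_fj v a c d : RG a c d -> gc C (uf M j v) a c d =
  cfd q mz a c d * gc C v a c (d - 1) + cfc q mz c d * gc C v (a + 1) (c - 1) d.
Proof.
move=> h; rewrite {1}/gc crd_fj /F1 mulrDl !crd_gc; congr (_ + _).
  have [r|r] := boolP (RG a c (d - 1)); last by rewrite gc_out// !mulr0 mul0r.
  exact: (shift_coef _ (lam0 _ _ _) (cfd_lam q_generic q_neq0 _ _ h r)).
have [r|r] := boolP (RG (a + 1) (c - 1) d); last by rewrite gc_out// !mulr0 mul0r.
exact: (shift_coef _ (lam0 _ _ _) (cfc_lam q_generic q_neq0 _ _ h r)).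
Qed.

(** After multiplication by q^wt1, the two terms of e_j u_{a,c,d} have orders a - c - d and -c, and
    [eps1] is the larger of the opposites. *)
Lemma lat_ej a c d : RG a c d ->
  lat C (q ^ (wt1 nz a c d + eps1 a c d) *: ue M j (G a c d)).
Proof.
move=> h a' c' d' h'; rewrite gcZ gc_ej// mulrDr; apply: regD.
  rewrite gc_gvec// /dl; case: eqP => [[ea ec ed]|]; last by rewrite !mulr0 => _; apply: reg0.
  rewrite mulr1 /ced mulrA -expfzDr ?q_neq0//; apply: regM.
    by apply: reg_qz; rewrite /wt1 /eps1; case: ifP; lia.
  apply/res_reg/res_div1; first apply: res_mul1; apply: res_qaz;
    move: h h'; rewrite /rng /rr; lia.
rewrite gc_gvec// /dl; case: eqP => [[ea ec ed]|]; last by rewrite !mulr0 => _; apply: reg0.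
rewrite mulr1 /cec mulrA -expfzDr ?q_neq0//; apply: regM.
  by apply: reg_qz; rewrite /wt1 /eps1; case: ifP; lia.
apply/res_reg/res_div1; first (apply: res_mul1; first apply: res_mul1);
  apply: res_qaz; move: h h'; rewrite /rng /rr; lia.
Qed.

(** The terms of f_j u_{a,c,d} have orders a - c - d and -c. They tie when a = d, and [ff1] then
    takes the term at which [eps1] grows by exactly 1. *)
Lemma res_fj a c d a' c' d' : RG a c d -> ff1 a c d = (a', c', d') ->
  RG a' c' d' -> res (q ^ eps1 a c d * gc C (uf M j (G a c d)) a' c' d') 1.
Proof.
move=> h; rewrite /ff1 /eps1; case: ifP => ad [<- <- <-] h';
  rewrite gc_fj// !gc_gvec// /dl !(addrK, subrK) eqxx mulr1.
  rewrite (_ : (_, _, _) == _ = false) ?mulr0 ?addr0; last first.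
    by rewrite !xpair_eqE; lia.
  rewrite /cfd mulrA -expfzDr ?q_neq0//.
  rewrite (_ : c + (d - a) + (1 + a - c - (d + 1)) = 0) ?expr0z ?mul1r; last by ring.
  apply: res_div1; first apply: res_mul1; apply: res_qaz;
    move: h h'; rewrite /rng /rr; lia.
rewrite (_ : (_, _, _) == _ = false) ?mulr0 ?add0r; last first.
  by rewrite !xpair_eqE; lia.
rewrite /cfc mulrA -expfzDr ?q_neq0//.
rewrite (_ : c + (1 - (c + 1)) = 0) ?expr0z ?mul1r; last by ring.
by apply: res_div1; apply: res_qaz; move: h h'; rewrite /rng /rr; lia.
Qed.

Lemma gcD_weight a c d k c' d' : RG a c d -> gc D (G a c d) k c' d' != 0 ->
  wt0 nz k c' d' = wt1 nz a c d.
Proof.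
move=> h g0; have : ut M j (G a c d) = q ^ wt1 nz a c d *: G a c d.
  apply: (gc_inj (C := C)) => a1 c1 d1 h1.
  rewrite gc_tj gcZ gc_gvec// /dl; case: eqP => [[-> -> ->]|] //.
  by rewrite !mulr0.
move=> /(congr1 (fun v => gc D v k c' d')).
by rewrite gc_ti gcZ => /(mulIf g0)/qz_inj.
Qed.

Lemma lat_gvecD a c d : RG a c d -> lat D (G a c d).
Proof. by move=> h; apply/(lat_unique C D)/lat_gvec. Qed.

(** In the coordinates D, e_j takes depth k to k - 1 with a factor [z], which is q^(1 - z) times a
    unit, and the weight gives wt1 + 1 - z = -k. So [lat_ej] says that the component at depth k is
    divisible by q^(k - eps1). *)
Lemma reg_gcD a c d k c' d' : RG a c d -> RD k c' d' -> eps1 a c d <= k ->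
  regular0 (q ^ (eps1 a c d - k) * gc D (G a c d) k c' d').
Proof.
move=> h h' ek; set e := eps1 _ _ _ in ek *.
have [->|g0] := eqVneq (gc D (G a c d) k c' d') 0; first by rewrite mulr0; apply: reg0.
have wE := gcD_weight h g0.
have [k0|k0] := eqVneq k 0.
  have -> : e - k = 0 by move: ek; rewrite /e /eps1; case: ifP; move: h; rewrite /rng; lia.
  by rewrite expr0z mul1r; apply: (lat_reg _ _ _ (lat_gvecD h)).
have h1 : RD (k - 1) c' d' by move: h' k0; rewrite /rng; lia.
have := (lat_unique C D _).1 (lat_ej h) _ _ _ h1.
rewrite gcZ gc_ei// subrK qi_qa.
set z := rr _ _ _ - _; have z0 : 0 < z by rewrite /z; move: h'; rewrite /rng; lia.
have y1 := res_qaz z0; have y0 : qa q z != 0.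
  by apply: (qa_neq0 q_generic q_neq0); lia.
move: (qa q z) y1 y0 (gc D _ _ _ _) => y y1 y0 g.
rewrite !mulrA -expfzDr ?q_neq0//.
have -> : wt1 nz a c d + eps1 a c d + (1 - z) = e - k.
  by rewrite -wE /z /e /wt0 /rr; ring.
move=> hr; have := res_div1 res1 y1 => /res_reg /(regM hr).
by rewrite mul1r -[_ * y * g]mulrAC mulfK.
Qed.

Lemma res_gcD0 a c d k c' d' : RG a c d -> RD k c' d' -> eps1 a c d < k ->
  res (gc D (G a c d) k c' d') 0.
Proof.
move=> h h' ek; set e := eps1 _ _ _ in ek *.
have -> : gc D (G a c d) k c' d'
    = q ^ (k - e) * (q ^ (e - k) * gc D (G a c d) k c' d').
  by rewrite mulrA -expfzDr ?q_neq0// addrA subrK subrr mul1r.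
have r : regular0 (q ^ (e - k) * gc D (G a c d) k c' d').
  by apply: reg_gcD => //; apply: ltW.
have [r1 hr] := reg_res r; rewrite -(mul0r r1); apply: resM hr.
by apply: res_qz; lia.
Qed.

Lemma res_neq0 x r : res x r -> r != 0 -> x != 0.
Proof. by move=> h; apply: contra => /eqP x0; rewrite x0 in h; rewrite (res_eq h res0). Qed.

Lemma residues v : lat D v -> exists r : int -> int -> int -> rat,
  (forall k c d, res (gc D v k c d) (r k c d)) /\
  (forall k c d, ~~ RD k c d -> r k c d = 0).
Proof.
move=> h.
have /choice [f hf] : forall t : int * int * int, exists r,
    res (gc D v t.1.1 t.1.2 t.2) r.
  by move=> t; apply/reg_res/lat_reg.
exists (fun k c d => f (k, c, d)); split=> k c d; first exact: (hf (k, c, d)).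
move=> h'; have := hf (k, c, d); rewrite /= gc_out// => h1.
exact: (res_eq h1 res0).
Qed.

Lemma formV_gvec v a c d : RG a c d ->
  formV C v (G a c d) = nuG q mz nz a c d * gc C v a c d.
Proof.
move=> h; rewrite formV_gc (bigD1_seq (a, c, d)) ?pts_uniq ?pts_rng//=.
rewrite gc_gvec// {1}/dl eqxx mulr1 big1 ?addr0// => -[[a' c'] d'] /= ne.
by rewrite gc_gvec// /dl (negPf ne) !mulr0.
Qed.

Lemma sum_residues_sq a c d (r : int -> int -> int -> rat) : RG a c d ->
  (forall k c' d', res (gc D (G a c d) k c' d') (r k c' d')) ->
  \sum_(t <- pts nz mz) r t.1.1 t.1.2 t.2 ^+ 2 = 1.
Proof.
move=> h hr; apply: (@res_eq (formV D (G a c d) (G a c d))).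
  under eq_bigr do rewrite expr2.
  by apply: res_formV => k c' d' _.
rewrite -(formV_unique C D) formV_gvec// gc_gvec// /dl eqxx mulr1.
exact: res_nuG.
Qed.

(* All components of G a c d mod q lie at the same place, eps1 a c d, of the
   j-strings. *)
Definition pure a c d := forall k c' d' r, RD k c' d' ->
  res (gc D (G a c d) k c' d') r -> r != 0 -> k = eps1 a c d.

(** The shift can only lose the entries that it pushes out of the range. *)
Lemma sum_shift_le (r : int -> int -> int -> rat) :
  (forall k c d, ~~ RD k c d -> r k c d = 0) ->
  \sum_(t <- pts nz mz) r (t.1.1 - 1) t.1.2 t.2 ^+ 2
  <= \sum_(t <- pts nz mz) r t.1.1 t.1.2 t.2 ^+ 2.
Proof.
move=> r0; pose F (t : int * int * int) : rat :=
  if RD t.1.1 t.1.2 t.2 then r (t.1.1 - 1) t.1.2 t.2 ^+ 2 else 0.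
have -> : \sum_(t <- pts nz mz) r (t.1.1 - 1) t.1.2 t.2 ^+ 2
    = \sum_(t <- pts nz mz) F t.
  apply: eq_big_seq => -[[k c] d]; rewrite (mem_pts (m := nz))// /F /= => h.
  by rewrite h.
pose h (t : int * int * int) := (t.1.1 + 1, t.1.2, t.2).
pose h' (t : int * int * int) := (t.1.1 - 1, t.1.2, t.2).
rewrite (@sum_shift _ _ (pts nz mz) h h' F) ?pts_uniq//.
- apply: ler_sum => -[[k c] d] _; rewrite /F /= addrK.
  by case: ifP => _; rewrite ?lexx ?sqr_ge0.
- by move=> [[k c] d]; rewrite /h /h' /= addrK.
- by move=> [[k c] d]; rewrite /h /h' /= subrK.
- by move=> [[k c] d]; rewrite (mem_pts (m := nz))// /F /= => /negPf ->.
move=> [[k c] d]; rewrite (mem_pts (m := nz))// /F /= addrK => /r0 ->.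
by rewrite expr0n /= if_same.
Qed.

Lemma KF_gvec_step a c d a' c' d' : RG a c d -> ff1 a c d = (a', c', d') ->
  RG a' c' d' -> pure a c d -> forall k x y, RD k x y ->
  res (gc D (KF D (G a c d)) k x y - gc D (G a' c' d') k x y) 0.
Proof.
move=> h e h' pu.
have [r [hr r0]] := residues (lat_gvecD h).
have [r' [hr' r'0]] := residues (lat_gvecD h').
have S1 := sum_residues_sq h hr; have S2 := sum_residues_sq h' hr'.
have ee : eps1 a' c' d' = eps1 a c d + 1.
  move: e; rewrite /ff1; case: ifP => ad [<- <- <-]; rewrite /eps1 ad.
    by rewrite (_ : a <= d + 1); lia.
  by case: ifP; lia.
have pr k x y : RD k x y -> k != eps1 a c d -> r k x y = 0.
  move=> hk ne; apply/eqP/negPn/negP => rn.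
  by have := pu _ _ _ _ hk (hr _ _ _) rn; apply/eqP.
(* r' has norm 1, the shift of r has norm at most 1, and their scalar product is
   1, hence they are equal. *)
have S3 : \sum_(t <- pts nz mz) r (t.1.1 - 1) t.1.2 t.2 * r' t.1.1 t.1.2 t.2 = 1.
  (* The scalar product of this vector with u_{a',c',d'} is evaluated at q = 0 twice: in the
     coordinates C it is 1 by [res_fj], in the coordinates D it is the sum above. *)
  pose v := q ^ eps1 a c d *: uf M j (G a c d).
  apply: (@res_eq (formV D v (G a' c' d'))); last first.
    rewrite -(formV_unique C D) formV_gvec// gcZ.
    by apply: res_mul1; [exact: res_nuG | exact: res_fj].
  rewrite formV_gc big_seq [X in res _ X]big_seq.
  apply: res_sum => -[[k x] y]; rewrite (mem_pts (m := nz))// => rk /=.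
  rewrite -[X in res _ X]mul1r; apply: resM; first exact: res_nuG.
  rewrite gcZ gc_fi//.
  have [k0|k0] := eqVneq k 0.
    rewrite k0 qi0 mul0r mulr0 mul0r r0 ?mul0r; first exact: res0.
    by rewrite /rng; lia.
  have k1 : 0 < k by move: rk k0; rewrite /rng; lia.
  have rk1 : RD (k - 1) x y by move: rk k1; rewrite /rng; lia.
  have hD : eps1 a c d < k - 1 -> r' k x y = 0.
    by move=> hk; apply: (res_eq (hr' k x y)); apply: res_gcD0 => //; lia.
  have hC : eps1 a c d < k - 1 ->
      regular0 (q ^ (eps1 a c d - (k - 1)) * gc D (G a c d) (k - 1) x y).
    by move=> hk; apply: reg_gcD => //; apply: ltW.
  rewrite qi_qa; move: hC (hr (k - 1) x y) (hr' k x y) (res_qaz k1).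
  move: (gc D (G a c d) _ _ _) (gc D _ k x y) (qa q k) => g g' z hC hA hB hq.
  have -> : q ^ eps1 a c d * (q ^ (1 - k) * z * g) * g'
      = q ^ (eps1 a c d - (k - 1)) * (z * (g * g')).
    by rewrite !mulrA -expfzDr ?q_neq0// opprB.
  (* Below eps1 a positive power of q is left. Above it, [g] absorbs the pole and [g'] vanishes at q
     = 0. In both cases purity makes the matching term of the sum 0. At eps1 the power of q is 1. *)
  have [hk|hk|hk] := ltgtP (k - 1) (eps1 a c d).
  - rewrite (pr _ _ _ rk1) ?(lt_eqF hk)// mul0r.
    rewrite -[X in res _ X](mul0r (1 * (r (k - 1) x y * r' k x y))).
    apply: resM; first by apply: res_qz; rewrite subr_gt0.
    by apply: resM => //; apply: resM.
  - rewrite (pr _ _ _ rk1) ?(gt_eqF hk)// mul0r.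
    have [s hs] := reg_res (hC hk).
    rewrite mulrCA mulrA -(mulr0 (1 * s)) -[X in res _ (_ * X)](hD hk).
    by rewrite -!mulrA [_ * (g * g')]mulrA; apply: resM => //; apply: resM.
  rewrite -hk subrr expr0z mul1r -[X in res _ X]mul1r.
  by apply: resM => //; apply: resM.
have S4 : \sum_(t <- pts nz mz) (r (t.1.1 - 1) t.1.2 t.2 - r' t.1.1 t.1.2 t.2) ^+ 2 <= 0.
  under eq_bigr do rewrite sqrrB.
  rewrite big_split sumrB /= S2 sumrMnl S3.
  have := sum_shift_le r0; rewrite S1 => hs.
  by rewrite mulr2n opprD addrA subrK subr_le0.
have S5 : \sum_(t <- pts nz mz) (r (t.1.1 - 1) t.1.2 t.2 - r' t.1.1 t.1.2 t.2) ^+ 2 == 0.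
  by rewrite eq_le S4 sumr_ge0// => t _; rewrite sqr_ge0.
move=> k x y hk; rewrite gc_KF hk.
move: S5; rewrite psumr_eq0; last by move=> t _; rewrite sqr_ge0.
move=> /allP /(_ (k, x, y)); rewrite (mem_pts (m := nz))// hk => /(_ isT) /=.
rewrite sqrf_eq0 => /eqP <-.
by apply: resB.
Qed.

Definition ee1 (a c d : int) : int * int * int :=
  if a < d then (a, c, d - 1) else (a + 1, c - 1, d).

Lemma ee1P a c d a' c' d' : ee1 a c d = (a', c', d') ->
  RG a c d -> 0 < eps1 a c d ->
  [/\ RG a' c' d', ff1 a' c' d' = (a, c, d) & eps1 a c d = eps1 a' c' d' + 1].
Proof.
rewrite /ee1; case: ifP => ad [<- <- <-] h.
  have a1 : (a <= d) = true by lia.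
  have a2 : (a <= d - 1) = true by lia.
  rewrite /ff1 /eps1 a1 a2 => _; split; last by ring.
    by move: h; rewrite /rng /rr; lia.
  by rewrite subrK.
have a2 : (a + 1 <= d) = false by lia.
have -> : eps1 a c d = c by rewrite /eps1; case: ifP => h1; lia.
rewrite /ff1 /eps1 a2 => c0; split; last by rewrite subrK.
  by move: h; rewrite /rng /rr; lia.
by rewrite !(addrK, subrK).
Qed.

(** Induction on [eps1]. At 0, [res_gcD0] leaves only depth 0; otherwise the vector is, modulo q,
    the shift by one of the pure vector at [ee1]. *)
Lemma pure_all a c d : RG a c d -> pure a c d.
Proof.
have [N] := ubnP (absz (eps1 a c d)); elim: N => // N IH in a c d *.
move=> ltN h.
have ge0 : 0 <= eps1 a c d by rewrite /eps1; case: ifP; move: h; rewrite /rng; lia.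
have [e0|e0] := eqVneq (eps1 a c d) 0.
  move=> k c' d' r hk hr r0; rewrite e0; apply/eqP/negPn/negP => k0.
  have ek : eps1 a c d < k by move: hk k0; rewrite e0 /rng; lia.
  by move: r0; rewrite (res_eq hr (res_gcD0 h hk ek)) eqxx.
case e : (ee1 a c d) => [[a' c'] d'].
have ep : 0 < eps1 a c d by rewrite lt_def e0.
have [h' ff ee] := ee1P e h ep.
have ge0' : 0 <= eps1 a' c' d' by rewrite /eps1; case: ifP; move: h'; rewrite /rng; lia.
have pu : pure a' c' d' by apply: IH => //; lia.
move=> k x y r hk hr r0; have := KF_gvec_step h' ff h pu hk.
rewrite gc_KF hk => /resB /(_ hr) => hd.
have hrk : res (gc D (G a' c' d') (k - 1) x y) r.
  by have := resD (KF_gvec_step h' ff h pu hk) hr; rewrite gc_KF hk subrK add0r.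
have hk1 : RD (k - 1) x y.
  by have := res_neq0 hrk r0; apply: contraR => /gc_out ->.
by rewrite ee -(pu _ _ _ _ hk1 hrk r0) subrK.
Qed.

Lemma KF_gvec_ff1 a c d a' c' d' : RG a c d -> ff1 a c d = (a', c', d') ->
  RG a' c' d' -> small D (KF D (G a c d) - G a' c' d').
Proof.
move=> h e h' k x y hk; rewrite gcB.
exact: (KF_gvec_step h e h' (pure_all h) hk).
Qed.

(** Here eps1 + wt1 = 0, so by purity and weight every component modulo q sits at the end of its
    j-string, where the shift expels it. *)
Lemma KF_gvec_ff1_out a c d a' c' d' : RG a c d -> ff1 a c d = (a', c', d') ->
  ~~ RG a' c' d' -> small D (KF D (G a c d)).
Proof.
move=> h e h' k x y hk; rewrite gc_KF hk.
have [r hr] := reg_res (lat_reg (k - 1) x y (lat_gvecD h)).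
have [<-//|r0] := eqVneq r 0; exfalso.
have g0 := res_neq0 hr r0.
have hk1 : RD (k - 1) x y by apply/negPn/negP => /gc_out hk1; rewrite hk1 eqxx in g0.
have ek := pure_all h hk1 hr r0; have wk := gcD_weight h g0.
move: e h h' hk hk1 ek wk.
by rewrite /ff1 /eps1 /rng /rr /wt0 /wt1 /rr; case: ifP => ad [<- <- <-]; lia.
Qed.

(** Modulo q the vector is the [KF]-image of the one at [ee1]. [KE] undoes [KF] except on components
    pushed out of the range, which purity and weight exclude. *)
Lemma KE_gvec_ee1 a c d a' c' d' : RG a c d -> ee1 a c d = (a', c', d') ->
  0 < eps1 a c d -> small D (KE D (G a c d) - G a' c' d').
Proof.
move=> h e he k x y hk; have [h' ff ee] := ee1P e h he.
rewrite gcB gc_KE hk; have [hk1|hk1] := boolP (RD (k + 1) x y).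
  have := KF_gvec_ff1 h' ff h hk1; rewrite gcB gc_KF hk1 addrK => /resN.
  by rewrite opprB oppr0.
rewrite gc_out// sub0r -oppr0; apply: resN.
have [r hr] := reg_res (lat_reg k x y (lat_gvecD h')).
have [<-//|r0] := eqVneq r 0; exfalso.
have g0 := res_neq0 hr r0.
have ek := pure_all h' hk hr r0; have wk := gcD_weight h' g0.
move: ff h h' hk hk1 ek wk.
by rewrite /ff1 /eps1 /rng /rr /wt0 /wt1 /rr; case: ifP => ad [<- <- <-]; lia.
Qed.

Lemma KE_gvec_ee1_out a c d : RG a c d -> eps1 a c d = 0 -> small D (KE D (G a c d)).
Proof.
move=> h e k x y hk; rewrite gc_KE hk.
have [r hr] := reg_res (lat_reg (k + 1) x y (lat_gvecD h)).
have [<-//|r0] := eqVneq r 0; exfalso.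
have hk1 : RD (k + 1) x y.
  by have := res_neq0 hr r0; apply: contraR => /gc_out ->.
by have := pure_all h hk1 hr r0; move: hk; rewrite e /rng; lia.
Qed.

End Residues.

(* Nakayama's lemma over the local ring of regular functions at q = 0. *)
Lemma nakayama (V : lmodType Qq) (N : V -> Prop) (I : eqType) (F : I -> V) (s : seq I) :
  (forall k v w, regular0 k -> N v -> N w -> N (k *: v + w)) -> N 0 ->
  (forall i, i \in s -> exists c : I -> Qq, (forall k, regular0 (c k)) /\
     N (F i - \sum_(k <- s) (q * c k) *: F k)) ->
  forall i, i \in s -> N (F i).
Proof.
move=> NP N0; have NZ k v : regular0 k -> N v -> N (k *: v).
  by move=> hk hv; rewrite -[_ *: _]addr0; apply: NP.
have ND v w : N v -> N w -> N (v + w).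
  by move=> hv hw; rewrite -[v]scale1r; apply: NP => //; exact: reg1.
elim: s => [//|i0 s IH] h.
have [c [hc]] := h i0 (mem_head _ _); rewrite big_cons => h0.
(* 1 - q c is a unit of the local ring, so [F i0] can be eliminated from the other relations, which
   keep the same shape. *)
have w1 : res (1 - q * c i0) 1.
  by rewrite -[X in res _ X]subr0; apply: resB; [exact: res1 | apply/res_qM/hc].
have wne : 1 - q * c i0 != 0.
  by apply/eqP => e; rewrite e in w1; have := res_eq res0 w1 => /eqP.
have hw : regular0 (1 - q * c i0)^-1.
  by have := resV (oner_neq0 _) w1 => /res_reg.
have {}h0 : N (F i0 - \sum_(k <- s) (q * ((1 - q * c i0)^-1 * c k)) *: F k).
  have := NZ _ _ hw h0; congr N.
  rewrite opprD addrA -{1}[F i0]scale1r -scalerBl scalerBr scalerA mulVf// scale1r.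
  congr (_ - _); rewrite scaler_sumr; apply: eq_bigr => k _.
  by rewrite scalerA mulrCA.
have hs : forall i, i \in s -> N (F i).
  apply: IH => i is_; have [c' [hc']] := h i (@mem_behead _ (i0 :: s) _ is_).
  rewrite big_cons => h1.
  exists (fun k => c' k + q * (c' i0 * ((1 - q * c i0)^-1 * c k))); split=> [k|].
    apply: regD => //; apply: regM; first exact: reg_q.
    by do 2!(apply: regM => //).
  have := NP _ _ _ (regM reg_q (hc' i0)) h0 h1; congr N.
  have -> : \sum_(k <- s) (q * (c' k + q * (c' i0 * ((1 - q * c i0)^-1 * c k)))) *: F k
      = \sum_(k <- s) (q * c' k) *: F k
      + (q * c' i0) *: \sum_(k <- s) (q * ((1 - q * c i0)^-1 * c k)) *: F k.
    rewrite scaler_sumr -big_split; apply: eq_bigr => k _ /=.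
    by rewrite scalerA -scalerDl mulrDr [q * (q * _)]mulrCA !mulrA [_ * q]mulrC !mulrA.
  rewrite scalerBr addrCA; congr (_ + _).
  have sub3 (X Y Z : V) : X - Y - (X + Z) = - (Z + Y).
    by rewrite opprD addrA [X - Y - X]addrAC subrr add0r opprD addrC.
  exact: sub3.
move=> i; rewrite in_cons => /orP[/eqP->|/hs//].
have hS : N (\sum_(k <- s) (q * ((1 - q * c i0)^-1 * c k)) *: F k).
  rewrite big_seq; apply: (big_ind N) => // k ks.
  apply: NZ (hs _ ks); apply: regM; first exact: reg_q.
  exact: regM.
by have := ND _ _ h0 hS; rewrite subrK.
Qed.

(** * The model crystal on triples *)

Local Notation T := (int * int * int)%type.

Definition rngt (m n : nat) (x : T) : bool := rng m n x.1.1 x.1.2 x.2.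

(* f_0^a f_1^(c + d) f_0^c applied to the highest weight vertex is (a, c, d). *)
Definition mf (m n : nat) (a : 'I_2) (x : T) : option T :=
  let y := if a == ord0 then (x.1.1 + 1, x.1.2, x.2) else ff1 x.1.1 x.1.2 x.2 in
  if rngt m n y then Some y else None.

Definition me (m n : nat) (a : 'I_2) (x : T) : option T :=
  let y := if a == ord0 then (x.1.1 - 1, x.1.2, x.2) else ee1 x.1.1 x.1.2 x.2 in
  if rngt m n y then Some y else None.

Definition mwt (m n : nat) (x : T) : weight := fun a =>
  if a == ord0 then wt0 m x.1.1 x.1.2 x.2 else wt1 n x.1.1 x.1.2 x.2.

Definition model_crystal (m n : nat) : crystal := {|
  ccarrier := option T;
  czero := None;
  cverts := Some @` [set x | rngt m n x];
  ce := fun a => obind (me m n a);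
  cf := fun a => obind (mf m n a);
  cwt := fun ox mu => exists2 x, ox = Some x & mu = mwt m n x |}.

Lemma mf1E m n a c d : mf m n ord_max (a, c, d) =
  if rngt m n (ff1 a c d) then Some (ff1 a c d) else None.
Proof. by []. Qed.

Lemma me1E m n a c d : me m n ord_max (a, c, d) =
  if rngt m n (ee1 a c d) then Some (ee1 a c d) else None.
Proof. by []. Qed.

Lemma mf_rng m n a x y : mf m n a x = Some y -> rngt m n y.
Proof. by rewrite /mf; case: ifP => // h [<-]. Qed.

Lemma rngt000 m n : rngt m n (0, 0, 0).
Proof. by rewrite /rngt /rng /rr /=; lia. Qed.

Lemma model_ind m n (P : T -> Prop) : P (0, 0, 0) ->
  (forall a x y, rngt m n x -> P x -> mf m n a x = Some y -> P y) ->
  forall x, rngt m n x -> P x.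
Proof.
move=> P0 Pf.
have P1 (c : nat) : Posz c <= m -> P (Posz c, 0, 0).
  elim: c => // c IH cm; apply: (Pf ord0 (Posz c, 0, 0)).
  - by rewrite /rngt /rng /rr /=; lia.
  - by apply: IH; lia.
  rewrite /mf /= ifT; last by rewrite /rngt /rng /rr /=; lia.
  by congr (Some (_, _, _)); lia.
(* While d = 0 < a, each f_1 moves one unit from a to c. *)
have P2 (k c : nat) : Posz (k + c)%N <= m -> P (Posz c, Posz k, 0).
  elim: k c => [|k IH] c km; first by apply: P1; lia.
  apply: (Pf ord_max (Posz c.+1, Posz k, 0)).
  - by rewrite /rngt /rng /rr /=; lia.
  - by apply: IH; lia.
  rewrite mf1E; have -> : ff1 c.+1 k 0 = (Posz c, Posz k.+1, 0).
    by rewrite /ff1 /=; congr (_, _, _); lia.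
  by rewrite ifT// /rngt /rng /rr /=; lia.
have P3 (c d : nat) : Posz c <= m -> Posz d <= n -> P (0, Posz c, Posz d).
  move=> cm; elim: d => [|d IH] dn; first by apply: P2; rewrite addn0.
  apply: (Pf ord_max (0, Posz c, Posz d)).
  - by rewrite /rngt /rng /rr /=; lia.
  - by apply: IH; lia.
  rewrite mf1E; have -> : ff1 0 c d = (0, Posz c, Posz d.+1).
    by rewrite /ff1 /=; congr (_, _, _); lia.
  by rewrite ifT// /rngt /rng /rr /=; lia.
move=> [[a c] d] h; have ha : a = Posz `|a| by move: h; rewrite /rngt /rng /=; lia.
rewrite {}ha in h *; elim: `|a|%N h => [|k IH] h.
  have -> : c = Posz `|c| by move: h; rewrite /rngt /rng /=; lia.
  have -> : d = Posz `|d| by move: h; rewrite /rngt /rng /=; lia.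
  by apply: P3; move: h; rewrite /rngt /rng /=; lia.
have h' : rngt m n (Posz k, c, d) by move: h; rewrite /rngt /rng /=; lia.
apply: (Pf ord0 (Posz k, c, d)) => //; first exact: IH.
rewrite /mf /= ifT; last by move: h; rewrite /rngt /rng /=; lia.
by congr (Some (_, _, _)); lia.
Qed.

Lemma ord2P (a : 'I_2) : a = ord0 \/ a = ord_max.
Proof. by case: a => [[|[]]//= ?]; [left|right]; apply: val_inj. Qed.

(** * The crystal of the module is the model crystal *)

Section ModuleCrystal.
Variables (V : lmodType Qq) (M : UqA2_module V) (u : V) (m n : nat).
Variables (C : coords M u ord0 ord_max m n) (D : coords M u ord_max ord0 n m).
Hypothesis hu : highest_weight_vector M (a2_weight m n) u.
Local Notation mz := (Posz m).
Local Notation nz := (Posz n).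
Local Notation RT := (rngt m n).

Definition gx (x : T) : V := gvec C x.1.1 x.1.2 x.2.
Definition go (o : option T) : V := if o is Some x then gx x else 0.

Definition okT (o : option T) : bool := if o is Some x then RT x else true.

Definition kf (a : 'I_2) (v : V) := if a == ord0 then KF C v else KF D v.
Definition ke (a : 'I_2) (v : V) := if a == ord0 then KE C v else KE D v.
Local Notation sm := (small C).

Let smD v : small D v <-> sm v.
Proof. by split => /(small_unique C D). Qed.

Lemma sm0 : sm 0.
Proof. by move=> a c d _; rewrite gc0; apply: res0. Qed.

Lemma smD2 v w : sm v -> sm w -> sm (v + w).
Proof. by move=> hv hw; rewrite -[v]scale1r; apply: smallP => //; apply: reg1. Qed.

Lemma smN v : sm v -> sm (- v).
Proof.
move=> hv; rewrite -scaleN1r -[_ *: _]addr0; apply: smallP => //; last exact: sm0.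
by apply: regN; apply: reg1.
Qed.

Lemma smB v w : sm v -> sm w -> sm (v - w).
Proof. by move=> hv hw; apply: smD2 => //; apply: smN. Qed.

Lemma kash_fE a v v' : kashiwara_f M a v v' <-> v' = kf a v.
Proof. by rewrite /kf; case: (ord2P a) => -> /=; apply: kash_f. Qed.

Lemma kash_eE a v v' : kashiwara_e M a v v' <-> v' = ke a v.
Proof. by rewrite /ke; case: (ord2P a) => -> /=; apply: kash_e. Qed.

Lemma small_kf a v : sm v -> sm (kf a v).
Proof.
by rewrite /kf; case: ifP => _; [apply: small_KF | move/smD/small_KF/smD].
Qed.

Lemma small_ke a v : sm v -> sm (ke a v).
Proof.
by rewrite /ke; case: ifP => _; [apply: small_KE | move/smD/small_KE/smD].
Qed.

Lemma kfB a v w : kf a (v - w) = kf a v - kf a w.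
Proof. by rewrite /kf; case: ifP => _; apply: KFB. Qed.

Lemma keB a v w : ke a (v - w) = ke a v - ke a w.
Proof. by rewrite /ke; case: ifP => _; apply: KEB. Qed.

Lemma lat_kf a v : lat C v -> lat C (kf a v).
Proof.
rewrite /kf; case: ifP => _; first exact: lat_KF.
by move/(lat_unique C D)/lat_KF/(lat_unique C D).
Qed.

Lemma kf_gx a x : RT x -> sm (kf a (gx x) - go (mf m n a x)).
Proof.
case: x => -[b c] d h; case: (ord2P a) => -> /=; rewrite /kf /=.
  rewrite KF_gvec// /mf /rngt /=; case: ifP => _; rewrite subrr; exact: sm0.
rewrite mf1E; case e : (ff1 b c d) => [[b' c'] d'].
case: ifP => h'; apply/smD; first exact: (KF_gvec_ff1 C D h e h').
by rewrite subr0; apply: (KF_gvec_ff1_out C D h e (negbT h')).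
Qed.

Lemma ke_gx a x : RT x -> sm (ke a (gx x) - go (me m n a x)).
Proof.
case: x => -[b c] d h; case: (ord2P a) => -> /=; rewrite /ke /=.
  rewrite KE_gvec// /me /rngt /=; case: ifP => _; rewrite subrr; exact: sm0.
rewrite me1E; case e : (ee1 b c d) => [[b' c'] d'].
(* [ee1] stays in the range exactly when epsilon_1 is positive. *)
have hr : rngt m n (b', c', d') = (0 < eps1 b c d).
  move: e h; rewrite /ee1 /eps1 /rngt /rng /rr /=.
  by case: ifP => bd [<- <- <-] h; case: ifP => bd'; lia.
rewrite hr; case: ifP => h'; apply/smD; first exact: (KE_gvec_ee1 C D h e h').
rewrite subr0; apply: (KE_gvec_ee1_out C D h).
by move: h h'; rewrite /eps1 /rngt /rng /=; case: ifP; lia.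
Qed.

Lemma kf0 a : kf a 0 = 0.
Proof. by have := kfB a 0 0; rewrite subr0 subrr. Qed.

Lemma kf_go a o v : okT o -> sm (v - go o) ->
  sm (kf a v - go (obind (mf m n a) o)).
Proof.
move=> ho /(small_kf a); rewrite kfB; case: o ho => [x|] /= hx.
  by move/smD2/(_ (kf_gx a hx)); rewrite addrA subrK.
by rewrite kf0 !subr0.
Qed.

Lemma gx000 : gx (0, 0, 0) = u.
Proof.
apply: (gc_inj (C := C)) => a c d r; rewrite /gx gc_gvec ?(rngt000 m n)//.
rewrite /gc crd_u {1}/dl; case: eqP => [[-> -> ->]|ne].
  by rewrite (lam000 _ _ q_generic q_neq0) /dl eqxx divr1.
by rewrite /dl; case: eqP => // _; rewrite mul0r.
Qed.

(** Modulo qL a chain follows the arrows of the model, and becomes 0 once it leaves the range. *)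
Lemma fchain_go v : fchain M u v -> lat C v /\
  exists o, okT o /\ sm (v - go o).
Proof.
elim=> [|a w w' _ [lw [o [ho hw]]] /kash_fE ->].
  have l0 : lat C (gx (0, 0, 0)) by apply/lat_gvec/rngt000.
  split; first by rewrite gx000 in l0.
  exists (Some (0, 0, 0)); split; first exact: rngt000.
  by rewrite /= gx000 subrr; apply: sm0.
split; first exact: lat_kf.
exists (obind (mf m n a) o); split; last exact: kf_go.
case: o {hw} ho => //= x _; case e : (mf _ _ _ _) => [y|] //.
exact: mf_rng e.
Qed.

Lemma fchain_gx x : RT x -> exists v, fchain M u v /\ sm (v - gx x).
Proof.
elim/model_ind => [|a y z hy [v [cv sv]] e].
  by exists u; split; [exact: fchain_base | rewrite gx000 subrr; apply: sm0].
exists (kf a v); split; first by apply: (fchain_step cv); apply/kash_fE.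
by have := @kf_go a (Some y) v hy sv; rewrite /= e.
Qed.

Lemma latticeP k v w : regular0 k -> lattice M u v -> lattice M u w ->
  lattice M u (k *: v + w).
Proof.
move=> hk [r [c [f [hf ->]]]] [r' [c' [f' [hf' ->]]]].
exists (r + r')%N, (fun i => match fintype.split i with inl i => k * c i | inr i => c' i end),
  (fun i => match fintype.split i with inl i => f i | inr i => f' i end); split.
  move=> i; case: fintype.split => i'; last exact: hf'.
  by have [h1 h2] := hf i'; split => //; apply: regM.
rewrite big_split_ord /= scaler_sumr; congr (_ + _); apply: eq_bigr => i _.
  by rewrite -[lshift _ _]/(unsplit (inl i)) unsplitK scalerA.
by rewrite -[rshift _ _]/(unsplit (inr i)) unsplitK.
Qed.

Lemma lattice0 : lattice M u 0.
Proof.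
exists 0%N, (fun=> 0), (fun=> u); split; first by case.
by rewrite big_ord0.
Qed.

Lemma lattice_sub v : lattice M u v -> lat C v.
Proof.
move=> [r [c [f [hf ->]]]]; apply: (big_ind (lat C)).
- by move=> a b d _; rewrite gc0; apply: reg0.
- by move=> x y hx hy; rewrite -[x]scale1r; apply: latP => //; apply: reg1.
move=> i _; have [hc /fchain_go [hl _]] := hf i.
rewrite -[_ *: _]addr0; apply: latP => // a b d _; rewrite gc0; exact: reg0.
Qed.

Lemma lattice_fchain v : fchain M u v -> lattice M u v.
Proof.
move=> h; exists 1%N, (fun=> 1), (fun=> v); split.
  by move=> _; split => //; apply: reg1.
by rewrite big_ord1 scale1r.
Qed.

(** Each u_{a,c,d} differs from a chain vector by an element of q times the lattice [lat C], so
    Nakayama's lemma places the whole basis in the span of the chains. *)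
Lemma latticeE v : lattice M u v <-> lat C v.
Proof.
split=> [|lv]; first exact: lattice_sub.
have hx x : x \in pts mz nz -> lattice M u (gx x).
  apply: (nakayama latticeP lattice0) => {}x; case: x => -[a c] d.
  rewrite pts_rng => /(@fchain_gx (a, c, d))[w [cw /smN sw]].
  have [w' lw' e] := (small_q C _).1 sw.
  exists (fun t => gc C w' t.1.1 t.1.2 t.2); split; first by move=> k; apply: lat_reg.
  have -> : \sum_(k <- pts mz nz) (q * gc C w' k.1.1 k.1.2 k.2) *: gx k = q *: w'.
    rewrite {2}(gvec_decomp C w') scaler_sumr; apply: eq_bigr => t _.
    by rewrite scalerA.
  rewrite -e opprK addrC subrK; exact: lattice_fchain.
rewrite (gvec_decomp C v) big_seq; apply: (big_ind (lattice M u)).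
- exact: lattice0.
- by move=> x y lx ly; rewrite -[x]scale1r; apply: latticeP => //; apply: reg1.
move=> x px; rewrite -[_ *: _]addr0; apply: latticeP; [|exact: hx|exact: lattice0].
exact: lat_reg.
Qed.

Lemma qlatticeE v : qlattice M u v <-> sm v.
Proof.
rewrite small_q; split=> [[w /latticeE lw <-]|[w lw ->]]; first by exists w.
by exists w => //; apply/latticeE.
Qed.

Lemma coset_eq v w : sm (v - w) -> coset M u v = coset M u w.
Proof.
move=> h; apply/seteqP; split=> z /= /qlatticeE hz; apply/qlatticeE.
  by have := smD2 hz h; rewrite addrA subrK.
by have := smB hz h; rewrite opprB addrA subrK.
Qed.

Lemma coset_inj v w : coset M u v = coset M u w -> sm (v - w).
Proof.
move=> e; have : coset M u v v by apply/qlatticeE; rewrite subrr; apply: sm0.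
by rewrite e => /qlatticeE.
Qed.

(** The operator descends to cosets because it is additive and preserves qL. *)
Lemma induced_kf a v : induced M u (kashiwara_f M a) (coset M u v) = coset M u (kf a v).
Proof.
apply/seteqP; split=> w /=.
  move=> [v1 /qlatticeE h1 [v2 /kash_fE -> /qlatticeE h2]]; apply/qlatticeE.
  by have := smD2 h2 (small_kf a h1); rewrite kfB addrA subrK.
move=> hw; exists v; first by apply/qlatticeE; rewrite subrr; apply: sm0.
by exists (kf a v) => //; apply/kash_fE.
Qed.

Lemma induced_ke a v : induced M u (kashiwara_e M a) (coset M u v) = coset M u (ke a v).
Proof.
apply/seteqP; split=> w /=.
  move=> [v1 /qlatticeE h1 [v2 /kash_eE -> /qlatticeE h2]]; apply/qlatticeE.
  by have := smD2 h2 (small_ke a h1); rewrite keB addrA subrK.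
move=> hw; exists v; first by apply/qlatticeE; rewrite subrr; apply: sm0.
by exists (ke a v) => //; apply/kash_eE.
Qed.

Lemma res_gx x y : RT x -> RT y ->
  res (gc C (gx x) y.1.1 y.1.2 y.2) (if y == x then 1 else 0).
Proof.
case: x y => [[a c] d] [[a' c'] d'] hx hy; rewrite /gx gc_gvec// /dl /=.
by case: ifP => _; [exact: res1 | exact: res0].
Qed.

Lemma gx_inj x y : RT x -> RT y -> sm (gx x - gx y) -> x = y.
Proof.
move=> hx hy /(_ x.1.1 x.1.2 x.2 hx); rewrite gcB => h.
have := resB (res_gx hx hx) (res_gx hy hx); rewrite eqxx => /(res_eq h).
by case: eqP => // _ /eqP; rewrite subr0 eq_sym oner_eq0.
Qed.

Lemma gx_not_small x : RT x -> ~ sm (gx x).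
Proof.
move=> hx /(_ x.1.1 x.1.2 x.2 hx) h; have := res_gx hx hx; rewrite eqxx.
by move=> /(res_eq h)/eqP; rewrite eq_sym oner_eq0.
Qed.

Lemma ut_gx a x : RT x -> ut M a (gx x) = q ^ mwt m n x a *: gx x.
Proof.
move=> hx; apply: (gc_inj (C := C)) => b c d r; rewrite gcZ.
case: (ord2P a) => ->; rewrite ?gc_ti ?gc_tj /mwt /= /gx gc_gvec// /dl;
  by case: eqP => [[-> -> ->]|]; rewrite ?mulr0.
Qed.

(** The coordinate at x of any vector in the coset has value 1 at q = 0; being nonzero, it reveals
    the weight. *)
Lemma weight_gx v x mu : RT x -> coset M u (gx x) v -> weight_vector M mu v ->
  mu = mwt m n x.
Proof.
move=> hx /qlatticeE sv wv; apply/funext => a.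
have g0 : gc C v x.1.1 x.1.2 x.2 != 0.
  have := resD (sv _ _ _ hx) (res_gx hx hx); rewrite gcB subrK eqxx add0r.
  by move/res_neq0/(_ (oner_neq0 _)).
have := congr1 (fun w => gc C w x.1.1 x.1.2 x.2) (wv a); rewrite gcZ.
case: (ord2P a) => ->; rewrite ?gc_ti ?gc_tj => /(mulIf g0)/qz_inj <-;
  by rewrite /mwt.
Qed.

Lemma model_module : crystal_isomorphic (model_crystal m n) (crystal_of_module M u).
Proof.
have cbE X : crystal_base M u X <-> exists2 x, RT x & X = coset M u (gx x).
  split=> [[v [/fchain_go [_ [[x|] [hx sv]]] nq] <-]|[x hx ->]].
  - by exists x => //; apply: coset_eq.
  - by case: nq; apply/qlatticeE; move: sv; rewrite /= subr0.
  have [v [cv sv]] := fchain_gx hx; exists v; last exact: coset_eq.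
  split=> // /qlatticeE h; apply: (gx_not_small hx).
  by have := smB h sv; rewrite opprB addrC subrK.
exists (fun o => coset M u (go o)); split=> /=.
- by apply/seteqP; split=> w; rewrite /coset /= subr0.
- split=> [_ [x hx <-]|o o' |X /cbE [x hx ->]].
  + by apply/cbE; exists x.
  + move=> /set_mem [x hx <-] /set_mem [y hy <-] /coset_inj e.
    by rewrite (gx_inj hx hy e).
  by exists (Some x) => //; exists x.
- move=> a _ [x hx <-]; rewrite induced_ke; apply/esym/coset_eq; exact: ke_gx.
- move=> a _ [x hx <-]; rewrite induced_kf; apply/esym/coset_eq; exact: kf_gx.
move=> _ mu [x hx <-]; split=> [[_ [<-] ->]|[v cv wv]].
  exists (gx x); first by apply/qlatticeE; rewrite subrr; apply: sm0.
  by move=> a; apply: ut_gx.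
by exists x => //; apply: weight_gx hx cv wv.
Qed.

End ModuleCrystal.

Lemma model_isomorphic (m n : nat) (V : lmodType Qq) (M : UqA2_module V) (u : V) :
  irreducible_module M -> highest_weight_vector M (a2_weight m n) u ->
  crystal_isomorphic (model_crystal m n) (crystal_of_module M u).
Proof.
move=> irr hu.
have [C] := coords_exist (i := ord0) (j := ord_max) (m := m) (n := n) isT irr hu erefl erefl.
have [D] := coords_exist (i := ord_max) (j := ord0) (m := n) (n := m) isT irr hu erefl erefl.
exact: (model_module C D).
Qed.

(** * The crystal B_l *)

(* An element of B_l in the coordinates x1, x2, x3, w = (y3 - x3) / 2, y2, y1. *)
Record vec := Vec { p1 : int; p2 : int; p3 : int; pw : int; p5 : int; p6 : int }.

Definition toE (v : vec) : elt :=
  Elt (p1 v) (p2 v) (p3 v) (p3 v + 2 * pw v) (p5 v) (p6 v).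

Definition okv (l : nat) (v : vec) : bool := let: Vec x1 x2 x3 w y2 y1 := v in
  [&& 0 <= x1, 0 <= x2, 0 <= x3, 0 <= x3 + 2 * w, 0 <= y2, 0 <= y1
    & x1 + x2 + x3 + w + y2 + y1 <= l].

Definition vA1 (v : vec) : int := 0.
Definition vA2 (v : vec) : int := let: Vec x1 x2 x3 w y2 y1 := v in y1 - x1.
Definition vA3 (v : vec) : int := let: Vec x1 x2 x3 w y2 y1 := v in
  y1 - x1 + y2 - x3 - 2 * w.
Definition vA4 (v : vec) : int := let: Vec x1 x2 x3 w y2 y1 := v in
  y1 - x1 + y2 - x3 + w.
Definition vA5 (v : vec) : int := let: Vec x1 x2 x3 w y2 y1 := v in
  y1 - x1 + y2 - x2 + w.
Definition vA6 (v : vec) : int := let: Vec x1 x2 x3 w y2 y1 := v in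
  2 * y1 - 2 * x1 + y2 - x2 + w.

Definition max6 (a b c d e f : int) : int :=
  Num.max a (Num.max b (Num.max c (Num.max d (Num.max e f)))).

Definition vmax v := max6 (vA1 v) (vA2 v) (vA3 v) (vA4 v) (vA5 v) (vA6 v).

(* [vsh k] and [vshV k] are the cases k + 1 of f_0 and e_0; [vsh1] and [vsh1V] are
   the three cases of f_1 and e_1, with conditions [dom1] and [dom1V]. *)
Definition vsh k v : vec := let: Vec x1 x2 x3 w y2 y1 := v in
  match k with
  | 0 => Vec (x1 + 1) x2 x3 w y2 y1
  | 1 => Vec x1 x2 (x3 + 1) w y2 (y1 - 1)
  | 2 => Vec x1 x2 (x3 + 2) (w - 1) (y2 - 1) y1
  | 3 => Vec x1 (x2 + 1) x3 (w - 1) y2 y1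
  | 4 => Vec (x1 + 1) x2 (x3 - 1) w y2 y1
  | _ => Vec x1 x2 x3 w y2 (y1 - 1)
  end.

Definition vshV k v : vec := let: Vec x1 x2 x3 w y2 y1 := v in
  match k with
  | 0 => Vec (x1 - 1) x2 x3 w y2 y1
  | 1 => Vec x1 x2 (x3 - 1) w y2 (y1 + 1)
  | 2 => Vec x1 x2 (x3 - 2) (w + 1) (y2 + 1) y1
  | 3 => Vec x1 (x2 - 1) x3 (w + 1) y2 y1
  | 4 => Vec (x1 - 1) x2 (x3 + 1) w y2 y1
  | _ => Vec x1 x2 x3 w y2 (y1 + 1)
  end.

Definition vsh1 k v : vec := let: Vec x1 x2 x3 w y2 y1 := v in
  match k with
  | 0 => Vec (x1 - 1) (x2 + 1) x3 w y2 y1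
  | 1 => Vec x1 x2 (x3 - 1) (w + 1) y2 y1
  | _ => Vec x1 x2 x3 w (y2 - 1) (y1 + 1)
  end.

Definition vsh1V k v : vec := let: Vec x1 x2 x3 w y2 y1 := v in
  match k with
  | 0 => Vec (x1 + 1) (x2 - 1) x3 w y2 y1
  | 1 => Vec x1 x2 (x3 + 1) (w - 1) y2 y1
  | _ => Vec x1 x2 x3 w (y2 + 1) (y1 - 1)
  end.

Definition dom1 k v : bool := let: Vec x1 x2 x3 w y2 y1 := v in
  let z := y2 - x3 - 2 * w in
  match k with
  | 0 => (0 <= x2 - x3) && (z <= x2 - x3)
  | 1 => (z <= 0) && (0 < x3 - x2)
  | _ => (0 < z) && (x2 - x3 < z)
  end.

Definition dom1V k v : bool := let: Vec x1 x2 x3 w y2 y1 := v in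
  let z := y2 - x3 - 2 * w in
  match k with
  | 0 => (0 < x2 - x3) && (z < x2 - x3)
  | 1 => (z < 0) && (0 <= x3 - x2)
  | _ => (0 <= z) && (x2 - x3 <= z)
  end.

Lemma okvE l v : inB l (toE v) = okv l v.
Proof.
case: v => x1 x2 x3 w y2 y1; rewrite /inB /toE /s /=.
have -> : ((x3 + (x3 + 2 * w)) %/ 2)%Z = x3 + w by lia.
rewrite (_ : (x3 == _ %[mod 2])%Z = true) ?andbT.
  by apply/idP/idP; lia.
lia.
Qed.

Lemma toE_onto l b : inB l b -> exists v, b = toE v.
Proof.
case: b => x1 x2 x3 y3 y2 y1; rewrite /inB /= => /andP[/andP[_ /eqP e] _].
have /dvdzP[w hw] : (2 %| y3 - x3)%Z by rewrite -eqz_mod_dvd; apply/eqP.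
exists (Vec x1 x2 x3 w y2 y1); rewrite /toE /=; congr (Elt _ _ _ _ _ _).
by rewrite mulrC -hw addrC subrK.
Qed.

Lemma toE_inj v v' : toE v = toE v' -> v = v'.
Proof.
case: v v' => [x1 x2 x3 w y2 y1] [x1' x2' x3' w' y2' y1'] [-> -> -> h -> ->].
by congr Vec; lia.
Qed.

Lemma AseqE v : Aseq (toE v) = [:: vA1 v; vA2 v; vA3 v; vA4 v; vA5 v; vA6 v].
Proof.
case: v => x1 x2 x3 w y2 y1; rewrite /Aseq /toE /=.
have -> : ((x3 + 2 * w - x3) %/ 2)%Z = w by lia.
by congr [:: _; _; _; _; _; _]; ring.
Qed.

Definition okopt l v := if okv l v then Some (toE v) else None.

(** The least index of a maximum spelled out as linear inequalities for [lia]. Applied to the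
    reversed list it describes the greatest index. *)
Definition firstmax (k : nat) (a0 a1 a2 a3 a4 a5 : int) : bool :=
  let a := nth a0 [:: a0; a1; a2; a3; a4; a5] k in
  [&& (k < 6)%N, [&& a0 <= a, a1 <= a, a2 <= a, a3 <= a, a4 <= a & a5 <= a] &
    [&& (0 < k)%N ==> (a0 < a), (1 < k)%N ==> (a1 < a), (2 < k)%N ==> (a2 < a),
      (3 < k)%N ==> (a3 < a) & (4 < k)%N ==> (a4 < a)]].

Lemma first_argmaxP a0 a1 a2 a3 a4 a5 :
  firstmax (first_argmax [:: a0; a1; a2; a3; a4; a5]) a0 a1 a2 a3 a4 a5.
Proof.
rewrite /first_argmax /=; case: ifP => h0; first by rewrite /firstmax /=; lia.
case: ifP => h1; first by rewrite /firstmax /=; lia.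
case: ifP => h2; first by rewrite /firstmax /=; lia.
case: ifP => h3; first by rewrite /firstmax /=; lia.
case: ifP => h4; first by rewrite /firstmax /=; lia.
case: ifP => h5; first by rewrite /firstmax /=; lia.
lia.
Qed.

Lemma f0E l v : exists2 k,
  firstmax k (vA1 v) (vA2 v) (vA3 v) (vA4 v) (vA5 v) (vA6 v) &
  f0 l (toE v) = okopt l (vsh k v).
Proof.
exists (first_argmax (Aseq (toE v))); first by rewrite AseqE; apply: first_argmaxP.
rewrite /f0 /okopt -okvE /restrB; move: (first_argmax _) => k.
suff <- : (match k with
   | 0 => shift (toE v) 1 0 0 0 0 0
   | 1 => shift (toE v) 0 0 1 1 0 (-1)
   | 2 => shift (toE v) 0 0 2 0 (-1) 0
   | 3 => shift (toE v) 0 1 0 (-2) 0 0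
   | 4 => shift (toE v) 1 0 (-1) (-1) 0 0
   | _ => shift (toE v) 0 0 0 0 0 (-1) end) = toE (vsh k v) by [].
by case: v => *; case: k => [|[|[|[|[|k]]]]]; rewrite /shift /toE /=; congr Elt; ring.
Qed.

Lemma e0E l v : exists2 k,
  firstmax (5 - k) (vA6 v) (vA5 v) (vA4 v) (vA3 v) (vA2 v) (vA1 v) &
  (k <= 5)%N /\ e0 l (toE v) = okopt l (vshV k v).
Proof.
have hk := first_argmaxP (vA6 v) (vA5 v) (vA4 v) (vA3 v) (vA2 v) (vA1 v).
exists (last_argmax (Aseq (toE v))).
  by rewrite AseqE /last_argmax /rev /= subKn//; move: hk => /andP[].
split; first by rewrite AseqE leq_subr.
rewrite /e0 /okopt -okvE /restrB; move: (last_argmax _) => k {hk}.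
suff <- : (match k with
   | 0 => shift (toE v) (-1) 0 0 0 0 0
   | 1 => shift (toE v) 0 0 (-1) (-1) 0 1
   | 2 => shift (toE v) 0 0 (-2) 0 1 0
   | 3 => shift (toE v) 0 (-1) 0 2 0 0
   | 4 => shift (toE v) (-1) 0 1 1 0 0
   | _ => shift (toE v) 0 0 0 0 0 1 end) = toE (vshV k v) by [].
by case: v => *; case: k => [|[|[|[|[|k]]]]]; rewrite /shift /toE /=; congr Elt; ring.
Qed.

Lemma f1E l v : exists2 k, (k < 3)%N && dom1 k v & f1 l (toE v) = okopt l (vsh1 k v).
Proof.
case: v => x1 x2 x3 w y2 y1; rewrite /f1 /pospart /=.
case: ifP => h1; [exists 0%N; first by rewrite /=; lia |
  case: ifP => h2; [exists 1%N; first by rewrite /=; lia |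
                   exists 2%N; first by rewrite /=; lia]];
  rewrite /restrB /okopt -okvE; set b := shift _ _ _ _ _ _ _; set b' := toE _;
  suff -> : b = b' by []; rewrite /b /b' /shift /toE /=; congr Elt; ring.
Qed.

Lemma e1E l v : exists2 k, (k < 3)%N && dom1V k v & e1 l (toE v) = okopt l (vsh1V k v).
Proof.
case: v => x1 x2 x3 w y2 y1; rewrite /e1 /pospart /=.
case: ifP => h1; [exists 2%N; first by rewrite /=; lia |
  case: ifP => h2; [exists 1%N; first by rewrite /=; lia |
                   exists 0%N; first by rewrite /=; lia]];
  rewrite /restrB /okopt -okvE; set b := shift _ _ _ _ _ _ _; set b' := toE _;
  suff -> : b = b' by []; rewrite /b /b' /shift /toE /=; congr Elt; ring.
Qed.

(** * Invariants and string lengths on B_l *)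

Definition min7 (a b c d e f g : int) : int :=
  Num.min a (Num.min b (Num.min c (Num.min d (Num.min e (Num.min f g))))).

Lemma le_min7 x a b c d e f g : (x <= min7 a b c d e f g) =
  [&& x <= a, x <= b, x <= c, x <= d, x <= e, x <= f & x <= g].
Proof. by rewrite /min7 !le_min. Qed.

Lemma max6_le x a b c d e f : (max6 a b c d e f <= x) =
  [&& a <= x, b <= x, c <= x, d <= x, e <= x & f <= x].
Proof. by rewrite /max6 !ge_max. Qed.

(* Constant on components: in that of bbar l i j0 j1 these are i + y0 + y1, i + 2 y0 + y1 and
   i + y0 + 2 y1, where ya = (l - i - ja) / 3. *)
Definition vP v : int := let: Vec x1 x2 x3 w y2 y1 := v in
  min7 (x1 + x2 + x3 + 2 * w) (x3 + w + y2 + y1) (x3 + y2 + y1) (x1 + x2 + y2)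
       (* Only six forms are involved; the last is repeated to fill [min7]. *)
       (x2 + y2 + y1) (x1 + x2 + x3 + w) (x1 + x2 + x3 + w).

Definition vQ0 v : int := let: Vec x1 x2 x3 w y2 y1 := v in
  min7 (x1 + x2 + 2 * x3 + 4 * w) (x3 + 2 * y2 + y1) (x1 + x2 + 2 * y2)
       (x2 + 2 * y2 + y1) (x1 + x2 + 2 * x3 + w) (x1 + 2 * x2 + x3 + w)
       (x2 + x3 + 2 * w + y2 + y1).

Definition vQ1 v : int := let: Vec x1 x2 x3 w y2 y1 := v in
  min7 (x1 + 2 * x2 + x3 + 2 * w) (x3 + w + 2 * y2 + y1) (x1 + 2 * x2 + y2)
       (2 * x2 + y2 + y1) (2 * x3 + y2 + y1) (x1 + x2 + x3 + y2)
       (2 * x3 + 3 * w + y2 + y1).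

(* s b for b = toE v *)
Definition vs v : int := let: Vec x1 x2 x3 w y2 y1 := v in
  x1 + x2 + x3 + w + y2 + y1.

(** phi_0 is l - s + max A, and A_6 is the weight phi_0 - eps_0. *)
Definition veps0 (l : nat) v : int := l%:Z - vs v + vmax v - vA6 v.
Definition vphi0 (l : nat) v : int := l%:Z - vs v + vmax v.

Definition veps1 v : int := let: Vec x1 x2 x3 w y2 y1 := v in
  y1 + pospart (x3 + 2 * w - y2 + pospart (x2 - x3)).
Definition vphi1 v : int := let: Vec x1 x2 x3 w y2 y1 := v in
  x1 + pospart (x3 - x2 + pospart (y2 - x3 - 2 * w)).

Notation fmax k v := (firstmax k (vA1 v) (vA2 v) (vA3 v) (vA4 v) (vA5 v) (vA6 v)).

(** Comparing lower bounds replaces an equation between nested minima by linear inequalities. *)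
Lemma eq_min7 (a b c d e f g a' b' c' d' e' f' g' : int) :
 (forall p, [&& p <= a, p <= b, p <= c, p <= d, p <= e, p <= f & p <= g] =
   [&& p <= a', p <= b', p <= c', p <= d', p <= e', p <= f' & p <= g']) ->
 min7 a b c d e f g = min7 a' b' c' d' e' f' g'.
Proof.
move=> h; set x := min7 _ _ _ _ _ _ _; set y := min7 _ _ _ _ _ _ _.
have hp p : (p <= x) = (p <= y) by rewrite !le_min7 h.
by apply/le_anti; rewrite -hp lexx hp lexx.
Qed.

Lemma vP_vsh k v : fmax k v -> vP (vsh k v) = vP v.
Proof.
case: v => x1 x2 x3 w y2 y1; rewrite /firstmax /vA1 /vP /=.
case: k => [|[|[|[|[|[|k]]]]]] //= h; apply: eq_min7 => p; apply/idP/idP; lia.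
Qed.

Lemma vQ0_vsh k v : fmax k v -> vQ0 (vsh k v) = vQ0 v.
Proof.
case: v => x1 x2 x3 w y2 y1; rewrite /firstmax /vA1 /vQ0 /=.
case: k => [|[|[|[|[|[|k]]]]]] //= h; apply: eq_min7 => p; apply/idP/idP; lia.
Qed.

Lemma vQ1_vsh k v : fmax k v -> vQ1 (vsh k v) = vQ1 v.
Proof.
case: v => x1 x2 x3 w y2 y1; rewrite /firstmax /vA1 /vQ1 /=.
case: k => [|[|[|[|[|[|k]]]]]] //= h; apply: eq_min7 => p; apply/idP/idP; lia.
Qed.

Lemma vP_vsh1 k v : (k < 3)%N && dom1 k v -> vP (vsh1 k v) = vP v.
Proof.
case: v => x1 x2 x3 w y2 y1; rewrite /vP /=.
case: k => [|[|[|k]]] //= h; apply: eq_min7 => p; apply/idP/idP; lia.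
Qed.

Lemma vQ0_vsh1 k v : (k < 3)%N && dom1 k v -> vQ0 (vsh1 k v) = vQ0 v.
Proof.
case: v => x1 x2 x3 w y2 y1; rewrite /vQ0 /=.
case: k => [|[|[|k]]] //= h; apply: eq_min7 => p; apply/idP/idP; lia.
Qed.

Lemma vQ1_vsh1 k v : (k < 3)%N && dom1 k v -> vQ1 (vsh1 k v) = vQ1 v.
Proof.
case: v => x1 x2 x3 w y2 y1; rewrite /vQ1 /=.
case: k => [|[|[|k]]] //= h; apply: eq_min7 => p; apply/idP/idP; lia.
Qed.

Lemma max6E x a b c d e f :
  [&& a <= x, b <= x, c <= x, d <= x, e <= x & f <= x] ->
  [|| a == x, b == x, c == x, d == x, e == x | f == x] ->
  max6 a b c d e f = x.
Proof.
move=> h1 h2; apply/le_anti; rewrite max6_le h1 /=.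
by move: h2; rewrite /max6 !le_max; lia.
Qed.

Lemma vmax_fmax k v : fmax k v ->
  vmax v = nth (vA1 v) [:: vA1 v; vA2 v; vA3 v; vA4 v; vA5 v; vA6 v] k.
Proof. by case: k => [|[|[|[|[|[|k]]]]]] //= h; apply: max6E; move: h; rewrite /firstmax /vA1 /=; lia. Qed.

(** The drops 0, 1, ..., 1, 2 match the changes 1, 0, ..., 0, -1 of s, so that phi_0 falls by 1 in
    every case. *)
Lemma vmax_vsh k v : fmax k v ->
  vmax (vsh k v) = vmax v - (if (k == 0)%N then 0 else if (k == 5)%N then 2 else 1).
Proof.
move=> h; rewrite (vmax_fmax h); move: h; case: v => x1 x2 x3 w y2 y1.
rewrite /firstmax /vA1 /=.
by case: k => [|[|[|[|[|[|k]]]]]] //= h; apply: max6E; rewrite /vA1 /=; lia.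
Qed.

Lemma vphi0_vsh l k v : fmax k v -> vphi0 l (vsh k v) = vphi0 l v - 1.
Proof.
move=> h; rewrite /vphi0 vmax_vsh//; move: h => /andP[]; move: (vmax v) => mx.
by case: v => x1 x2 x3 w y2 y1; case: k => [|[|[|[|[|[|k]]]]]] //= _ _; lia.
Qed.

Lemma vA6_vsh k v : fmax k v -> vA6 (vsh k v) = vA6 v - 2.
Proof.
case: v => x1 x2 x3 w y2 y1 /andP[].
by case: k => [|[|[|[|[|[|k]]]]]] //= _ _; lia.
Qed.

Lemma veps0_vsh l k v : fmax k v -> veps0 l (vsh k v) = veps0 l v + 1.
Proof.
move=> h; have := vphi0_vsh l h; rewrite /vphi0 /veps0 vA6_vsh//; lia.
Qed.

Lemma fmax_inv k v : (k <= 5)%N ->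
  firstmax (5 - k) (vA6 v) (vA5 v) (vA4 v) (vA3 v) (vA2 v) (vA1 v) ->
  fmax k (vshV k v).
Proof.
case: v => x1 x2 x3 w y2 y1.
by case: k => [|[|[|[|[|[|k]]]]]] //= _; rewrite /firstmax /vA1 /=; lia.
Qed.

Lemma vshK k v : vsh k (vshV k v) = v.
Proof.
by case: v => x1 x2 x3 w y2 y1; case: k => [|[|[|[|[|k]]]]] /=;
  rewrite ?addrK ?subrK.
Qed.

Lemma dom1_inv k v : (k < 3)%N && dom1V k v -> (k < 3)%N && dom1 k (vsh1V k v).
Proof.
by case: v => x1 x2 x3 w y2 y1; case: k => [|[|[|k]]] //=; lia.
Qed.

Lemma vsh1K k v : vsh1 k (vsh1V k v) = v.
Proof.
by case: v => x1 x2 x3 w y2 y1; case: k => [|[|k]] /=; rewrite ?addrK ?subrK.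
Qed.

Lemma veps1_vsh1 k v : (k < 3)%N && dom1 k v -> veps1 (vsh1 k v) = veps1 v + 1.
Proof.
case: v => x1 x2 x3 w y2 y1; rewrite /pospart; case: k => [|[|[|k]]] //=;
  rewrite /pospart; lia.
Qed.

Definition vz (v : vec) : int := let: Vec x1 x2 x3 w y2 y1 := v in y1 - x1 + w.

(** The difference of the two arguments of the maximum in [eps_sum]. It becomes d - a, whose sign
    selects the case of [ff1]. *)
Definition vD v : int := vQ0 v - vQ1 v + vz v.

Definition vwt1 v : int := let: Vec x1 x2 x3 w y2 y1 := v in
  x1 - y1 + y2 - 2 * w - x2.

Lemma vwt1E v : vphi1 v - veps1 v = vwt1 v.
Proof. by case: v => x1 x2 x3 w y2 y1; rewrite /= /pospart; lia. Qed.

Definition vlin (v : vec) : int :=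
  let: Vec x1 x2 x3 w y2 y1 := v in y1 - x1 + y2 - x2.

Lemma veps1_le t v : (veps1 v <= t) = let: Vec x1 x2 x3 w y2 y1 := v in
  [&& y1 <= t, y1 + (x3 + 2 * w - y2) <= t & y1 + (x3 + 2 * w - y2 + x2 - x3) <= t].
Proof.
by case: v => x1 x2 x3 w y2 y1; rewrite /veps1 /pospart; apply/idP/idP; lia.
Qed.

Lemma vmax_le t v : (vmax v <= t) = [&& vA1 v <= t, vA2 v <= t, vA3 v <= t,
  vA4 v <= t, vA5 v <= t & vA6 v <= t].
Proof. exact: max6_le. Qed.

Lemma vP_ge t v : (t <= vP v) = let: Vec x1 x2 x3 w y2 y1 := v in
  [&& t <= x1 + x2 + x3 + 2 * w, t <= x3 + w + y2 + y1, t <= x3 + y2 + y1,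
      t <= x1 + x2 + y2, t <= x2 + y2 + y1, t <= x1 + x2 + x3 + w
    & t <= x1 + x2 + x3 + w].
Proof. by case: v => *; apply: le_min7. Qed.

Lemma vQ0_ge t v : (t <= vQ0 v) = let: Vec x1 x2 x3 w y2 y1 := v in
  [&& t <= x1 + x2 + 2 * x3 + 4 * w, t <= x3 + 2 * y2 + y1, t <= x1 + x2 + 2 * y2,
      t <= x2 + 2 * y2 + y1, t <= x1 + x2 + 2 * x3 + w, t <= x1 + 2 * x2 + x3 + w
    & t <= x2 + x3 + 2 * w + y2 + y1].
Proof. by case: v => *; apply: le_min7. Qed.

Lemma vQ1_ge t v : (t <= vQ1 v) = let: Vec x1 x2 x3 w y2 y1 := v in
  [&& t <= x1 + 2 * x2 + x3 + 2 * w, t <= x3 + w + 2 * y2 + y1, t <= x1 + 2 * x2 + y2,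
      t <= 2 * x2 + y2 + y1, t <= 2 * x3 + y2 + y1, t <= x1 + x2 + x3 + y2
    & t <= 2 * x3 + 3 * w + y2 + y1].
Proof. by case: v => *; apply: le_min7. Qed.

(** The left side is eps_0 + eps_1 up to a linear form, hence a maximum of linear forms: the sums of
    one of the 3 terms of [veps1] and one of the 6 terms of [vmax]. Both inequalities are checked
    term by term. *)
Lemma eps_sum v : veps1 v + vmax v - vs v - vA6 v + vlin v
  = Num.max (- vQ0 v) (vz v - vQ1 v).
Proof.
apply/le_anti/andP; split.
  set t := Num.max _ _.
  have h0 : - t <= vQ0 v by rewrite /t; lia.
  have h1 : vz v - t <= vQ1 v by rewrite /t; lia.
  move: h0 h1; rewrite vQ0_ge vQ1_ge; move: t => t h0 h1.
  suff : veps1 v <= t + vs v + vA6 v - vlin v - vmax v by lia.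
  rewrite veps1_le.
  (* With each term x of [veps1] moved across, [vmax_le] splits the remaining maximum. *)
  suff h x : vmax v <= t + vs v + vA6 v - vlin v - x -> x <= t + vs v + vA6 v - vlin v - vmax v.
    case: v h0 h1 h => x1 x2 x3 w y2 y1 /= h0 h1 h.
    by do ?[apply/andP; split]; apply: h; rewrite vmax_le /vA1 /=; lia.
  lia.
have := lexx (vmax v); rewrite {1}vmax_le; move: (vmax v) => mx hm.
have := lexx (veps1 v); rewrite {1}veps1_le; move: (veps1 v) => e he.
rewrite ge_max; apply/andP; split.
  suff : - (e + mx - vs v - vA6 v + vlin v) <= vQ0 v by lia.
  by rewrite vQ0_ge; case: v hm he => x1 x2 x3 w y2 y1; rewrite /vA1 /=; lia.
suff : vz v - (e + mx - vs v - vA6 v + vlin v) <= vQ1 v by lia.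
by rewrite vQ1_ge; case: v hm he => x1 x2 x3 w y2 y1; rewrite /vA1 /=; lia.
Qed.

(** Under f_1 both [veps1] and [vz] grow by 1 while Q0 and Q1 stay, so by [eps_sum] the sign of [vD]
    decides whether eps_0 stays or drops. *)
Lemma veps0_vsh1 l k v : (k < 3)%N && dom1 k v ->
  veps0 l (vsh1 k v) = veps0 l v - (if 0 <= vD v then 0 else 1).
Proof.
move=> h; have := eps_sum (vsh1 k v); have := eps_sum v.
rewrite veps1_vsh1// vQ0_vsh1// vQ1_vsh1// /vD /veps0.
have -> : vz (vsh1 k v) = vz v + 1.
  by case: v h => x1 x2 x3 w y2 y1; case: k => [|[|[|k]]] //= _; ring.
have -> : vlin (vsh1 k v) = vlin v.
  by case: v h => x1 x2 x3 w y2 y1; case: k => [|[|[|k]]] //= _; ring.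
have -> : vs (vsh1 k v) = vs v.
  by case: v h => x1 x2 x3 w y2 y1; case: k => [|[|[|k]]] //= _; ring.
have -> : vA6 (vsh1 k v) = vA6 v + 1.
  by case: v h => x1 x2 x3 w y2 y1; case: k => [|[|[|k]]] //= _; ring.
case: ifP => hD; lia.
Qed.

(* The vertex of the model crystal corresponding to v. *)
Definition va l v : int := veps0 l v.
Definition vd l v : int := veps0 l v + vD v.
Definition vc (l : nat) v : int := l%:Z - vQ0 v - veps0 l v - vlin v.
Definition vm (l : nat) v : int := l%:Z + vQ1 v - 2 * vQ0 v.
Definition vn (l : nat) v : int := l%:Z + vQ0 v - 2 * vQ1 v.

Lemma veps1E l v : veps1 v = if va l v <= vd l v then vc l v + (vd l v - va l v) else vc l v.
Proof.
have := eps_sum v; rewrite /va /vd /vc /veps0 /vD; case: ifP => h; lia.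
Qed.

Lemma veps0_ge0 l v : okv l v -> 0 <= veps0 l v.
Proof.
move=> h; suff : vA6 v <= vmax v.
  by rewrite /veps0; case: v h => x1 x2 x3 w y2 y1 /=; lia.
by have := lexx (vmax v); rewrite {1}vmax_le; lia.
Qed.

Lemma vphi0_ge0 l v : okv l v -> 0 <= vphi0 l v.
Proof.
move=> h; suff : vA1 v <= vmax v.
  by rewrite /vphi0 /vA1; case: v h => x1 x2 x3 w y2 y1 /=; lia.
by have := lexx (vmax v); rewrite {1}vmax_le; lia.
Qed.

Lemma vphi0E l v : vphi0 l v = rr (vm l v) (vc l v) (vd l v) - va l v.
Proof.
rewrite /vphi0 /rr /vm /vc /vd /va /veps0 /vD.
by case: v => x1 x2 x3 w y2 y1 /=; ring.
Qed.

(** This and the next three bounds compare the terms of the maximum [vmax] with those of the minima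
    Q0 and Q1, which leaves linear inequalities. *)
Lemma vc_ge0 l v : okv l v -> 0 <= vc l v.
Proof.
move=> h; suff : vmax v <= vs v + vA6 v - vlin v - vQ0 v by rewrite /vc /veps0; lia.
have := lexx (vQ0 v); rewrite {1}vQ0_ge vmax_le; move: (vQ0 v) => Q.
by case: v h => x1 x2 x3 w y2 y1; rewrite /vA1 /=; lia.
Qed.

Lemma vc_le l v : okv l v -> vc l v <= vm l v.
Proof.
move=> h; suff : vQ0 v - veps0 l v - vlin v <= vQ1 v by rewrite /vc /vm; lia.
have := lexx (vQ0 v); rewrite {1}vQ0_ge vQ1_ge /veps0; move: (vQ0 v) => Q.
have := lexx (vmax v); rewrite {1}vmax_le; move: (vmax v) => mx.
by case: v h => x1 x2 x3 w y2 y1; rewrite /vA1 /=; lia.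
Qed.

Lemma vd_ge0 l v : okv l v -> 0 <= vd l v.
Proof.
move=> h; suff : vQ1 v - veps0 l v - vz v <= vQ0 v by rewrite /vd /vD; lia.
have := lexx (vQ1 v); rewrite {1}vQ1_ge vQ0_ge /veps0; move: (vQ1 v) => Q.
have := lexx (vmax v); rewrite {1}vmax_le; move: (vmax v) => mx.
by case: v h => x1 x2 x3 w y2 y1; rewrite /vA1 /=; lia.
Qed.

Lemma vd_le l v : okv l v -> vd l v <= vn l v.
Proof.
move=> h; suff : vmax v <= vs v + vA6 v - vz v - vQ1 v.
  by rewrite /vd /vn /vD /veps0; lia.
have := lexx (vQ1 v); rewrite {1}vQ1_ge vmax_le; move: (vQ1 v) => Q.
by case: v h => x1 x2 x3 w y2 y1; rewrite /vA1 /=; lia.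
Qed.

Lemma v_rng l v : okv l v -> rng (vm l v) (vn l v) (va l v) (vc l v) (vd l v).
Proof.
move=> h; have := vphi0_ge0 h; rewrite vphi0E /rng.
have := veps0_ge0 h; have := vc_ge0 h; have := vc_le h; have := vd_ge0 h.
by have := vd_le h; rewrite /va; lia.
Qed.


(** The image of f_0 leaves B_l exactly at the end of its string. Replacing [vmax] by the selected
    entry makes phi_0 linear in each case. *)
Lemma okv_vsh l k v : okv l v -> fmax k v -> okv l (vsh k v) = (1 <= vphi0 l v).
Proof.
move=> h hk; rewrite /vphi0 (vmax_fmax hk); move: h hk.
case: v => x1 x2 x3 w y2 y1; rewrite /firstmax /vA1 /=.
by case: k => [|[|[|[|[|[|k]]]]]] //= h hk; apply/idP/idP; lia.
Qed.

Lemma okv_vshV l k v : okv l v -> (k <= 5)%N ->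
  firstmax (5 - k) (vA6 v) (vA5 v) (vA4 v) (vA3 v) (vA2 v) (vA1 v) ->
  okv l (vshV k v) = (1 <= veps0 l v).
Proof.
move=> h k5 hk; have := vphi0_vsh l (fmax_inv k5 hk); have := vA6_vsh (fmax_inv k5 hk).
have hm := vmax_fmax (fmax_inv k5 hk); rewrite vshK /veps0 /vphi0 hm.
move: h k5 hk {hm}; case: v => x1 x2 x3 w y2 y1; rewrite /firstmax /vA1.
by case: k => [|[|[|[|[|[|k]]]]]] //= h _ hk h1 h2; apply/idP/idP; lia.
Qed.

Lemma okv_vsh1 l k v : okv l v -> (k < 3)%N && dom1 k v ->
  okv l (vsh1 k v) = (1 <= vphi1 v).
Proof.
case: v => x1 x2 x3 w y2 y1; rewrite /vphi1 /pospart.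
by case: k => [|[|[|k]]] //= h hk; apply/idP/idP; lia.
Qed.

Lemma okv_vsh1V l k v : okv l v -> (k < 3)%N && dom1V k v ->
  okv l (vsh1V k v) = (1 <= veps1 v).
Proof.
case: v => x1 x2 x3 w y2 y1; rewrite /veps1 /pospart.
by case: k => [|[|[|k]]] //= h hk; apply/idP/idP; lia.
Qed.

Definition vinv v : int * int * int := (vP v, vQ0 v, vQ1 v).

Definition vPhi l v : int * int * int := (va l v, vc l v, vd l v).

Lemma vinv_vsh k v : fmax k v -> vinv (vsh k v) = vinv v.
Proof. by move=> h; rewrite /vinv vP_vsh// vQ0_vsh// vQ1_vsh. Qed.

Lemma vinv_vsh1 k v : (k < 3)%N && dom1 k v -> vinv (vsh1 k v) = vinv v.
Proof. by move=> h; rewrite /vinv vP_vsh1// vQ0_vsh1// vQ1_vsh1. Qed.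

Lemma vPhi_vsh l k v : fmax k v ->
  vPhi l (vsh k v) = (va l v + 1, vc l v, vd l v).
Proof.
move=> h; rewrite /vPhi /va /vc /vd /vD veps0_vsh// vQ0_vsh// vQ1_vsh//.
have -> : vlin (vsh k v) = vlin v - 1.
  by case: v h => x1 x2 x3 w y2 y1; case: k => [|[|[|[|[|[|k]]]]]] //= _; ring.
have -> : vz (vsh k v) = vz v - 1.
  by case: v h => x1 x2 x3 w y2 y1; case: k => [|[|[|[|[|[|k]]]]]] //= _; ring.
by congr (_, _, _); ring.
Qed.

Lemma vPhi_vsh1 l k v : (k < 3)%N && dom1 k v ->
  vPhi l (vsh1 k v) = ff1 (va l v) (vc l v) (vd l v).
Proof.
move=> h; rewrite /vPhi /va /vc /vd /vD veps0_vsh1// vQ0_vsh1// vQ1_vsh1//.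
have -> : vlin (vsh1 k v) = vlin v.
  by case: v h => x1 x2 x3 w y2 y1; case: k => [|[|[|k]]] //= _; ring.
have -> : vz (vsh1 k v) = vz v + 1.
  by case: v h => x1 x2 x3 w y2 y1; case: k => [|[|[|k]]] //= _; ring.
rewrite /ff1 /vD; case: ifP => h1; case: ifP => h2; try lia;
  by congr (_, _, _); ring.
Qed.

Lemma ff1K a c d : let: (a', c', d') := ff1 a c d in ee1 a' c' d' = (a, c, d).
Proof.
rewrite /ff1; case: ifP => h; rewrite /ee1; case: ifP => h'; try lia;
  by congr (_, _, _); ring.
Qed.

Lemma vwt1_model l v : vwt1 v = vn l v + va l v - vc l v - 2 * vd l v.
Proof. by rewrite /vn /va /vc /vd /vD; case: v => x1 x2 x3 w y2 y1 /=; ring. Qed.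

Lemma vphi1E l v : vphi1 v =
  if va l v <= vd l v then vn l v - vd l v else vn l v + va l v - 2 * vd l v.
Proof.
have := vwt1E v; rewrite (vwt1_model l) (veps1E l).
by case: ifP => _ h; lia.
Qed.

(** * B_l and the model crystal have the same operators *)

Section Operators.
Variables (l m n : nat) (v : vec).
Hypotheses (hv : okv l v) (hm : vm l v = m) (hn : vn l v = n).

Lemma rngt_vPhi : rngt m n (vPhi l v).
Proof. by have := v_rng hv; rewrite hm hn. Qed.

Lemma f_model a : match mf m n a (vPhi l v) with
  | Some t => exists v', [/\ fB l a (toE v) = Some (toE v'), okv l v',
                            vinv v' = vinv v & vPhi l v' = t]
  | None => fB l a (toE v) = None end.
Proof.
have := rngt_vPhi; rewrite /rngt /rng /vPhi /= => hr.
case: (ord2P a) => ->; rewrite /fB /=.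
  have [k hk ->] := f0E l v; rewrite /okopt okv_vsh// vphi0E hm /mf /=.
  case: ifP => h1; last by rewrite ifF//; move: h1 hr; rewrite /rngt /rng /=; lia.
  rewrite ifT; last by move: h1 hr; rewrite /rngt /rng /=; lia.
  exists (vsh k v); rewrite vinv_vsh// -/(vPhi l (vsh k v)) vPhi_vsh// okv_vsh// vphi0E hm; split=> //.
  by move: h1 hr; rewrite /rngt /rng /=; lia.
have [k hk ->] := f1E l v; rewrite /okopt okv_vsh1// (vphi1E l) hn mf1E.
case: ifP => h1; last first.
  rewrite ifF//; move: h1 hr; rewrite /rngt /rng /rr /ff1.
  by case: ifP => /= h2; lia.
have h1' : 1 <= (if va l v <= vd l v then Posz n - vd l v else Posz n + va l v - 2 * vd l v).
  move: h1 hr; rewrite /rngt /rng /rr /ff1; case: ifP => /= h2; lia.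
rewrite h1'; exists (vsh1 k v).
by rewrite vinv_vsh1// -/(vPhi l (vsh1 k v)) vPhi_vsh1// okv_vsh1// (vphi1E l) hn.
Qed.

Lemma e_model a : match me m n a (vPhi l v) with
  | Some t => exists v', [/\ eB l a (toE v) = Some (toE v'), okv l v',
                            vinv v' = vinv v & vPhi l v' = t]
  | None => eB l a (toE v) = None end.
Proof.
have := rngt_vPhi; rewrite /rngt /rng /vPhi /= => hr.
case: (ord2P a) => ->; rewrite /eB /=.
  have [k hk [k5 ->]] := e0E l v; rewrite /okopt (okv_vshV hv)// -/(va l v) /me /=.
  case: ifP => h1; last by rewrite ifF//; move: h1 hr; rewrite /rngt /rng /=; lia.
  rewrite ifT; last by move: h1 hr; rewrite /rngt /rng /=; lia.
  have hk' := fmax_inv k5 hk; exists (vshV k v).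
  have := vinv_vsh hk'; have := vPhi_vsh l hk'; rewrite vshK => -[e1 e2 e3] <-.
  rewrite /vPhi (okv_vshV hv)//; split=> //.
    by move: h1 hr; rewrite /rngt /rng /= -/(va l v); lia.
  by rewrite e1 e2 e3 addrK.
have [k hk ->] := e1E l v; rewrite /okopt (okv_vsh1V hv)// (veps1E l) me1E.
case: ifP => h1; last first.
  rewrite ifF//; move: h1 hr; rewrite /rngt /rng /rr /ee1.
  by case: ifP => /= h2; case: ifP => h3; lia.
have h1' : 1 <= (if va l v <= vd l v then vc l v + (vd l v - va l v) else vc l v).
  by move: h1 hr; rewrite /rngt /rng /rr /ee1; case: ifP => /= h2; case: ifP => h3; lia.
have hk' := dom1_inv hk; rewrite h1'; exists (vsh1V k v).
have := vinv_vsh1 hk'; have := vPhi_vsh1 l hk'; rewrite vsh1K => e <-.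
rewrite (okv_vsh1V hv)// (veps1E l); split=> //.
have := ff1K (va l (vsh1V k v)) (vc l (vsh1V k v)) (vd l (vsh1V k v)).
by rewrite -e /vPhi => ->.
Qed.

End Operators.

Lemma firstmax_inj k k' a0 a1 a2 a3 a4 a5 : firstmax k a0 a1 a2 a3 a4 a5 ->
  firstmax k' a0 a1 a2 a3 a4 a5 -> k = k'.
Proof.
rewrite /firstmax; case: k => [|[|[|[|[|[|k]]]]]] //=;
  by case: k' => [|[|[|[|[|[|k']]]]]] //=; lia.
Qed.

Lemma dom1_inj k k' v : (k < 3)%N && dom1 k v -> (k' < 3)%N && dom1 k' v -> k = k'.
Proof.
by case: v => x1 x2 x3 w y2 y1; case: k => [|[|[|k]]] //=;
  case: k' => [|[|[|k']]] //=; lia.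
Qed.

Lemma okoptP l v b : okopt l v = Some b -> okv l v /\ b = toE v.
Proof. by rewrite /okopt; case: ifP => // h [<-]. Qed.

Lemma fB_eB l a v b : okv l v -> eB l a (toE v) = Some b -> fB l a b = Some (toE v).
Proof.
move=> hv; rewrite /eB /fB; case: ifP => _.
  have [k hk [k5 ->]] := e0E l v => /okoptP[_ ->].
  have hk' := fmax_inv k5 hk; have [k' h ->] := f0E l (vshV k v).
  by rewrite -(firstmax_inj hk' h) vshK /okopt hv.
have [k hk ->] := e1E l v => /okoptP[_ ->].
have hk' := dom1_inv hk; have [k' h ->] := f1E l (vsh1V k v).
by rewrite -(dom1_inj hk' h) vsh1K /okopt hv.
Qed.

Lemma me_mf m n a x y : rngt m n x -> mf m n a x = Some y -> me m n a y = Some x.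
Proof.
move=> hx; rewrite /mf /me; case: ifP => // _ [<-]; case: x hx => [[a' c] d] hx.
case: eqP => _ /=; first by rewrite addrK hx.
have := ff1K a' c d; case: (ff1 _ _ _) => [[a1 c1] d1] /= ->.
by rewrite hx.
Qed.

(** * Vertices of B_l over (0, 0, 0) *)

Definition vbar (l : nat) (i y0 y1 : int) : vec :=
  if y1 <= y0 then Vec 0 y1 (3 * y0 + i - 2 * y1) (y1 - y0) (Posz l - i - 2 * y0) 0
  else Vec 0 y0 (y0 + i) (y1 - y0) (Posz l - i - y0 - y1) 0.

Lemma vPE t v : (t <= vP v) -> (let: Vec x1 x2 x3 w y2 y1 := v in
  [|| t == x1 + x2 + x3 + 2 * w, t == x3 + w + y2 + y1, t == x3 + y2 + y1,
      t == x1 + x2 + y2, t == x2 + y2 + y1 | t == x1 + x2 + x3 + w]) -> vP v = t.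
Proof.
move=> h1 h2; apply/le_anti; rewrite h1 andbT; have := lexx (vP v).
by rewrite {1}vP_ge; case: v h1 h2 => x1 x2 x3 w y2 y1 _; lia.
Qed.

Lemma vQ0E t v : (t <= vQ0 v) -> (let: Vec x1 x2 x3 w y2 y1 := v in
  [|| t == x1 + x2 + 2 * x3 + 4 * w, t == x3 + 2 * y2 + y1, t == x1 + x2 + 2 * y2,
      t == x2 + 2 * y2 + y1, t == x1 + x2 + 2 * x3 + w, t == x1 + 2 * x2 + x3 + w
    | t == x2 + x3 + 2 * w + y2 + y1]) -> vQ0 v = t.
Proof.
move=> h1 h2; apply/le_anti; rewrite h1 andbT; have := lexx (vQ0 v).
by rewrite {1}vQ0_ge; case: v h1 h2 => x1 x2 x3 w y2 y1 _; lia.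
Qed.

Lemma vQ1E t v : (t <= vQ1 v) -> (let: Vec x1 x2 x3 w y2 y1 := v in
  [|| t == x1 + 2 * x2 + x3 + 2 * w, t == x3 + w + 2 * y2 + y1, t == x1 + 2 * x2 + y2,
      t == 2 * x2 + y2 + y1, t == 2 * x3 + y2 + y1, t == x1 + x2 + x3 + y2
    | t == 2 * x3 + 3 * w + y2 + y1]) -> vQ1 v = t.
Proof.
move=> h1 h2; apply/le_anti; rewrite h1 andbT; have := lexx (vQ1 v).
by rewrite {1}vQ1_ge; case: v h1 h2 => x1 x2 x3 w y2 y1 _; lia.
Qed.

Section HighestWeight.
Variables (l : nat) (i y0 y1 : int).
Hypotheses (hi : 0 <= i) (h0 : 0 <= y0) (h1 : 0 <= y1).
Hypotheses (hl0 : 2 * i + 3 * y0 <= l) (hl1 : 2 * i + 3 * y1 <= l).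

Lemma okv_vbar : okv l (vbar l i y0 y1).
Proof. by rewrite /vbar; case: ifP => h /=; lia. Qed.

Lemma vinv_vbar : vinv (vbar l i y0 y1) = (i + y0 + y1, i + 2 * y0 + y1, i + y0 + 2 * y1).
Proof.
rewrite /vbar; case: ifP => h; congr (_, _, _);
  by [apply: vPE; rewrite ?vP_ge; lia | apply: vQ0E; rewrite ?vQ0_ge; lia
     | apply: vQ1E; rewrite ?vQ1_ge; lia].
Qed.

Lemma vPhi_vbar : vPhi l (vbar l i y0 y1) = (0, 0, 0).
Proof.
have [_ hQ0 hQ1] := vinv_vbar.
have hmx : vmax (vbar l i y0 y1) = vA6 (vbar l i y0 y1).
  by rewrite /vbar; case: ifP => h; apply: max6E; rewrite /vA1 /=; lia.
rewrite /vPhi /va /vc /vd /vD /veps0 hQ0 hQ1 hmx /vbar.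
by case: ifP => h /=; congr (_, _, _); ring.
Qed.

End HighestWeight.

Lemma vbar_of_vPhi l v : okv l v -> vPhi l v = (0, 0, 0) ->
  exists i y0 y1 : nat, [/\ (2 * i + 3 * y0 <= l)%N, (2 * i + 3 * y1 <= l)%N
    & v = vbar l i y0 y1].
Proof.
(* Over (0, 0, 0) both eps_0 and eps_1 vanish; these two conditions drive the computation. *)
move=> hv [ha hc hd]; have := veps1E l v; rewrite ha hc hd lexx => he1.
have := lexx (veps1 v); rewrite {1}veps1_le he1; move: ha hv {hc hd he1}.
have := lexx (vmax v); rewrite {1}vmax_le /va /veps0; move: (vmax v) => mx.
case: v => x1 x2 x3 w y2 y1 /=; rewrite /vA1 => hm ha hv he.
(* In both cases of [vbar] one has w = y1 - y0, so the sign of w tells the case; the witnesses solve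
   its coordinates for i, y0, y1. *)
case: (lerP w 0) => hw.
  exists (absz (x3 + 3 * w - x2)%R), (absz (x2 - w)%R), (absz x2); split; try lia.
  by rewrite /vbar ifT; [congr Vec; lia | lia].
exists (absz (x3 - x2)%R), (absz x2), (absz (x2 + w)%R); split; try lia.
by rewrite /vbar ifF; [congr Vec; lia | lia].
Qed.

Lemma vm_vn_nat l v : okv l v -> exists m n : nat, vm l v = m /\ vn l v = n.
Proof.
move=> /v_rng; rewrite /rng => h.
by exists (absz (vm l v)), (absz (vn l v)); split; lia.
Qed.

Lemma vm_vinv l v v' : vinv v' = vinv v -> vm l v' = vm l v.
Proof. by move=> [_ e0 e1]; rewrite /vm e0 e1. Qed.

Lemma vn_vinv l v v' : vinv v' = vinv v -> vn l v' = vn l v.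
Proof. by move=> [_ e0 e1]; rewrite /vn e0 e1. Qed.

Lemma fB_okv l a v b : okv l v -> fB l a (toE v) = Some b ->
  exists v', [/\ b = toE v', okv l v' & vinv v' = vinv v].
Proof.
move=> hv; have [m [n [hm hn]]] := vm_vn_nat hv; have := f_model hv hm hn a.
case: mf => [t [v' [-> ok' iv _]] [<-]|-> //]; by exists v'.
Qed.

Lemma eB_okv l a v b : okv l v -> eB l a (toE v) = Some b ->
  exists v', [/\ b = toE v', okv l v' & vinv v' = vinv v].
Proof.
move=> hv; have [m [n [hm hn]]] := vm_vn_nat hv; have := e_model hv hm hn a.
case: me => [t [v' [-> ok' iv _]] [<-]|-> //]; by exists v'.
Qed.

(** * Components and their invariants *)

Definition okI l iv b := exists v, [/\ b = toE v, okv l v & vinv v = iv].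

Lemma step_okI l iv b b' : step l b b' -> okI l iv b <-> okI l iv b'.
Proof.
move=> [hb [a hs]]; have [v e] := toE_onto hb; subst b; rewrite /Bl /= okvE in hb.
have {}hs : exists v', [/\ b' = toE v', okv l v' & vinv v' = vinv v].
  by case: hs; [apply: eB_okv | apply: fB_okv].
have [v' [-> ok' iv']] := hs; split=> -[w [/toE_inj <- _ <-]].
  by exists v'.
by exists v.
Qed.

Lemma connected_okI l iv b b' : clos_refl_sym_trans elt (step l) b b' ->
  okI l iv b <-> okI l iv b'.
Proof.
elim=> [x y /step_okI|x|x y _ [h h']|x y z _ [h1 h2] _ [h3 h4]] //; split; auto.
Qed.

(** The path from (0, 0, 0) to the image of v in the model is lifted backwards by the raising
    operators, which keep the invariants. *)
Lemma connected_vbar l v : okv l v -> exists v', [/\ okv l v', vinv v' = vinv v,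
  vPhi l v' = (0, 0, 0) & clos_refl_sym_trans elt (step l) (toE v') (toE v)].
Proof.
move=> hv; have [m [n [hm hn]]] := vm_vn_nat hv.
have := rngt_vPhi hv hm hn; move e: (vPhi l v) => x hx.
elim/(@model_ind m n): x / hx v hv hm hn e => [|a x y hx IH hxy] v hv hm hn e.
  by exists v; split=> //; apply: rst_refl.
have := e_model hv hm hn a; rewrite e (me_mf hx hxy) => -[v' [e1 ok' iv e2]].
have hm' : vm l v' = m by rewrite (vm_vinv _ iv).
have hn' : vn l v' = n by rewrite (vn_vinv _ iv).
have [v0 [ok0 iv0 ph0 hc]] := IH v' ok' hm' hn' e2.
exists v0; rewrite iv0; split=> //; apply: rst_trans hc _; apply: rst_sym.
by apply: rst_step; split; [rewrite /Bl /= okvE | exists a; left].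
Qed.

Definition tinv (l : nat) (t : nat * nat * nat) : int * int * int :=
  let: (i, j0, j1) := t in let y0 := yidx l i j0 in let y1 := yidx l i j1 in
  (Posz i + y0 + y1, Posz i + 2 * y0 + y1, Posz i + y0 + 2 * y1).

Lemma comp_indexP l i j0 j1 : comp_index l (i, j0, j1) <->
  exists y0 y1 : nat, [/\ (2 * i + 3 * y0 <= l)%N, (2 * i + 3 * y1 <= l)%N,
    (l = i + j0 + 3 * y0)%N & (l = i + j1 + 3 * y1)%N].
Proof.
split=> [[h1 h2 h3 h4 h5]|[y0 [y1 [h1 h2 h3 h4]]]]; last by split; lia.
by exists ((l - i - j0) %/ 3)%N, ((l - i - j1) %/ 3)%N; split; lia.
Qed.

(** Since j_a = l - i - 3 y_a, the condition j0 <= j1 is y1 <= y0. *)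
Lemma bbarE l i j0 j1 : comp_index l (i, j0, j1) ->
  bbar l i j0 j1 = toE (vbar l i (yidx l i j0) (yidx l i j1)).
Proof.
move=> /comp_indexP[y0 [y1 [h1 h2 h3 h4]]]; rewrite /bbar /vbar.
have -> : yidx l i j0 = y0 by rewrite /yidx; lia.
have -> : yidx l i j1 = y1 by rewrite /yidx; lia.
by case: ifP => h; case: ifP => h'; try lia; rewrite /toE /=; congr Elt; lia.
Qed.

Lemma bbar_props l i j0 j1 : comp_index l (i, j0, j1) ->
  exists v, [/\ bbar l i j0 j1 = toE v, okv l v, vinv v = tinv l (i, j0, j1)
    & vPhi l v = (0, 0, 0)].
Proof.
move=> h; rewrite bbarE//; exists (vbar l i (yidx l i j0) (yidx l i j1)).
have [y0 [y1 [h1 h2 h3 h4]]] := (comp_indexP _ _ _ _).1 h.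
rewrite /tinv; have -> : yidx l i j0 = y0 by rewrite /yidx; lia.
have -> : yidx l i j1 = y1 by rewrite /yidx; lia.
by split=> //; [apply: okv_vbar | apply: vinv_vbar | apply: vPhi_vbar]; lia.
Qed.

(** Q0 - P = y0 and Q1 - P = y1, then P gives i, and l gives j0 and j1. *)
Lemma tinv_inj l t t' : comp_index l t -> comp_index l t' -> tinv l t = tinv l t' ->
  t = t'.
Proof.
case: t t' => [[i j0] j1] [[i' j0'] j1'] /comp_indexP[y0 [y1 [h1 h2 h3 h4]]].
move=> /comp_indexP[y0' [y1' [h1' h2' h3' h4']]]; rewrite /tinv /yidx => -[e1 e2 e3].
by congr (_, _, _); lia.
Qed.

Lemma hw_index l v : okv l v -> vPhi l v = (0, 0, 0) ->
  exists2 t, comp_index l t & vinv v = tinv l t.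
Proof.
move=> ok h; have [i [y0 [y1 [h1 h2 ->]]]] := vbar_of_vPhi ok h.
exists (i, l - i - 3 * y0, l - i - 3 * y1)%N.
  by apply/comp_indexP; exists y0, y1; split; lia.
rewrite vinv_vbar; try lia; rewrite /tinv.
have -> : yidx l i (l - i - 3 * y0) = y0 by rewrite /yidx; lia.
by have -> : yidx l i (l - i - 3 * y1) = y1 by rewrite /yidx; lia.
Qed.

Lemma hw_inj l v v' : okv l v -> okv l v' -> vPhi l v = (0, 0, 0) ->
  vPhi l v' = (0, 0, 0) -> vinv v = vinv v' -> v = v'.
Proof.
move=> ok ok' h h'; have [i [y0 [y1 [h1 h2 ->]]]] := vbar_of_vPhi ok h.
have [i' [y0' [y1' [h1' h2' ->]]]] := vbar_of_vPhi ok' h'.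
rewrite !vinv_vbar; try lia; move=> [e1 e2 e3]; congr vbar; lia.
Qed.

(** Arrows keep the invariants. Conversely, a vertex with the invariants of t is raised to a vertex
    over (0, 0, 0), which must be bbar by [hw_inj]. *)
Lemma componentE l t : comp_index l t -> component l t = [set b | okI l (tinv l t) b].
Proof.
case: t => [[i j0] j1] ht; have [v0 [e0 ok0 iv0 ph0]] := bbar_props ht.
apply/seteqP; split=> b /= [].
  by rewrite e0 => _ hc; apply/(connected_okI _ hc); exists v0.
move=> v [-> ok iv]; rewrite /Bl /= okvE; split=> //.
have [v' [ok' iv' ph' hc]] := connected_vbar ok.
by rewrite e0 (hw_inj ok0 ok' ph0 ph') // iv0 iv' iv.
Qed.

Lemma Bl_components l : Bl l = \bigcup_(t in comp_index l) component l t.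
Proof.
apply/seteqP; split=> b /=.
  move=> hb; have [v e] := toE_onto hb; subst b; rewrite /Bl /= okvE in hb.
  have [v' [ok' iv' ph' _]] := connected_vbar hb; have [t ht e] := hw_index ok' ph'.
  by exists t => //; rewrite componentE//; exists v; rewrite -iv' e.
by move=> [[[i j0] j1] _ []].
Qed.

Lemma trivIset_component l : trivIset (comp_index l) (component l).
Proof.
move=> t t' ht ht' [b []]; rewrite !componentE// => -[v [-> _ iv]] [v' [/toE_inj <- _ iv']].
by apply: (tinv_inj ht ht'); rewrite -iv iv'.
Qed.

(** Two vertices with the same image are raised in parallel until [hw_inj] applies; [fB_eB] brings
    the equality back down. *)
Lemma vPhi_inj l v v' : okv l v -> okv l v' -> vinv v = vinv v' ->
  vPhi l v = vPhi l v' -> v = v'.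
Proof.
move=> hv; have [m [n [hm hn]]] := vm_vn_nat hv.
have := rngt_vPhi hv hm hn; move e: (vPhi l v) => x hx.
elim/(@model_ind m n): x / hx v v' hv hm hn e => [|a x y hx IH hxy] v v' hv hm hn e hv' iv ph.
  by apply: (hw_inj hv hv') => //; rewrite -ph.
have hm' : vm l v' = m by rewrite -(vm_vinv l iv).
have hn' : vn l v' = n by rewrite -(vn_vinv l iv).
have := e_model hv hm hn a; rewrite e (me_mf hx hxy) => -[w [e1 ok1 iv1 ph1]].
have := e_model hv' hm' hn' a; rewrite -ph (me_mf hx hxy) => -[w' [e2 ok2 iv2 ph2]].
have ew : w = w'.
  apply: IH => //; rewrite ?(vm_vinv _ iv1) ?(vn_vinv _ iv1) ?ph1 ?ph2 //.
  by rewrite iv1 iv2.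
apply: toE_inj; have := fB_eB hv e1; rewrite ew (fB_eB hv' e2).
by move=> /Some_inj.
Qed.

(** * Isomorphism of a component with the model, including weights *)

Lemma crystal_isomorphic_trans A B C :
  crystal_isomorphic A B -> crystal_isomorphic B C -> crystal_isomorphic A C.
Proof.
move=> [f [f0 [ff fi fs] fe ff' fw]] [g [g0 [gf gi gs] ge gf' gw]].
exists (g \o f); split=> /=; first by rewrite f0.
- split=> [b /ff/gf//|b b' hb hb' /= e|c /gs[b /fs[a ha <-] <-]]; last by exists a.
  by apply: fi => //; apply: gi => //; rewrite inE; apply: ff; rewrite -inE.
- by move=> a b hb; rewrite fe// ge//; apply: ff.
- by move=> a b hb; rewrite ff'// gf'//; apply: ff.
- by move=> b mu hb; rewrite fw// gw//; apply: ff.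
Qed.

(** [meps] and [mphi] are the string lengths of the model in closed form; they carry the weights,
    which B_l defines through its own string lengths. *)
Definition meps (a : 'I_2) (x : int * int * int) : int :=
  if a == ord0 then x.1.1 else eps1 x.1.1 x.1.2 x.2.

Definition mphi (m n : nat) (a : 'I_2) (x : int * int * int) : int :=
  if a == ord0 then rr m x.1.2 x.2 - x.1.1
  else if x.1.1 <= x.2 then Posz n - x.2 else Posz n + x.1.1 - 2 * x.2.

Lemma mwtE m n x a : mwt m n x a = mphi m n a x - meps a x.
Proof.
case: x => [[a' c] d]; rewrite /mwt /mphi /meps /wt0 /wt1 /eps1.
by case: ifP => _ /=; [ring | case: ifP => _; ring].
Qed.

Lemma meps_me m n a x : rngt m n x ->
  if me m n a x is Some y then meps a y = meps a x - 1 else meps a x = 0.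
Proof.
case: x => [[a' c] d]; rewrite /me /meps; case: (ord2P a) => -> /=.
  by case: ifP; rewrite /rngt /rng /=; lia.
rewrite /ee1 /eps1 /rngt /rng /rr.
by case: (ifP (a' < d)) => h /=; case: ifP => /= h1; do ?[case: ifP => /= ?]; lia.
Qed.

Lemma mphi_mf m n a x : rngt m n x ->
  if mf m n a x is Some y then mphi m n a y = mphi m n a x - 1 else mphi m n a x = 0.
Proof.
case: x => [[a' c] d]; rewrite /mf /mphi; case: (ord2P a) => -> /=.
  by case: ifP; rewrite /rngt /rng /rr /=; lia.
rewrite /ff1 /rngt /rng /rr.
by case: (ifP (a' <= d)) => h /=; case: ifP => /= h1; do ?[case: ifP => /= ?]; lia.
Qed.

Lemma meps_ge0 m n a x : rngt m n x -> 0 <= meps a x.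
Proof.
case: x => [[a' c] d]; rewrite /meps /eps1 /rngt /rng /=.
by case: ifP => _; [lia | case: ifP => h; lia].
Qed.

Lemma mphi_ge0 m n a x : rngt m n x -> 0 <= mphi m n a x.
Proof.
case: x => [[a' c] d]; rewrite /mphi /rngt /rng /=.
by case: ifP => _; [lia | case: ifP => h; lia].
Qed.

(** A function that falls by 1 along the operator and is 0 where the operator stops is the string
    length; [R] carries it over from the model. *)
Lemma string_length_transfer (T : Type) (R : elt -> T -> Prop) (g : elt -> option elt)
    (g' : T -> option T) (h : T -> int) :
  (forall b x, R b x -> 0 <= h x) ->
  (forall b x, R b x -> if g' x is Some y then h y = h x - 1 /\
     exists2 b', g b = Some b' & R b' y else h x = 0 /\ g b = None) ->
  forall b x, R b x -> exists2 k : nat, string_length g b k & h x = k.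
Proof.
move=> h0 hg b x hR; have := h0 _ _ hR; case e: (h x) => [k|//] _.
exists k => //; elim: k b x hR e => [|k IH] b x hR e.
  split=> //=; have := hg _ _ hR; case: (g' x) => [y [hy [b' _ /h0]]|[]//].
  by rewrite hy e.
have := hg _ _ hR; case: (g' x) => [y [hy [b' hb' hR']]|[]]; last by rewrite e.
have ey : h y = k by rewrite hy e; lia.
have eg : obind g (Some b) = Some b' by [].
by have [h1 h2] := IH _ _ hR' ey; split; rewrite iterSr eg.
Qed.

Lemma string_length_inj g b k k' : string_length g b k -> string_length g b k' -> k = k'.
Proof.
have it j p : iter j (obind g) (Some b) = None -> iter (p + j) (obind g) (Some b) = None.
  by move=> e; rewrite iterD e; elim: p => //= p ->.
move=> [h1 h2] [h1' h2']; apply/eqP; rewrite eqn_leq; apply/andP; split.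
  rewrite leqNgt; apply/negP => lt; apply: h1.
  by have := it _ (k - k'.+1)%N h2'; rewrite subnK.
rewrite leqNgt; apply/negP => lt; apply: h1'.
by have := it _ (k' - k.+1)%N h2; rewrite subnK.
Qed.

Definition toV (b : elt) : vec :=
  Vec (x1 b) (x2 b) (x3 b) ((y3 b - x3 b) %/ 2)%Z (y2 b) (y1 b).

Lemma toEK v : toV (toE v) = v.
Proof. by case: v => x1 x2 x3 w y2 y1; rewrite /toV /toE /=; congr Vec; lia. Qed.

Lemma component_model l i j0 j1 : comp_index l (i, j0, j1) ->
  crystal_isomorphic (component_crystal l (i, j0, j1)) (model_crystal j0 j1).
Proof.
move=> ht; set t := (i, j0, j1).
have vmE v : vinv v = tinv l t -> vm l v = j0 /\ vn l v = j1.
  move=> [_ e0 e1]; rewrite /vm /vn e0 e1.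
  by have [z0 [z1 [? ? ? ?]]] := (comp_indexP _ _ _ _).1 ht; rewrite /yidx; split; lia.
have rngE v : okv l v -> vinv v = tinv l t -> rngt j0 j1 (vPhi l v).
  by move=> ok iv; have [hm hn] := vmE _ iv; apply: rngt_vPhi.
pose psi b := vPhi l (toV b).
have fP a b : okI l (tinv l t) b -> if mf j0 j1 a (psi b) is Some y then
    exists b', [/\ fB l a b = Some b', okI l (tinv l t) b' & psi b' = y]
  else fB l a b = None.
  move=> [v [-> ok iv]]; have [hm hn] := vmE _ iv; rewrite /psi toEK.
  have := f_model ok hm hn a; case: mf => // y [v' [-> ok' iv' ph']].
  by exists (toE v'); rewrite toEK; split=> //; exists v'; rewrite iv' iv.
have eP a b : okI l (tinv l t) b -> if me j0 j1 a (psi b) is Some y then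
    exists b', [/\ eB l a b = Some b', okI l (tinv l t) b' & psi b' = y]
  else eB l a b = None.
  move=> [v [-> ok iv]]; have [hm hn] := vmE _ iv; rewrite /psi toEK.
  have := e_model ok hm hn a; case: me => // y [v' [-> ok' iv' ph']].
  by exists (toE v'); rewrite toEK; split=> //; exists v'; rewrite iv' iv.
rewrite /component_crystal componentE//; exists (omap psi); split=> //=.
- split.
  + move=> _ [b [v [-> ok iv]] <-] /=; exists (vPhi l v); last by rewrite /psi toEK.
    exact: rngE.
  + move=> b b'; rewrite !inE => -[_ [v [-> ok iv] <-]] [_ [v' [-> ok' iv'] <-]] /=.
    move=> /Some_inj; rewrite /psi !toEK => e; congr (Some (toE _)).
    by apply: vPhi_inj ok ok' _ e; rewrite iv iv'.
  move=> _ [x hx <-].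
  suff [b hb e] : exists2 b, okI l (tinv l t) b & psi b = x.
    by exists (Some b); [exists b | rewrite /= e].
  (* Surjectivity: start at bbar, over (0, 0, 0), and follow the lowering operators. *)
  elim/(@model_ind j0 j1): x / hx => [|a x y hx [b hb e] hxy].
    have [v0 [_ ok iv ph]] := bbar_props ht; exists (toE v0); first by exists v0.
    by rewrite /psi toEK.
  by have := fP a b hb; rewrite e hxy => -[b' [_ hb' e']]; exists b'.
- move=> a _ [b hb <-] /=; have := eP a b hb.
  by case: (me _ _ _ _) => [y [b' [-> _ <-]]|->].
- move=> a _ [b hb <-] /=; have := fP a b hb.
  by case: (mf _ _ _ _) => [y [b' [-> _ <-]]|->].
move=> _ mu [b hb <-] /=.
pose R b x := okI l (tinv l t) b /\ x = psi b.
have Rrng b' x : R b' x -> rngt j0 j1 x.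
  by move=> [[v [-> ok iv] ->]]; rewrite /psi toEK; apply: rngE.
have hstr a : exists eps phi : nat, [/\ string_length (eB l a) b eps,
    string_length (fB l a) b phi & mwt j0 j1 (psi b) a = phi%:Z - eps%:Z].
  have hR : R b (psi b) by [].
  have [||k hk ek] := @string_length_transfer _ R (eB l a) (me j0 j1 a) (meps a) _ _ _ _ hR.
  - by move=> b' x /Rrng; apply: meps_ge0.
  - move=> b' x hR'; have := meps_me a (Rrng _ _ hR').
    case: hR' => hb' ->; have := eP a b' hb'; case: me => // y [b1 [h1 h2 h3]] hy.
    by split=> //; exists b1.
  have [||p hp ep] := @string_length_transfer _ R (fB l a) (mf j0 j1 a) (mphi j0 j1 a) _ _ _ _ hR.
  - by move=> b' x /Rrng; apply: mphi_ge0.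
  - move=> b' x hR'; have := mphi_mf a (Rrng _ _ hR').
    case: hR' => hb' ->; have := fP a b' hb'; case: mf => // y [b1 [h1 h2 h3]] hy.
    by split=> //; exists b1.
  by exists k, p; rewrite mwtE ek ep.
split=> [[_ /Some_inj <- hw]|[_ /Some_inj <- ->]]; last by exists b.
(* A string has one length, so the weight in B_l is unique. *)
exists (psi b) => //; apply: funext => a.
have [k [p [hk hp ->]]] := hw a; have [k' [p' [hk' hp' ->]]] := hstr a.
by rewrite (string_length_inj hk hk') (string_length_inj hp hp').
Qed.

Theorem theorem5p3 (l : nat) (hl : (0 < l)%N) :
  [/\ forall i j0 j1 : nat, comp_index l (i, j0, j1) -> Bl l (bbar l i j0 j1),
      Bl l = \bigcup_(t in comp_index l) component l t,
      trivIset (comp_index l) (component l)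
    & forall i j0 j1 : nat, comp_index l (i, j0, j1) ->
        isomorphic_to_BA2 (a2_weight j0 j1)
                          (component_crystal l (i, j0, j1))].
Proof.
split.
- by move=> i j0 j1 /bbar_props[v [-> ok _ _]]; rewrite /Bl /= okvE.
- exact: Bl_components.
- exact: trivIset_component.
move=> i j0 j1 ht V M u irr hu.
exact: crystal_isomorphic_trans (component_model ht) (model_isomorphic irr hu).
Qed.
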